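(* Let $G$ be a service distribution satisfying the standing assumptions (A1) and (A2) of the context, and fix $\lambda\in(0,1]$ and $d\in\mathbb{N}$. Then there exists a physical invariant state of the hydrodynamic equations with arrival rate $\lambda$ if and only if there exists a sequence of measurable functions $\{r_\ell\}_{\ell\in\mathbb{N}}$ on $[0,\infty)$, continuously differentiable on $[0,L)$, such that $r_\ell(x)=0$ for $x\notin[0,L)$ and, for $x\in[0,L)$, $r_1(x)=\lambda$ and for $\ell\ge 2$ $$r_\ell(x)=\lambda (s_\ell^* )^d e^{-\lambda\mathfrak{P}_d(s_{\ell-1}^*,s_\ell^* )x}+\lambda\mathfrak{P}_d(s_{\ell-1}^*,s_\ell^* )\int_0^x e^{-\lambda\mathfrak{P}_d(s_{\ell-1}^*,s_\ell^* )(x-u)}r_{\ell-1}(u)\,du,$$ where for $\ell\ge1$ $$s_\ell^*=\int_0^L r_\ell(x)\bar G(x)\,dx.$$ In this case, the physical invariant state $\nu^*=(\nu^*_\ell)_{\ell\in\mathbb{N}}$ and the functions $r_\ell$ are related by $$\nu_\ell^*(A)=\int_A r_\ell(x)\bar G(x)\,dx,\qquad A\in\mathcal{B}([0,L)),\ \ell\in\mathbb{N}.$$ Furthermore, a physical invariant state of the hydrodynamic equations with arrival rate $\lambda$ always exists, and also satisfies $$\lambda(s_{\ell-1}^* )^d=\int_0^L g(x)r_\ell(x)\,dx,\qquad \ell\ge2.$$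
   Context: Service distribution. (A1): $G$ is the cumulative distribution function of a distribution on $[0,\infty)$ with a density $g$ and mean $1$. Put $\bar G=1-G$, $L=\sup\{x\in[0,\infty):\bar G(x)>0\}$ and $h(x)=g(x)/\bar G(x)$ for $x\in[0,L)$. Notation. $\mathbb{N}=\{1,2,\dots\}$; $\langle f,\mu\rangle=\int f\,d\mu$; $\mathbf 1$ is the constant function $1$; $\mathcal{B}(\cdot)$ denotes Borel sets; $\mathbb{C}_b[0,\infty)$ is the space of bounded continuous functions on $[0,\infty)$; $\mathbb{M}_{\le1}[0,L)$ is the space of sub-probability measures on $[0,L)$ (weak topology); $$\mathbb{S}=\{(\mu_\ell)_{\ell\in\mathbb{N}}\in\mathbb{M}_{\le1}[0,L)^{\mathbb{N}}:\langle f,\mu_\ell\rangle\ge\langle f,\mu_{\ell+1}\rangle\ \forall \ell\in\mathbb{N},\ \forall f\in\mathbb{C}_b[0,\infty),\ f\ge0\};$$ $\mathbb{C}_{\mathbb{S}}[0,\infty)$ is the set of continuous $\mathbb{S}$-valued functions on $[0,\infty)$; $\mathfrak{P}_d(x,y)=\sum_{m=0}^{d-1}x^my^{d-1-m}$ (which equals $(x^d-y^d)/(x-y)$ when $x\ne y$). Hydrodynamic equations. Given $\lambda>0$ and $\nu(0)\in\mathbb{S}$, a function $\nu=(\nu_\ell(t);\ell\in\mathbb{N},t\ge0)\in\mathbb{C}_{\mathbb{S}}[0,\infty)$ solves the hydrodynamic equations associated with $(\lambda,\nu(0))$ if for every $t\ge0$: $\int_0^t\langle h,\nu_1(s)\rangle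 ds<\infty$; for every $\ell\in\mathbb{N}$, $\langle\mathbf 1,\nu_\ell(t)\rangle-\langle\mathbf 1,\nu_\ell(0)\rangle=D_{\ell+1}(t)+\int_0^t\langle\mathbf 1,\eta_\ell(s)\rangle ds-D_\ell(t)$; and for every $\ell\in\mathbb{N}$ and $f\in\mathbb{C}_b[0,\infty)$, $$\langle f,\nu_\ell(t)\rangle=\Big\langle f(\cdot+t)\tfrac{\bar G(\cdot+t)}{\bar G(\cdot)},\nu_\ell(0)\Big\rangle+\int_{[0,t]}f(t-s)\bar G(t-s)\,dD_{\ell+1}(s)+\int_0^t\Big\langle f(\cdot+t-s)\tfrac{\bar G(\cdot+t-s)}{\bar G(\cdot)},\eta_\ell(s)\Big\rangle ds,$$ where $D_\ell(t)=\int_0^t\langle h,\nu_\ell(s)\rangle ds$, $\eta_1(t)=\lambda(1-\langle\mathbf 1,\nu_1(t)\rangle^d)\delta_0$ and, for $\ell\ge2$, $\eta_\ell(t)=\lambda\mathfrak{P}_d(\langle\mathbf 1,\nu_{\ell-1}(t)\rangle,\langle\mathbf 1,\nu_\ell(t)\rangle)(\nu_{\ell-1}(t)-\nu_\ell(t))$. (A2): there exists a unique solution to the hydrodynamic equations (for each initial condition $\nu(0)\in\mathbb{S}$). Invariant states. $\nu^*\in\mathbb{S}$ is an invariant state of the hydrodynamic equations with arrival rate $\lambda$ if $\nu(t)=\nu^*$ for all $t\ge0$ solves the hydrodynamic equations associated with $(\lambda,\nu^* )$. For an invariant state put $s_\ell^*=\langle\mathbf 1,\nu_\ell^*\rangle$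 (the invariant queue length distribution). It is a physical invariant state if in addition $\lim_{\ell\to\infty}s_\ell^*=0$.
   Formalization: At λ=1 existence and the equivalence fail (the equations force s_ℓ*=1 for all ℓ, and r_ℓ=1 solves the system), so these and the passage from r_ℓ to ν* are stated for λ<1; that passage is stated for r_ℓ≥0, as needed for the formula to define measures. *)

(* Defs.v *)
From mathcomp Require Import all_boot all_order all_algebra.
From mathcomp Require Import all_classical all_reals all_analysis.

Set Implicit Arguments.
Unset Strict Implicit.
Unset Printing Implicit Defensive.

Import Order.TTheory GRing.Theory Num.Theory.
Import numFieldNormedType.Exports.

Local Open Scope classical_set_scope.
Local Open Scope ring_scope.

(* Sequences indexed by {1, 2, ...} are functions on [nat] whose value at 0 is
   irrelevant; functions of time or age live on [R], and only their values on
   the half-line [0, +oo[ matter. *)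

Section LoadBalancing.
Context {R : realType}.

(* G is the cdf of a distribution carried by [0, +oo[ with density g and
   mean 1. *)
Definition service_distribution (G g : R -> R) : Prop :=
  exists P : probability (measurableTypeR R) R,
    [/\ P `[0, +oo[%classic = 1%E,
        forall x, G x = fine (P `]-oo, x]%classic),
        measurable_fun (`[0, +oo[%classic : set (measurableTypeR R)) g
          /\ (forall x, 0 <= x -> 0 <= g x),
        forall A : set (measurableTypeR R),
          measurable A -> A `<=` `[0, +oo[%classic ->
          P A = (\int[lebesgue_measure]_(x in A) (g x)%:E)%E
      & (\int[P]_x x%:E)%E = 1%E].

Definition tail (G : R -> R) (x : R) : R := 1 - G x.

Definition right_end (G : R -> R) : \bar R :=
  ereal_sup [set x%:E | x in [set x | 0 <= x /\ 0 < tail G x]].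

(* the interval [0, L), where L may be +oo *)
Definition age_space (G : R -> R) : set R :=
  [set x | 0 <= x /\ (x%:E < right_end G)%E].

Definition hazard (G g : R -> R) (x : R) : R := g x / tail G x.

Definition Cb (A : set R) (f : R -> R) : Prop :=
  {within A, continuous f} /\ [bounded f x | x in A].

(* Elements of M_{<=1}[0,L) are encoded as sub-probabilities on R that do not
   charge the complement of [0,L). *)
Definition mseq := nat -> subprobability (measurableTypeR R) R.

Definition pairing (G : R -> R) (f : R -> R)
    (mu : {measure set (measurableTypeR R) -> \bar R}) : R :=
  \int[mu]_(x in age_space G) f x.

Definition mass (G : R -> R) (mu : {measure set (measurableTypeR R) -> \bar R})
  : R := pairing G (fun=> 1) mu.

Definition in_S (G : R -> R) (mu : mseq) : Prop :=
  (forall l, (1 <= l)%N -> mu l (~` age_space G) = 0%E) /\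
  (forall l (f : R -> R), (1 <= l)%N -> Cb `[0, +oo[ f ->
     (forall x, 0 <= x -> 0 <= f x) ->
     pairing G f (mu l.+1) <= pairing G f (mu l)).

(* Continuity for the product of the weak topologies, i.e. of the initial
   topologies of the maps mu |-> <f, mu> for f in C_b[0,L). *)
Definition continuous_in_S (G : R -> R) (nu : R -> mseq) : Prop :=
  (forall t, 0 <= t -> in_S G (nu t)) /\
  (forall l (f : R -> R), (1 <= l)%N -> Cb (age_space G) f ->
     {within `[0, +oo[, continuous (fun t => pairing G f (nu t l))}).

Definition Pd (d : nat) (x y : R) : R :=
  \sum_(m < d) x ^+ m * y ^+ (d.-1 - m).

(* <h, mu>, possibly infinite *)
Definition hazard_rate (G g : R -> R)
    (mu : {measure set (measurableTypeR R) -> \bar R}) : \bar R :=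
  (\int[mu]_(x in age_space G) (hazard G g x)%:E)%E.

Definition departures_ext (G g : R -> R) (nu : R -> mseq) (l : nat) (t : R)
  : \bar R :=
  (\int[lebesgue_measure]_(s in `[0%R, t]) hazard_rate G g (nu s l))%E.

Definition departures (G g : R -> R) (nu : R -> mseq) (l : nat) (t : R) : R :=
  fine (departures_ext G g nu l t).

(* <f, eta_l> where eta is determined by the state mu; for l >= 2 eta_l is a
   multiple of a difference of two measures, paired with f by linearity. *)
Definition arrivals (G : R -> R) (lam : R) (d : nat) (mu : mseq) (l : nat)
    (f : R -> R) : R :=
  if l == 1%N then
    lam * (1 - mass G (mu 1%N) ^+ d) *
      \int[\d_(0 : measurableTypeR R)]_(x in age_space G) f x
  else
    lam * Pd d (mass G (mu l.-1)) (mass G (mu l)) *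
      (pairing G f (mu l.-1) - pairing G f (mu l)).

(* the function x |-> f(x + t) * Gbar(x + t) / Gbar(x) *)
Definition aged (G : R -> R) (f : R -> R) (t : R) (x : R) : R :=
  f (x + t) * (tail G (x + t) / tail G x).

(* In the last clause dD_(l+1) is the Lebesgue-Stieltjes measure of D_(l+1),
   extended by 0 to negative times; since D_(l+1)(0) = 0, there is no atom
   at 0. *)
Definition solves_hydrodynamic (G g : R -> R) (lam : R) (d : nat)
    (nu0 : mseq) (nu : R -> mseq) : Prop :=
  [/\ continuous_in_S G nu,
      forall l, (1 <= l)%N ->
        forall A : set (measurableTypeR R), measurable A -> nu 0 l A = nu0 l A,
      forall t, 0 <= t -> (departures_ext G g nu 1 t < +oo)%E,
      forall t l, 0 <= t -> (1 <= l)%N ->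
        mass G (nu t l) - mass G (nu 0 l) =
          departures G g nu l.+1 t
          + \int[lebesgue_measure]_(s in `[0, t])
              arrivals G lam d (nu s) l (fun=> 1)
          - departures G g nu l t
    & forall l, (1 <= l)%N ->
        exists2 D : cumulative R R,
          forall s, D s = if 0 <= s then departures G g nu l.+1 s else 0
        & forall t (f : R -> R), 0 <= t -> Cb `[0, +oo[ f ->
          pairing G f (nu t l) =
            pairing G (aged G f t) (nu 0 l)
            + \int[lebesgue_stieltjes_measure D]_(s in `[0, t])
                (f (t - s) * tail G (t - s))
            + \int[lebesgue_measure]_(s in `[0, t])
                arrivals G lam d (nu s) l (aged G f (t - s))].

(* Uniqueness is equality on measurable sets: the value of a measure on a
   non-measurable set carries no information. *)
Definition hydrodynamic_well_posed (G g : R -> R) (lam : R) (d : nat) : Prop :=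
  forall nu0 : mseq, in_S G nu0 ->
    (exists nu, solves_hydrodynamic G g lam d nu0 nu) /\
    (forall nu nu', solves_hydrodynamic G g lam d nu0 nu ->
       solves_hydrodynamic G g lam d nu0 nu' ->
       forall t l, 0 <= t -> (1 <= l)%N ->
       forall A : set (measurableTypeR R), measurable A ->
         nu t l A = nu' t l A).

Definition invariant_state (G g : R -> R) (lam : R) (d : nat) (nu : mseq)
  : Prop :=
  in_S G nu /\ solves_hydrodynamic G g lam d nu (fun=> nu).

Definition physical_invariant_state (G g : R -> R) (lam : R) (d : nat)
    (nu : mseq) : Prop :=
  invariant_state G g lam d nu /\ (fun l => mass G (nu l)) @ \oo --> (0 : R).

(* f is C^1 on A, with derivatives taken relatively to A (hence one-sided at
   an endpoint of A that belongs to A) *)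
Definition continuously_differentiable_on (A : set R) (f : R -> R) : Prop :=
  exists2 df : R -> R,
    {within A, continuous df}
  & forall x, A x -> (fun y => (f y - f x) / (y - x)) @ within A x^' --> df x.

(* the numbers s_l^* computed from the functions r_l *)
Definition queue_length (G : R -> R) (r : nat -> R -> R) (l : nat) : R :=
  \int[lebesgue_measure]_(x in age_space G) (r l x * tail G x).

Definition age_system (G : R -> R) (lam : R) (d : nat) (r : nat -> R -> R)
  : Prop :=
  let s := queue_length G r in
  let a l := lam * Pd d (s l.-1) (s l) in
  (forall l, (1 <= l)%N ->
    [/\ measurable_fun (`[0, +oo[%classic : set (measurableTypeR R)) (r l),
        continuously_differentiable_on (age_space G) (r l),
        forall x, 0 <= x -> ~ age_space G x -> r l x = 0
      & lebesgue_measure.-integrable (age_space G)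
          (fun x => (r l x * tail G x)%:E)]) /\
  (forall x, age_space G x -> r 1%N x = lam) /\
  (forall l x, (2 <= l)%N -> age_space G x ->
    r l x = lam * s l ^+ d * expR (- (a l * x))
      + a l * \int[lebesgue_measure]_(u in `[0, x])
                (expR (- (a l * (x - u))) * r l.-1 u)).

Definition state_of_ages (G : R -> R) (nu : mseq) (r : nat -> R -> R) : Prop :=
  forall l (A : set (measurableTypeR R)), (1 <= l)%N -> measurable A ->
    A `<=` age_space G ->
    nu l A = (\int[lebesgue_measure]_(x in A) (r l x * tail G x)%:E)%E.

End LoadBalancing.

(* Main.v *)
Require Import Defs.
From HB Require Import structures.
From mathcomp Require Import all_boot all_order all_algebra.
From mathcomp Require Import all_classical all_reals all_analysis.
From mathcomp Require Import measurable_realfun ring lra.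

Set Implicit Arguments.
Unset Strict Implicit.
Unset Printing Implicit Defensive.

Import Order.TTheory GRing.Theory Num.Theory.
Import numFieldNormedType.Exports.

Local Open Scope classical_set_scope.
Local Open Scope ring_scope.

(* Along an invariant state the departure rates h_l = <h, nu_l> are constant, and
   the mass equations give h_(l+1) = h_1 - lam + lam (s_l)^d. Integrating the
   ageing dynamics, nu_1 must have density h_1 Gbar; and if nu_(l-1) has density
   r_(l-1) Gbar, then nu_l has density r_l Gbar, where
     r_l' = a_l (r_(l-1) - r_l),  r_l(0) = h_(l+1),
     a_l = lam Pd(s_(l-1), s_l):
   the difference phi(t) of the pairings of nu_l and of r_l Gbar with an aged test
   function satisfies phi(t) = phi(0) + a_l int_0^t phi and tends to 0 at infinity,
   hence phi(0) = 0. As 0 <= h_(l+1) <= s_l -> 0 for a physical state, h_1 = lam,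
   so that h_(l+1) = lam (s_l)^d.

   Conversely, Tonelli's theorem gives int g r_l = lam (s_(l-1))^d for every
   nonnegative solution. If s_l > s_(l-1), then r_l > lam (s_(l-1))^d everywhere,
   which contradicts this identity; so s_l is nonincreasing, all the r_l are
   nondecreasing and r_l <= r_(l-1). The limit s of s_l satisfies s = lam s^d, so
   s = 0 as lam < 1. A solution is built by choosing the s_l successively in
   [0, s_(l-1)] with the intermediate value theorem. *)

(** * Linear equations of the first order *)

(** The system is implicit: [s_l] enters the initial value and the rate of [r_l], and is itself an
    integral of [r_l]. The hinge is that the [s_l] do not increase; then neither do the initial
    values, and comparison gives monotone functions with [r_l <= r_(l-1)]. This property has three
    sources: the order that defines the states, the flow identity for a given solution, and the
    interval searched in the construction. Past that point the three cases share the same lemmas. An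
    invariant state is not known to have a density. The comparison with [r_l Gbar] is therefore
    weak, one bounded continuous test function at a time. The equation for [phi] has growth rate
    [+a_l]; it propagates the value at 0 forward, and a nonzero value is ruled out by the decay of
    the ageing factor [Gbar(x + t) / Gbar(x)]. The functions of age are solved on the whole
    half-line, whether [L] is finite or not, and extended to negative ages by their value at 0.
    Beyond [L] this is harmless: [Gbar] vanishes there and [g] is 0 almost everywhere. *)

Section Primitive.
Context {R : realType}.
Notation leb := (@lebesgue_measure R).
Implicit Types (k f W : R -> R) (a x y t : R).

Lemma integrable_continuous_itv k x y : continuous k ->
  leb.-integrable `[x, y] (EFin \o k).
Proof.
move=> ck; apply: continuous_compact_integrable; first exact: segment_compact.
exact: continuous_subspaceT.
Qed.

Lemma Rintegral_itvD k x y z : continuous k -> x <= y -> y <= z ->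
  \int[leb]_(u in `[x, z]) k u =
  \int[leb]_(u in `[x, y]) k u + \int[leb]_(u in `[y, z]) k u.
Proof.
move=> ck xy yz.
rewrite -[X in _ + X]Rintegral_itv_obnd_cbnd; last first.
  apply: integrableS (integrable_continuous_itv y z ck) => //.
  exact: subset_itv_oc_cc.
rewrite -(@Rintegral_itvB _ k (BLeft x) (BRight z) y) ?bnd_simp//; first by rewrite addrC subrK.
exact: integrable_continuous_itv.
Qed.

(** The base point -1 makes 0 an interior point, so that the derivative at 0 is two-sided. *)
Lemma primitive_continuous k : continuous k ->
  exists K : R -> R, (forall x, -1 < x -> is_derive x (1 : R) K (k x)) /\
    (forall x y, 0 <= x -> x <= y -> K y - K x = \int[leb]_(u in `[x, y]) k u).
Proof.
move=> ck; exists (fun x => \int[leb]_(u in `[-1, x]) k u); split => [x x1|x y x0 xy].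
  have xu : x < x + 1 by rewrite ltrDl.
  have [dK] := @continuous_FTC1_closed R k (-1) x (x + 1) xu
    (integrable_continuous_itv _ _ ck) x1 (ck x).
  by rewrite derive1E => <-; exact: DeriveDef.
rewrite (@Rintegral_itvD k _ x y)//; first by rewrite addrC addKr.
by rewrite (le_trans _ x0)// oppr_le0.
Qed.

Lemma gtN1_derive_within_continuous W w x y :
  (forall x, -1 < x -> is_derive x (1 : R) W (w x)) -> 0 <= x ->
  {within `[x, y], continuous W}.
Proof.
move=> dW x0; apply: derivable_within_continuous => z /[!in_itv]/= /andP[xz _].
have := dW z; rewrite (lt_le_trans _ (le_trans x0 xz)) ?ltrN10// => /(_ isT) H.
exact: ex_derive.
Qed.

(** Only the values of [w] inside []0, t[] enter the mean value theorem, which spares a discussion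
    of the point 0. *)
Lemma derive0_const W w t : (forall x, -1 < x -> is_derive x (1 : R) W (w x)) ->
  (forall x, 0 < x -> w x = 0) -> 0 <= t -> W t = W 0.
Proof.
move=> dW w0; rewrite le_eqVlt => /predU1P[<-//|t0].
have [|c ct] := @MVT R W w 0 t t0 _ (gtN1_derive_within_continuous dW (lexx 0)).
  by move=> x /[!in_itv]/= /andP[x0 _]; apply: dW; rewrite (lt_trans _ x0)// ltrN10.
rewrite w0; first by rewrite mul0r => /eqP; rewrite subr_eq0 => /eqP.
by move: ct => /[!in_itv]/= /andP[].
Qed.

Lemma is_derive_expRM a x :
  is_derive x (1 : R) (fun u => expR (a * u)) (a * expR (a * x)).
Proof.
have H : is_derive x (1:R) (fun u => a * u) a.
  by have := is_deriveZ a (is_derive_id x (1 : R)); rewrite /GRing.scale/= mulr1.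
have := is_derive1_comp (is_derive_expR (a * x)) H.
by rewrite /comp /= mulrC.
Qed.

(* The equation forces phi t = phi 0 e^(at), of modulus at least |phi 0|. *)
Lemma exp_ode_zero (phi : R -> R) a : 0 <= a -> continuous phi ->
  (forall t, 0 <= t -> phi t = phi 0 + a * \int[leb]_(u in `[0, t]) phi u) ->
  (fun n : nat => phi n%:R) @ \oo --> (0 : R) -> phi 0 = 0.
Proof.
move=> a0 cphi hphi phi0.
have [K [dK KE]] := primitive_continuous cphi.
(* [phi] is unconstrained at negative times; [Z] agrees with it on the half-line and is
   differentiable at 0. *)
pose Z t := phi 0 + a * (K t - K 0).
have ZE t : 0 <= t -> Z t = phi t by move=> t0; rewrite /Z KE// -hphi.
have dZ x : -1 < x -> is_derive x (1:R) Z (a * phi x).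
  move=> x1; have := dK x x1 => dKx.
  have -> : Z = cst (phi 0 - a * K 0) + a *: K.
    by apply/funext => t; rewrite /Z !fctE /GRing.scale/=; ring.
  have := is_deriveD (is_derive_cst (phi 0 - a * K 0) x (1 : R)) (is_deriveZ a dKx).
  by rewrite add0r.
have phiE t : 0 <= t -> phi t = phi 0 * expR (a * t).
  move=> t0.
  have dW x : -1 < x -> is_derive x (1:R) ((fun u => expR ((- a) * u)) * Z)
      (expR ((- a) * x) * (a * phi x - a * Z x)).
    move=> x1; have := dZ x x1 => dZx.
    have dEx := is_derive_expRM (- a) x.
    by apply: is_derive_eq; rewrite /GRing.scale/=; ring.
  have := derive0_const dW _ t0.
  rewrite !fctE mulr0 expR0 mul1r !ZE// mulNr expRN => <-.
    by rewrite mulrAC mulVf ?mul1r// gt_eqF// expR_gt0.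
  by move=> x x0; rewrite ZE ?ltW// subrr mulr0.
have cv : (fun n : nat => `|phi n%:R|) @ \oo --> `|0 : R| by apply: cvg_norm.
apply/eqP; rewrite -normr_eq0 eq_le normr_ge0 andbT -[leRHS](normr0 R) -(cvg_lim _ cv)//.
apply: limr_ge; first by apply/cvg_ex; exists `|0:R|; apply: cvg_norm.
apply: nearW => n. rewrite (phiE n%:R)// normrM ler_peMr// ger0_norm ?expR_ge0//.
by rewrite -[leLHS]expR0 ler_expR mulr_ge0.
Qed.
End Primitive.

(** * Variation of constants and comparison *)

Section Volterra.
Context {R : realType}.
Notation leb := (@lebesgue_measure R).
Implicit Types (k f w W r : R -> R) (a c x y t M : R).

Lemma primitive_unique k W w x y :
  continuous k -> (forall x, -1 < x -> is_derive x (1 : R) W (w x)) ->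
  (forall x, 0 < x -> w x = k x) -> 0 <= x -> x <= y ->
  W y - W x = \int[leb]_(u in `[x, y]) k u.
Proof.
move=> ck dW wk x0 xy.
have [K [dK <-//]] := primitive_continuous ck.
have dWK (z : R) : -1 < z -> is_derive z (1 : R) (W - K) (w z - k z).
  by move=> z1; have := is_deriveB (dW z z1) (dK z z1).
have E (z : R) : 0 <= z -> W z - K z = W 0 - K 0.
  by move=> z0; apply: (derive0_const dWK _ z0) => u /wk ->; rewrite subrr.
have := E _ x0; have := E _ (le_trans x0 xy); lra.
Qed.

(** Variation of constants for the equation [w' = a (r - w)], [w 0 = c]. *)
Definition volterra a c r x :=
  c * expR (- (a * x)) +
  a * \int[leb]_(u in `[0, x]) (expR (- (a * (x - u))) * r u).

Lemma continuous_expRM a : continuous (fun u : R => expR (a * u)).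
Proof.
move=> x; apply: differentiable_continuous; apply/derivable1_diffP.
by have := is_derive_expRM a x => -[].
Qed.

Lemma continuous_expM a r : continuous r -> continuous (fun u => expR (a * u) * r u).
Proof. by move=> cr x; apply: cvgM; [exact: continuous_expRM|exact: cr]. Qed.

(** Taking [x] out of the integrand leaves an exponential times a primitive, which can be
    differentiated and compared. *)
Lemma volterraE a c r x : continuous r ->
  volterra a c r x = expR (- a * x) *
    (c + a * \int[leb]_(u in `[0, x]) (expR (a * u) * r u)).
Proof.
move=> cr; rewrite /volterra mulrDr mulNr [c * _]mulrC; congr (_ + _).
rewrite mulrCA; congr (_ * _).
rewrite -RintegralZl//; last exact/integrable_continuous_itv/continuous_expM.
apply: eq_Rintegral => u _.
by rewrite mulrA -expRD; congr (expR _ * _); ring.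
Qed.

Lemma volterra0 a c r : continuous r -> volterra a c r 0 = c.
Proof.
by move=> cr; rewrite volterraE// mulr0 expR0 mul1r set_itv1 Rintegral_set1 mulr0 addr0.
Qed.

(** Below 0 the interval [[0, x]] is empty, and the left derivative of [volterra] at 0 is in general
    the wrong one. [W] uses a primitive instead of the integral, which repairs this and keeps the
    values on the half-line. *)
Lemma volterra_ode a c r : continuous r ->
  exists W, (forall x, 0 <= x -> volterra a c r x = W x) /\
    (forall x, -1 < x -> is_derive x (1 : R) W (a * (r x - W x))).
Proof.
move=> cr; have [K [dK KE]] := primitive_continuous (continuous_expM (a := a) cr).
exists ((fun u => expR (- a * u)) * (cst (c - a * K 0) + a *: K)); split => [x x0|x x1].
  rewrite volterraE// !fctE -KE//; congr (_ * _); rewrite /GRing.scale/=; ring.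
have dEx := is_derive_expRM (- a) x.
have dKx := is_deriveD (is_derive_cst (c - a * K 0) x (1 : R)) (is_deriveZ a (dK x x1)).
rewrite add0r in dKx.
have := is_deriveM dEx dKx.
set u := (X in is_derive _ _ _ X); set v := (X in _ -> is_derive _ _ _ X).
suff -> : u = v by [].
rewrite /u /v !fctE /GRing.scale/= -[a *: K x]/(a * K x).
have E : expR (- a * x) * expR (a * x) = 1 by rewrite -expRD mulNr addNr expR0.
transitivity (a * r x * (expR (- a * x) * expR (a * x)) - a * (expR (- a * x) * (c - a * K 0 + a * K x))); first ring.
rewrite E; ring.
Qed.

Lemma continuous_max0 k : (forall x, -1 < x -> {for x, continuous k}) ->
  continuous (fun x : R => k (Num.max x 0)).
Proof.
move=> ck x; apply: continuous_comp.
  by apply: continuous_max; [exact: cvg_id|exact: cvg_cst].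
by apply: ck; rewrite (lt_le_trans (ltrN10 R))// le_max lexx orbT.
Qed.

Lemma volterra_continuous a c r : continuous r ->
  continuous (fun x => volterra a c r (Num.max x 0)).
Proof.
move=> cr; have [W [WE dW]] := volterra_ode a c cr.
rewrite (_ : (fun x => _) = (fun x => W (Num.max x 0))); last first.
  by apply/funext => x; rewrite WE// le_max lexx orbT.
apply: continuous_max0 => x x1; apply: differentiable_continuous.
by apply/derivable1_diffP; have := dW x x1 => -[].
Qed.

(** The integral form of the equation is what the transport identities take as input; [Num.max u 0]
    keeps the integrand continuous on the line. *)
Lemma volterra_int a c r x y : continuous r -> 0 <= x -> x <= y ->
  volterra a c r y - volterra a c r x = \int[leb]_(u in `[x, y])
     (a * (r u - volterra a c r (Num.max u 0))).
Proof.
move=> cr x0 xy; have [W [WE dW]] := volterra_ode a c cr.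
rewrite !WE ?(le_trans x0)//; apply: (primitive_unique _ dW) => //.
  move=> u; apply: cvgM; first exact: cvg_cst.
  by apply: cvgB; [exact: cr|exact: volterra_continuous].
by move=> u u0; rewrite (max_idPl (ltW u0)) WE ?ltW.
Qed.

Lemma int_expRM a x : 0 <= x ->
  a * \int[leb]_(u in `[0, x]) expR (a * u) = expR (a * x) - 1.
Proof.
move=> x0; rewrite -RintegralZl//; last exact/integrable_continuous_itv/continuous_expRM.
have -> : expR (a * x) - 1 = expR (a * x) - expR (a * 0) by rewrite mulr0 expR0.
apply/esym/(@primitive_unique _ (fun u => expR (a * u)) (fun u => a * expR (a * u))) => //.
  by move=> u; apply: cvgM; [exact: cvg_cst|exact: continuous_expRM].
by move=> u _; exact: is_derive_expRM.
Qed.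

(** For [a] and [x] nonnegative this is a convex combination of [c] and [M], so comparison with
    constant sources yields all the bounds below. *)
Lemma volterra_cst a c M x : 0 <= x -> volterra a c (cst M) x =
  c * expR (- (a * x)) + M * (1 - expR (- (a * x))).
Proof.
move=> x0; rewrite volterraE; last exact: cst_continuous.
rewrite RintegralZr//; last exact/integrable_continuous_itv/continuous_expRM.
rewrite mulrA int_expRM// mulNr expRN.
have : expR (a * x) != 0 by rewrite gt_eqF ?expR_gt0.
by move=> e0; field; exact: e0.
Qed.

Lemma volterra_le a c c' r r' x : continuous r -> continuous r' -> 0 <= a -> 
  c <= c' -> (forall u, 0 <= u -> u <= x -> r u <= r' u) ->
  volterra a c r x <= volterra a c' r' x.
Proof.
move=> cr cr' a0 cc' rM; rewrite !volterraE//.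
rewrite ler_wpM2l ?expR_ge0// lerD// ler_wpM2l//.
apply: le_Rintegral => //; try exact/integrable_continuous_itv/continuous_expM.
by move=> u /=; rewrite in_itv/= => /andP[u0 ux]; rewrite ler_wpM2l ?expR_ge0// rM.
Qed.

Lemma volterra_ubound a c r x M : continuous r -> 0 <= a -> 0 <= x ->
  (forall u, 0 <= u -> u <= x -> r u <= M) -> c <= M -> volterra a c r x <= M.
Proof.
move=> cr a0 x0 rM cM.
apply: (le_trans (volterra_le cr (@cst_continuous _ _ M) a0 cM rM)).
by rewrite volterra_cst//; lra.
Qed.

Lemma volterra_lbound a c r x M : continuous r -> 0 <= a -> 0 <= x ->
  (forall u, 0 <= u -> u <= x -> M <= r u) -> M <= c -> M <= volterra a c r x.
Proof.
move=> cr a0 x0 rM cM.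
apply: le_trans (volterra_le (@cst_continuous _ _ M) cr a0 cM rM).
by rewrite volterra_cst//; lra.
Qed.

(** On [[0, x]] a nondecreasing source is at most [r x], and [volterra_ubound] applies with this
    constant. *)
Lemma volterra_le_source a c r x : continuous r -> 0 <= a -> 0 <= x ->
  {in `[0, +oo[ &, nondecreasing r} -> c <= r 0 -> volterra a c r x <= r x.
Proof.
move=> cr a0 x0 ndr cr0; apply: volterra_ubound => //.
  by move=> u u0 ux; apply: ndr => //; rewrite in_itv/= andbT.
by apply: (le_trans cr0); apply: ndr => //; rewrite in_itv/= ?lexx ?x0.
Qed.

(** The derivative [a (r - w)] is nonnegative by [volterra_le_source]; monotonicity thus passes from
    one level to the next. *)
Lemma volterra_nondecreasing a c r : continuous r -> 0 <= a ->
  {in `[0, +oo[ &, nondecreasing r} -> c <= r 0 ->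
  {in `[0, +oo[ &, nondecreasing (volterra a c r)}.
Proof.
move=> cr a0 ndr cr0 x y /[!in_itv]/= /[!andbT] x0 y0 xy.
rewrite -subr_ge0 volterra_int//; apply: Rintegral_ge0 => u /=.
rewrite in_itv/= => /andP[xu _]; have u0 := le_trans x0 xu.
by rewrite mulr_ge0// subr_ge0 (max_idPl u0) volterra_le_source.
Qed.
End Volterra.

(** * Tonelli's theorem on the triangle *)

Section Tonelli.
Local Open Scope ereal_scope.
Context d1 d2 (T1 : measurableType d1) (T2 : measurableType d2) (R : realType).
Variables (m1 : {sigma_finite_measure set T1 -> \bar R})
  (m2 : {sigma_finite_measure set T2 -> \bar R}).
Variables (E : set (T1 * T2)) (D1 : set T1) (D2 : set T2)
  (A : T1 -> set T2) (B : T2 -> set T1) (f : T1 * T2 -> \bar R).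
Hypotheses (mE : measurable E) (mf : measurable_fun setT f)
  (f0 : forall z, 0 <= f z)
  (EA : forall x y, E (x, y) <-> D1 x /\ A x y)
  (EB : forall x y, E (x, y) <-> D2 y /\ B y x).

Let fE := f \_ E.

Let mfE : measurable_fun setT fE.
Proof. by apply/(measurable_restrictT _ mE); exact: measurable_funTS. Qed.

Let fE0 z : 0 <= fE z.
Proof. by apply: erestrict_ge0 => ? _; exact: f0. Qed.

Let FE x : ((fun x => \int[m2]_(y in A x) f (x, y)) \_ D1) x = \int[m2]_y fE (x, y).
Proof.
rewrite patchE; case: ifPn => [|]; rewrite (inE, notin_setE) => D1x.
  rewrite integral_mkcond; apply: eq_integral => y _.
  rewrite /fE !patchE; congr (if _ then _ else _).
  by apply/idP/idP; rewrite !inE; [move=> ?; apply/EA|case/EA].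
rewrite (_ : (fun y => _) = cst 0) ?integral_cst ?mul0e//.
apply/funext => y; rewrite /fE patchE ifF//; apply/negP.
by rewrite inE => /EA[].
Qed.

Let GE y : ((fun y => \int[m1]_(x in B y) f (x, y)) \_ D2) y = \int[m1]_x fE (x, y).
Proof.
rewrite patchE; case: ifPn => [|]; rewrite (inE, notin_setE) => D1x.
  rewrite integral_mkcond; apply: eq_integral => x _.
  rewrite /fE !patchE; congr (if _ then _ else _).
  by apply/idP/idP; rewrite !inE; [move=> ?; apply/EB|case/EB].
rewrite (_ : (fun y => _) = cst 0) ?integral_cst ?mul0e//.
apply/funext => x; rewrite /fE patchE ifF//; apply/negP.
by rewrite inE => /EB[].
Qed.

(** Extending [f] by 0 outside [E] turns integrals over variable sections into integrals over the
    full factors, where the order can be exchanged. *)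
Lemma tonelli_sections :
  \int[m1]_(x in D1) \int[m2]_(y in A x) f (x, y) =
  \int[m2]_(y in D2) \int[m1]_(x in B y) f (x, y).
Proof.
rewrite integral_mkcond [RHS]integral_mkcond (funext FE) (funext GE).
exact: fubini_tonelli.
Qed.

Lemma measurable_sectionl : measurable D1 ->
  measurable_fun D1 (fun x => \int[m2]_(y in A x) f (x, y)).
Proof.
move=> mD1; apply/(measurable_restrictT _ mD1); rewrite (funext FE).
exact: measurable_fun_fubini_tonelli_F.
Qed.

Lemma measurable_sectionr : measurable D2 ->
  measurable_fun D2 (fun y => \int[m1]_(x in B y) f (x, y)).
Proof.
move=> mD2; apply/(measurable_restrictT _ mD2); rewrite (funext GE).
exact: measurable_fun_fubini_tonelli_G.
Qed.

End Tonelli.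

(** * Invariance of Lebesgue measure under translation and reflection *)

Section Invariance.
Context {R : realType}.
Notation leb := (@lebesgue_measure R).
Local Open Scope ereal_scope.

(** Lebesgue measure is determined by half-open intervals, so it equals its pushforward by [phi].
    The change of variables then holds for nonnegative functions, and for the others through their
    positive and negative parts. *)
Lemma integral_leb_invariant (phi : R -> R) (D : set R) (f : R -> \bar R) :
  measurable_fun [set: measurableTypeR R] (phi : measurableTypeR R -> measurableTypeR R) ->
  (forall X, ocitv X -> leb X = leb (phi @^-1` X)) ->
  measurable D -> measurable_fun D f ->
  \int[leb]_(x in phi @^-1` D) f (phi x) = \int[leb]_(x in D) f x.
Proof.
move=> mphi invo mD mf.
have inv (X : set (measurableTypeR R)) : measurable X -> leb X = leb (phi @^-1` X).
  exact: (@lebesgue_measure_unique R (measure_function_pushforward__canonical__measure_function_Measure leb mphi) invo).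
have ge0_inv (h : R -> \bar R) : measurable_fun D h -> (forall x, 0 <= h x) ->
    \int[leb]_(x in phi @^-1` D) h (phi x) = \int[leb]_(x in D) h x.
  move=> mh h0; rewrite -(ge0_integral_pushforward mphi leb mD mh)//.
  apply: eq_measure_integral => X mX _; exact/esym/inv.
rewrite integralE [RHS]integralE; congr (_ - _).
  by apply: etrans (ge0_inv _ (measurable_funepos mf) _); [apply: eq_integral => x _; rewrite ?funeposE ?funenegE|].
by apply: etrans (ge0_inv _ (measurable_funeneg mf) _); [apply: eq_integral => x _; rewrite ?funeposE ?funenegE|].
Qed.

Lemma integral_leb_shift (t : R) (D : set R) (f : R -> \bar R) :
  measurable D -> measurable_fun D f ->
  \int[leb]_(x in [set x | D (x + t)%R]) f (x + t)%R = \int[leb]_(x in D) f x.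
Proof.
apply: (@integral_leb_invariant (fun x => x + t)%R).
  exact: measurable_funD.
move=> _ [[a b] _ <-]/=.
rewrite (_ : _ @^-1` _ = `](a - t)%R, (b - t)%R]%classic); last first.
  by apply/seteqP; split => x /=; rewrite !in_itv/= ltrBlDr lerBrDr.
rewrite !lebesgue_measure_itv/= !lte_fin ltrD2r; case: ifPn => // _.
by rewrite -!EFinD; congr (_%:E); ring.
Qed.

Lemma integral_leb_reflect (t : R) (D : set R) (f : R -> \bar R) :
  measurable D -> measurable_fun D f ->
  \int[leb]_(x in [set x | D (t - x)%R]) f (t - x)%R = \int[leb]_(x in D) f x.
Proof.
apply: (@integral_leb_invariant (fun x => t - x)%R).
  exact: measurable_funB.
move=> _ [[a b] _ <-]/=.
rewrite (_ : _ @^-1` _ = `[(t - b)%R, (t - a)%R[%classic); last first.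
  by apply/seteqP; split => x /=; rewrite !in_itv/= andbC ltrBrDl lerBlDl -ltrBrDr -lerBlDr.
rewrite !lebesgue_measure_itv/= !lte_fin ltrD2l ltrN2; case: ifPn => // _.
by rewrite -!EFinD; congr (_%:E); ring.
Qed.

End Invariance.

(** * Transport of a density along the ages *)

Section Evolution.
Context {R : realType}.
Notation leb := (@lebesgue_measure R).
Local Open Scope ereal_scope.
Implicit Types (k q F : R -> R).

Let mtri : measurable [set z : measurableTypeR R * measurableTypeR R | (0 <= z.2 <= z.1)%R].
Proof.
rewrite (_ : [set _ | _] = (snd @^-1` `[0%R, +oo[) `&` ((fun z => z.1 - z.2)%R @^-1` `[0%R, +oo[)).
  apply: measurableI; rewrite -[X in measurable X]setTI.
    exact: measurable_snd.
  have : measurable_fun [set: measurableTypeR R * measurableTypeR R] (fun z => z.1 - z.2)%R.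
    by apply: measurable_funB; [exact: measurable_fst|exact: measurable_snd].
  exact.
by apply/seteqP; split => -[x y] /=; rewrite !in_itv/= !andbT subr_ge0 => /andP.
Qed.

Let mprod k q : measurable_fun setT k -> measurable_fun setT q ->
  measurable_fun [set: measurableTypeR R * measurableTypeR R] (fun z => (k z.1 * q z.2)%:E).
Proof.
move=> mk mq; apply/measurable_EFinP/measurable_funM.
  exact: measurableT_comp mk measurable_fst.
exact: measurableT_comp mq measurable_snd.
Qed.

Let triA (x y : R) : (0 <= y <= x)%R <-> `[0%R, +oo[%classic x /\ `[0%R, x]%classic y.
Proof.
rewrite /= !in_itv/= andbT; split => [|[]//] /[dup] h /andP[y0 yx].
by split; [exact: le_trans yx|].
Qed.

Let triB (x y : R) : (0 <= y <= x)%R <-> `[0%R, +oo[%classic y /\ `[y, +oo[%classic x.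
Proof. by rewrite /= !in_itv/= !andbT; split => /andP. Qed.

Let Zl (D : set R) (h : R -> R) (c : R) : measurable (D : set (measurableTypeR R)) ->
  measurable_fun setT h -> (forall x, 0 <= h x)%R -> (0 <= c)%R ->
  c%:E * \int[leb]_(x in D) (h x)%:E = \int[leb]_(x in D) (c * h x)%:E.
Proof.
move=> mD mh h0 c0; rewrite -ge0_integralZl//.
- by apply: measurable_funTS; exact/measurable_EFinP.
- by move=> *; rewrite lee_fin.
Qed.

(** When [k] is the service density, the inner integral on the right is the service tail: this is
    the source of the flow identity. *)
Lemma tonelli_tail k q : measurable_fun setT k -> measurable_fun setT q ->
  (forall x, 0 <= k x)%R -> (forall x, 0 <= q x)%R ->
  \int[leb]_(x in `[0%R, +oo[) ((k x)%:E * \int[leb]_(u in `[0%R, x]) (q u)%:E) =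
  \int[leb]_(u in `[0%R, +oo[) ((q u)%:E * \int[leb]_(x in `[u, +oo[) (k x)%:E).
Proof.
move=> mk mq k0 q0.
under eq_integral do rewrite Zl//.
under [RHS]eq_integral do rewrite Zl//.
have := @tonelli_sections _ _ _ _ R leb leb _ _ _ (fun x : R => `[0%R, x]%classic)
  (fun y : R => `[y, +oo[%classic) (fun z => (k z.1 * q z.2)%:E) mtri (mprod mk mq) _ triA triB.
move=> -> //=; last by move=> z; rewrite lee_fin mulr_ge0.
by apply: eq_integral => u _; apply: eq_integral => x _; rewrite mulrC.
Qed.

Lemma measurable_tail_integral k : measurable_fun setT k -> (forall x, 0 <= k x)%R ->
  measurable_fun (`[0%R, +oo[%classic : set (measurableTypeR R)) (fun u => \int[leb]_(x in `[u, +oo[) (k x)%:E).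
Proof.
move=> mk k0.
have mc : measurable_fun setT (fun z : R => 1%R : R) by [].
have := @measurable_sectionr _ _ _ _ R leb _ _
  (fun y : R => `[y, +oo[%classic) (fun z => (k z.1 * 1)%:E) mtri (mprod mk mc) _ triB.
move=> H; apply: eq_measurable_fun (H _ _) => //.
  by move=> u _; apply: eq_integral => x _; rewrite /= mulr1.
by move=> z; rewrite lee_fin mulr1.
Qed.

Lemma measurable_primitive q : measurable_fun setT q -> (forall x, 0 <= q x)%R ->
  measurable_fun (`[0%R, +oo[%classic : set (measurableTypeR R)) (fun x => \int[leb]_(u in `[0%R, x]) (q u)%:E).
Proof.
move=> mq q0.
have mc : measurable_fun setT (fun z : R => 1%R : R) by [].
have := @measurable_sectionl _ _ _ _ R leb _ _
  (fun x : R => `[0%R, x]%classic) (fun z => (1 * q z.2)%:E) mtri (mprod mc mq) _ triA.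
move=> H; apply: eq_measurable_fun (H _ _) => //.
  by move=> u _; apply: eq_integral => x _; rewrite /= mul1r.
by move=> z; rewrite lee_fin mul1r.
Qed.

Lemma tail_integralD F x y : measurable_fun setT F -> (forall x, 0 <= F x)%R -> (x <= y)%R ->
  \int[leb]_(z in `[x, +oo[) (F z)%:E =
  \int[leb]_(z in `[x, y]) (F z)%:E + \int[leb]_(z in `[y, +oo[) (F z)%:E.
Proof.
move=> mF F0 xy.
have mF' D : measurable_fun D (EFin \o F) by apply: measurable_funTS; exact/measurable_EFinP.
rewrite (@itv_bndbnd_setU _ _ _ (BRight y)) ?bnd_simp// ge0_integral_setU//=.
- by rewrite integral_itv_obnd_cbnd.
- exact: mF'.
- by move=> *; rewrite lee_fin.
- apply/disj_setPS => z [] /=; rewrite !in_itv/= andbT => /andP[_ +] => /le_lt_trans /[apply].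
  by rewrite ltxx.
Qed.

(* With R = c + int_0^. q, this is the integral form of the transport of the
   density R by the flow x -> x + t. *)
Lemma transport_identity F q (c t : R) :
  measurable_fun setT F -> measurable_fun setT q ->
  (forall x, 0 <= F x)%R -> (forall x, 0 <= q x)%R -> (0 <= c)%R -> (0 <= t)%R ->
  \int[leb]_(x in `[0%R, +oo[) ((F x)%:E * (c%:E + \int[leb]_(u in `[0%R, x]) (q u)%:E)) =
  \int[leb]_(x in `[0%R, +oo[) ((F (x + t))%:E * (c%:E + \int[leb]_(u in `[0%R, x]) (q u)%:E))
  + c%:E * \int[leb]_(x in `[0%R, t]) (F x)%:E
  + \int[leb]_(u in `[0%R, t]) \int[leb]_(x in `[0%R, +oo[) (F (x + u) * q x)%:E.
Proof.
move=> mF mq F0 q0 c0 t0.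
have mFt : measurable_fun setT (fun x : R => F (x + t)%R).
  by apply: measurableT_comp => //; exact: measurable_funD.
(* Tonelli's theorem separates the part carried by [c] from the part created by [q], both for
   [k = F] and for its translate by [t]. *)
have split k : measurable_fun setT k -> (forall x, 0 <= k x)%R ->
    \int[leb]_(x in `[0%R, +oo[) ((k x)%:E * (c%:E + \int[leb]_(u in `[0%R, x]) (q u)%:E)) =
    c%:E * \int[leb]_(x in `[0%R, +oo[) (k x)%:E +
    \int[leb]_(u in `[0%R, +oo[) ((q u)%:E * \int[leb]_(x in `[u, +oo[) (k x)%:E).
  move=> mk k0.
  have mk' : measurable_fun (`[0%R, +oo[%classic : set (measurableTypeR R)) (EFin \o k) by apply: measurable_funTS; exact/measurable_EFinP.
  rewrite -tonelli_tail// -ge0_integralZl ?lee_fin//; last by move=> *; rewrite lee_fin.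
  rewrite -ge0_integralD//.
  - apply: eq_integral => x _; rewrite ge0_muleDr ?lee_fin// ?integral_ge0//.
      by rewrite [c%:E * _]muleC.
    by move=> *; rewrite lee_fin.
  - by move=> x _; rewrite mule_ge0 ?lee_fin.
  - exact: measurable_funeM.
  - by move=> x _; rewrite mule_ge0 ?lee_fin// integral_ge0// => *; rewrite lee_fin.
  - by apply: emeasurable_funM => //; exact: measurable_primitive.
rewrite !split// -/(_ <= _)%R.
have shiftE (u : R) : \int[leb]_(x in `[u, +oo[) (F (x + t))%:E = \int[leb]_(x in `[(u + t)%R, +oo[) (F x)%:E.
  rewrite -(@integral_leb_shift R t `[(u + t)%R, +oo[%classic (EFin \o F))//.
    by congr (integral _ _ _); apply/seteqP; split => x /=; rewrite !in_itv/= !andbT lerD2r.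
  by apply: measurable_funTS; exact/measurable_EFinP.
(* For mass created at age [x], integrating over the elapsed time [u] sweeps the interval
   [[x, x + t]]. *)
have -> : \int[leb]_(u in `[0%R, t]) \int[leb]_(x in `[0%R, +oo[) (F (x + u) * q x)%:E =
    \int[leb]_(x in `[0%R, +oo[) ((q x)%:E * \int[leb]_(y in `[x, (x + t)%R]) (F y)%:E).
  rewrite (@tonelli_sections _ _ _ _ R leb leb (`[0%R, t]%classic `*` `[0%R, +oo[%classic) _ `[0%R, +oo[%classic _ (fun=> `[0%R, t]%classic)
    (fun z => (F (z.2 + z.1) * q z.2)%:E))//=.
  - apply: eq_integral => x _.
    rewrite -(@integral_leb_shift R x `[x, (x + t)%R]%classic (EFin \o F))//=; last first.
      by apply: measurable_funTS; exact/measurable_EFinP.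
    have -> : [set u | `[x, (x + t)%R]%classic (u + x)%R] = `[0%R, t]%classic.
      by apply/seteqP; split => u /=; rewrite !in_itv/= [(x + t)%R]addrC lerD2r lerDr.
    rewrite Zl//; first by apply: eq_integral => u _; rewrite mulrC [(u + x)%R]addrC.
    by apply: measurableT_comp => //; exact: measurable_funD.
  - exact: measurableX.
  - apply/measurable_EFinP/measurable_funM.
      apply: measurableT_comp => //; apply: measurable_funD; [exact: measurable_snd|exact: measurable_fst].
    exact: measurableT_comp mq measurable_snd.
  - by move=> z; rewrite lee_fin mulr_ge0.
  - by move=> x y; rewrite and_comm.
have I0 (D : set R) : 0%R <= \int[leb]_(x in D) (F x)%:E.
  by apply: integral_ge0 => *; rewrite lee_fin.
(* The half-line from [u] is cut at [u + t]; its far part is the integral of the translate, by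
   [shiftE]. *)
have -> : \int[leb]_(u in `[0%R, +oo[) ((q u)%:E * \int[leb]_(x in `[u, +oo[) (F x)%:E) =
    \int[leb]_(u in `[0%R, +oo[) ((q u)%:E * \int[leb]_(x in `[u, +oo[) (F (x + t))%:E) +
    \int[leb]_(x in `[0%R, +oo[) ((q x)%:E * \int[leb]_(y in `[x, (x + t)%R]) (F y)%:E).
  have mt : measurable_fun (`[0%R, +oo[%classic : set (measurableTypeR R))
      (fun x : R => \int[leb]_(y in `[x, (x + t)%R]) (F y)%:E).
    have mE : measurable [set z : measurableTypeR R * measurableTypeR R |
        `[0%R, +oo[%classic z.1 /\ `[z.1, (z.1 + t)%R]%classic z.2].
      rewrite (_ : [set _ | _] = (fst @^-1` `[0%R, +oo[) `&`
        ((fun z => z.2 - z.1)%R @^-1` `[0%R, t])).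
        apply: measurableI; rewrite -[X in measurable X]setTI.
          exact: measurable_fst.
        have : measurable_fun [set: measurableTypeR R * measurableTypeR R] (fun z => z.2 - z.1)%R.
          by apply: measurable_funB; [exact: measurable_snd|exact: measurable_fst].
        exact.
      by apply/seteqP; split => -[x y] /=; rewrite !in_itv/= !andbT subr_ge0 lerBlDl.
    have m1 : measurable_fun setT (fun z : R => 1%R : R) by [].
    have := @measurable_sectionl _ _ _ _ R leb _ _
      (fun x : R => `[x, (x + t)%R]%classic) (fun z => (1 * F z.2)%:E) mE (mprod m1 mF) _ _.
    move=> H; apply: eq_measurable_fun (H _ _ _ _) => //.
      by move=> u _; apply: eq_integral => x _; rewrite /= mul1r.
    by move=> z; rewrite lee_fin mul1r.
  rewrite -ge0_integralD//.
  - apply: eq_integral => u _; rewrite shiftE (@tail_integralD F u (u + t)%R)//; last by rewrite lerDl.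
    by rewrite ge0_muleDr// addeC.
  - by move=> x _; rewrite mule_ge0 ?lee_fin// shiftE.
  - apply: emeasurable_funM; first by apply: measurable_funTS; exact/measurable_EFinP.
    exact: measurable_tail_integral.
  - by move=> x _; rewrite mule_ge0 ?lee_fin.
  - by apply: emeasurable_funM => //; apply: measurable_funTS; exact/measurable_EFinP.
rewrite shiftE add0r (@tail_integralD F 0%R t)// ge0_muleDr//.
have AC (a b e f : \bar R) : a + b + (e + f) = b + e + a + f.
  by rewrite [a + b]addeC -!addeA; congr (_ + _); rewrite addeCA.
exact: AC.
Qed.
End Evolution.

(** * The service distribution *)

Section ServiceTail.
Context {R : realType}.
Notation leb := (@lebesgue_measure R).
Variables (G g : R -> R).
Hypothesis hG : service_distribution G g.
Notation T := (tail G).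
Notation Rp := (`[0%R, +oo[%classic : set (measurableTypeR R)).

Lemma density_measurable : measurable_fun Rp g.
Proof. by case: hG => P [_ _ [] ]. Qed.

Lemma density_ge0 x : 0 <= x -> 0 <= g x.
Proof. by case: hG => P [_ _ [_ +] _ _]; exact. Qed.

Lemma density_total : (\int[leb]_(x in Rp) (g x)%:E = 1)%E.
Proof. by case: hG => P [P1 _ _ /(_ Rp) <-//]. Qed.

Let mg (D : set R) : measurable (D : set (measurableTypeR R)) -> D `<=` Rp ->
  measurable_fun (D : set (measurableTypeR R)) (EFin \o g).
Proof.
move=> mD DR; apply/measurable_EFinP.
exact: (measurable_funS _ DR density_measurable).
Qed.

Lemma density_integrable : leb.-integrable Rp (EFin \o g).
Proof.
apply/integrableP; split; first exact: mg.
rewrite (_ : integral _ _ _ = 1%E) ?ltry// -density_total.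
apply: eq_integral => x; rewrite inE/= in_itv/= andbT => x0.
by rewrite ger0_norm// density_ge0.
Qed.

Let tailE : exists P : probability (measurableTypeR R) R,
  [/\ P Rp = 1%E, forall x, (T x)%:E = P `]x, +oo[%classic,
    (forall A : set (measurableTypeR R), measurable A -> A `<=` Rp ->
          P A = (\int[leb]_(x in A) (g x)%:E)%E) & (\int[P]_x x%:E)%E = 1%E].
Proof.
case: hG => P [P1 GE _ Pg EP]; exists P; split => // x.
rewrite /tail GE EFinB fineK ?fin_num_measure//.
by rewrite -probability_setC// setCitvl.
Qed.

(** The density excludes an atom at 0, so []0, +oo[] already carries the whole mass. *)
Lemma tail_le0 x : x <= 0 -> T x = 1.
Proof.
case: tailE => P [P1 TE Pg _] x0; apply: EFin_inj; rewrite TE.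
apply/eqP; rewrite eq_le probability_le1//= -P1.
have <- : P `]0, +oo[%classic = P Rp.
  rewrite !Pg//; first by rewrite integral_itv_obnd_cbnd//; apply: mg => // y /=; rewrite !in_itv/= !andbT => /ltW.
  by move=> y /=; rewrite !in_itv/= !andbT => /ltW.
apply: le_measure; rewrite ?inE//.
by move=> y /=; rewrite !in_itv/= !andbT; exact: le_lt_trans.
Qed.

Lemma tail_integral x : 0 <= x -> (T x)%:E = (\int[leb]_(y in `[x, +oo[) (g y)%:E)%E.
Proof.
case: tailE => P [P1 TE Pg _] x0; rewrite TE Pg//.
  rewrite integral_itv_obnd_cbnd//; apply: mg => // y /=.
  by rewrite !in_itv/= !andbT => /ltW; exact: le_trans.
by move=> y /=; rewrite !in_itv/= !andbT => /ltW; exact: le_trans.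
Qed.

Lemma tail_ge0 x : 0 <= T x.
Proof. by case: tailE => P [_ TE _ _]; rewrite -lee_fin TE. Qed.

Lemma tail_nonincreasing : {homo T : x y /~ x <= y}.
Proof.
move=> x y yx; case: tailE => P [_ TE _ _]; rewrite -lee_fin !TE.
apply: le_measure; rewrite ?inE//.
by move=> z /=; rewrite !in_itv/= !andbT; exact: le_lt_trans.
Qed.

(** The primitive of an integrable function is continuous. The density is extended by 0 and
    integrated from -1, so that 0 is an interior point. *)
Lemma tail_continuous : continuous T.
Proof.
pose g0 := g \_ Rp.
have ig0 (a b : R) : leb.-integrable `[a, b] (EFin \o g0).
  apply: (@integrableS _ _ _ leb setT) => //.
  rewrite -restrict_EFin; apply/(integrable_mkcond _ _).1 => //.
  exact: density_integrable.
have TE x b : 0 <= x -> x <= b -> T x = 1 - \int[leb]_(y in `[-1, x]) g0 y.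
  move=> x0 _.
  have -> : \int[leb]_(y in `[-1, x]) g0 y = \int[leb]_(y in `[0, x]) g y.
    rewrite -Rintegral_mkcondr; congr (Rintegral _ _ _).
    apply/seteqP; split => y /=; rewrite !in_itv/= andbT.
      by move=> [/andP[_ ->]] ->.
    by move=> /andP[y0 ->]; rewrite y0 (le_trans _ y0)// oppr_le0.
  have := @Rintegral_itvB R g (BLeft 0) (BInfty R false) x density_integrable.
  rewrite !bnd_simp => /(_ x0 isT) /eqP; rewrite subr_eq => /eqP E.
  have -> : T x = \int[leb]_(y in `]x, +oo[) g y.
    rewrite /Rintegral integral_itv_obnd_cbnd -?tail_integral//.
    by apply: mg => // y /=; rewrite !in_itv/= !andbT => /ltW; exact: le_trans.
  have : \int[leb]_(y in Rp) g y = 1 by rewrite /Rintegral density_total.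
  by rewrite E => <-; rewrite addrK.
have TE' x : -1 <= x -> T x = 1 - \int[leb]_(y in `[-1, x]) g0 y.
  move=> x1; have [x0|x0] := leP 0 x; first exact: (TE x x).
  rewrite tail_le0 ?ltW// (_ : \int[leb]_(y in `[-1, x]) g0 y = 0) ?subr0//.
  rewrite -Rintegral_mkcondr (_ : _ `&` _ = set0) ?Rintegral_set0//.
  apply/seteqP; split => y //=; rewrite !in_itv/= andbT => -[/andP[_ yx] y0].
  by have := lt_le_trans x0 (le_trans y0 yx); rewrite ltxx.
move=> x; have [x0|x0] := ltP x 0.
  have : {near x, cst 1 =1 T}.
    near=> y; rewrite tail_le0//; apply: ltW; near: y.
    exact: lt_nbhsl.
  move=> /near_eq_cvg H; rewrite /continuous_at tail_le0 ?ltW//.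
  by apply: (cvg_trans H); exact: cvg_cst.
have xo : x \in `]-1, x + 1[ by rewrite in_itv/= ltrDl ltr01 (lt_le_trans _ x0)// ltrN10.
have lt1 : -1 < x + 1 by rewrite (lt_le_trans (ltrN10 R))// addr_ge0.
have cI : {for x, continuous (fun z : R => \int[leb]_(y in `[-1, z]) g0 y)}.
  apply: (within_continuous_continuous lt1 _ xo).
  exact: parameterized_integral_continuous (ltW lt1) (ig0 _ _).
have : {near x, (fun z : R => 1 - \int[leb]_(y in `[-1, z]) g0 y) =1 T}.
  near=> y; rewrite TE'//; apply: ltW; near: y; apply: lt_nbhsr.
  by rewrite (lt_le_trans _ x0)// ltrN10.
move=> /near_eq_cvg H; rewrite /continuous_at TE' ?(le_trans _ x0) ?oppr_le0//.
apply: (cvg_trans H).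
by apply: cvgB; [exact: cvg_cst|exact: cI].
Unshelve. all: by end_near. Qed.

(** The mean of a nonnegative variable is the integral of its tail. The identity is nonnegative only
    almost surely, hence the positive part [X]. *)
Lemma tail_total : (\int[leb]_(x in Rp) (T x)%:E = 1)%E.
Proof.
case: tailE => P [P1 TE Pg EP].
have mX : measurable_fun setT (fun x : measurableTypeR R => Num.max x 0 : R).
  by apply: measurable_maxr => //; exact: measurable_id.
pose X : {RV P >-> R} := mfun_Sub (mem_set mX).
have X0 x : 0 <= X x by rewrite /X/= le_max lexx orbT.
have := ge0_expectation_ccdf X0.
have -> : 'E_P[X]%E = 1%E.
  rewrite -EP unlock; apply: ae_eq_integral => //; first exact/measurable_EFinP.
  exists (~` Rp); split; first exact: measurableC.
    have H : (P (~` Rp) = 1 - P Rp)%E by exact: probability_setC.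
    by apply: (etrans H); rewrite P1 subee.
  move=> x /= H; apply: contra_not H; rewrite in_itv/= andbT => x0 _.
  by rewrite (max_idPl x0).
move=> ->; apply: eq_integral => x; rewrite inE/= in_itv/= andbT => x0.
rewrite TE /ccdf /distribution /pushforward; congr (P _).
apply/seteqP; split => y /=; rewrite !in_itv/= !andbT lt_max; first by move=> ->.
by case/orP => // /lt_le_trans => /(_ _ x0); rewrite ltxx.
Qed.

(** The supremum [L] is not attained: by continuity a positive tail at [x] stays positive slightly
    to the right of [x]. *)
Lemma age_spaceE : age_space G = [set x | 0 <= x /\ 0 < T x].
Proof.
apply/seteqP; split => x [x0].
  move=> /ereal_sup_gt[_ [y [y0 Ty] <-]]; rewrite lte_fin => xy; split=> //.
  by apply: lt_le_trans Ty _; apply: tail_nonincreasing; exact: ltW.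
move=> Tx; split => //.
have H : \forall y \near x^'+, 0 < T y /\ x < y.
  near=> y; split; last by near: y; exact: nbhs_right_gt.
  near: y; apply: cvgr_gt Tx.
  by apply: cvg_at_right_filter; exact: tail_continuous.
have [y [Ty xy]] := @filter_ex _ (at_right x) _ _ H.
apply: (@lt_le_trans _ _ y%:E); first by rewrite lte_fin.
by apply: ereal_sup_ubound; exists y => //; split => //; rewrite (le_trans x0)// ltW.
Unshelve. all: by end_near. Qed.

Lemma tail_measurable : measurable_fun [set: measurableTypeR R] (T : R -> R).
Proof. exact: continuous_measurable_fun tail_continuous. Qed.

Lemma age_space_measurable : measurable (age_space G : set (measurableTypeR R)).
Proof.
rewrite age_spaceE (_ : [set _ | _] = Rp `&` (T @^-1` `]0, +oo[)).
  apply: measurableI => //; rewrite -[X in measurable X]setTI.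
  exact: tail_measurable.
by apply/seteqP; split => x /=; rewrite !in_itv/= !andbT.
Qed.

Lemma age_space0 : age_space G 0.
Proof. by rewrite age_spaceE; split => //; rewrite tail_le0. Qed.

Lemma age_space_le x y : 0 <= x -> x <= y -> age_space G y -> age_space G x.
Proof.
rewrite age_spaceE => x0 xy [_ Ty]; split => //.
exact: lt_le_trans Ty (tail_nonincreasing xy).
Qed.

Lemma tail_out x : 0 <= x -> ~ age_space G x -> T x = 0.
Proof.
rewrite age_spaceE => x0 nx; apply/eqP; rewrite eq_le tail_ge0 andbT leNgt.
by apply/negP => Tx; apply: nx.
Qed.

(** Unless it is empty, the set is [[L, +oo[] with [L] finite, and its mass is the tail at [L],
    which is 0 because [L] is not an age. *)
Lemma density_out : (\int[leb]_(x in Rp `\` age_space G) (g x)%:E = 0)%E.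
Proof.
have [E|] := eqVneq (Rp `\` age_space G) set0; first by rewrite E integral_set0.
move=> /set0P[z [/= ]]; rewrite in_itv/= andbT => z0 nz.
have zL : (right_end G <= z%:E)%E by rewrite leNgt; apply/negP => ?; apply: nz.
have L0 : (0%:E < right_end G)%E by case: age_space0.
move: zL L0; case E : (right_end G) => [l| |]//; rewrite lee_fin lte_fin => lz l0.
have -> : Rp `\` age_space G = `[l, +oo[%classic.
  apply/seteqP; split => x /=; rewrite !in_itv/= !andbT /age_space/= E lte_fin.
    by move=> [x0 H]; rewrite leNgt; apply/negP => xl; apply: H.
  by move=> lx; split => [|[_]]; [exact: le_trans (ltW l0) lx|rewrite ltNge lx].
rewrite -tail_integral ?ltW// tail_out// ?ltW//.
by rewrite /age_space/= E ltxx => -[].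
Qed.

Lemma integral_tail_age (k : R -> R) :
  (\int[leb]_(x in age_space G) (k x * T x)%:E = \int[leb]_(x in Rp) (k x * T x)%:E)%E.
Proof.
rewrite integral_mkcond [RHS]integral_mkcond; apply: eq_integral => x _.
rewrite !patchE; case: ifPn => [|].
  by rewrite inE => -[x0 _]; rewrite ifT// inE/= in_itv/= x0.
rewrite notin_setE => nx; case: ifPn => //; rewrite inE/= in_itv/= andbT => x0.
by rewrite tail_out// mulr0.
Qed.

(** Beyond [L] the density need not vanish pointwise; its integral does, and the bound [M] carries
    this over to [g k]. *)
Lemma integral_density_age (k : R -> R) M : measurable_fun Rp k ->
  (forall x, 0 <= x -> 0 <= k x <= M) ->
  (\int[leb]_(x in age_space G) (g x * k x)%:E = \int[leb]_(x in Rp) (g x * k x)%:E)%E.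
Proof.
move=> mk kM.
have mgk (D : set R) : measurable (D : set (measurableTypeR R)) -> D `<=` Rp ->
    measurable_fun (D : set (measurableTypeR R)) (fun x => (g x * k x)%:E).
  move=> mD DR; apply/measurable_EFinP/measurable_funM.
    by apply/measurable_EFinP; exact: mg.
  exact: measurable_funS mk.
have ageR : age_space G `<=` Rp by move=> x [x0 _] /=; rewrite in_itv/= x0.
have mage := age_space_measurable.
have RE : Rp = age_space G `|` (Rp `\` age_space G) by rewrite setDUK.
have mD : measurable (Rp `\` age_space G) by exact: measurableD.
rewrite [in RHS]RE ge0_integral_setU//; last 3 first.
- by rewrite -RE; exact: mgk.
- rewrite -RE => x /=; rewrite in_itv/= andbT => x0.
  by rewrite lee_fin mulr_ge0 ?density_ge0//; case/andP: (kM x x0).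
- by apply/disj_setPS => x [? []].
suff -> : (\int[leb]_(x in Rp `\` age_space G) (g x * k x)%:E = 0)%E by rewrite adde0.
have M0 : 0 <= M by have /andP[] := kM 0 (lexx _); exact: le_trans.
apply/eqP; rewrite eq_le; apply/andP; split; last first.
  apply: integral_ge0 => x [/=]; rewrite in_itv/= andbT => x0 _.
  by rewrite lee_fin mulr_ge0 ?density_ge0//; case/andP: (kM x x0).
rewrite -(mule0 M%:E) -density_out -ge0_integralZl ?lee_fin//; last 2 first.
- by apply: mg => //; exact: subDsetl.
- by move=> x [/=]; rewrite in_itv/= andbT => x0 _; rewrite lee_fin density_ge0.
apply: ge0_le_integral => //.
- move=> x [/=]; rewrite in_itv/= andbT => x0 _.
  by rewrite lee_fin mulr_ge0 ?density_ge0//; case/andP: (kM x x0).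
- by apply: mgk => //; exact: subDsetl.
- by apply: measurable_funeM; apply: mg => //; exact: subDsetl.
- move=> x [/=]; rewrite in_itv/= andbT => x0 _.
  rewrite -EFinM lee_fin mulrC ler_wpM2r ?density_ge0//.
  by case/andP: (kM x x0).
Qed.

End ServiceTail.

(** * Measures with a density *)

Section Density.
Context {R : realType}.
Notation leb := (@lebesgue_measure R).
Local Open Scope ereal_scope.

Lemma subprobability_of_density (w : R -> R) :
  measurable_fun [set: measurableTypeR R] w -> (forall x, 0 <= w x)%R ->
  \int[leb]_x (w x)%:E <= 1 ->
  exists nu : subprobability (measurableTypeR R) R,
    forall A, nu A = \int[leb]_(x in A) (w x)%:E.
Proof.
move=> mw w0 w1; pose m (A : set (measurableTypeR R)) := \int[leb]_(x in A) (w x)%:E.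
have m0 : m set0 = 0 by rewrite /m integral_set0.
have m_ge0 A : 0 <= m A by apply: integral_ge0 => *; rewrite lee_fin.
have m_sigma : semi_sigma_additive m.
  apply: (@semi_sigma_additive_nng_induced _ _ _ leb (EFin \o w)).
    exact/measurable_EFinP.
  by move=> x /=; rewrite lee_fin.
pose mm : {measure set (measurableTypeR R) -> \bar R} :=
  HB.pack m (isMeasure.Build _ _ _ m m0 m_ge0 m_sigma).
pose ms : subprobability (measurableTypeR R) R :=
  HB.pack m mm (Measure_isSubProbability.Build _ _ _ mm w1).
by exists ms.
Qed.

Variables (nu : {finite_measure set (measurableTypeR R) -> \bar R})
  (D : set (measurableTypeR R)) (w : R -> R).
Hypotheses (mD : measurable D) (mw : measurable_fun D w)
  (w0 : forall x, D x -> (0 <= w x)%R) (nuD : nu (~` D) = 0)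
  (nuE : forall A, measurable A -> A `<=` D -> nu A = \int[leb]_(x in A) (w x)%:E).

Let nu_leb : nu `<< leb.
Proof.
apply/null_content_dominatesP => A mA A0.
rewrite -(setIT A) -(setUv D) setIUr measureU; last 3 first.
- exact: measurableI.
- by apply: measurableI => //; exact: measurableC.
- by rewrite setIACA setICr setI0.
have mDc := measurableC mD; have mADc := measurableI _ _ mA mDc.
have mAD := measurableI _ _ mA mD.
have E2 : nu (A `&` ~` D) = 0.
  by apply/eqP; rewrite -measure_le0 -nuD le_measure ?inE//; exact: subIsetr.
have E1 : nu (A `&` D) = 0.
  rewrite nuE//; apply: null_set_integral => //.
    apply/measurable_EFinP; apply: measurable_funS mw => //; exact: subIsetr.
  by apply/eqP; rewrite -measure_le0 -A0 le_measure ?inE//; exact: subIsetl.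
by apply: (etrans (congr2 _ E1 E2)); rewrite adde0.
Qed.

Let nu_ae : ae_eq leb D (Radon_Nikodym_SigmaFinite.f nu leb) (EFin \o w).
Proof.
apply: integral_ae_eq => //.
- apply: integrableS (Radon_Nikodym_SigmaFinite.f_integrable nu_leb) => //.
- exact/measurable_EFinP.
- move=> A AD mA; rewrite -(Radon_Nikodym_SigmaFinite.f_integral nu_leb)//.
  exact: nuE.
Qed.

(** [nu] is absolutely continuous and its Radon-Nikodym derivative agrees with [w] almost everywhere
    on [D]; the change of variables is done with that derivative. *)
Lemma ge0_integral_density (f : R -> \bar R) : measurable_fun D f ->
  (forall x, D x -> 0 <= f x) ->
  \int[nu]_(x in D) f x = \int[leb]_(x in D) (f x * (w x)%:E).
Proof.
move=> mf f0; pose h := f \_ D.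
have hE x : D x -> h x = f x by move=> Dx; rewrite /h patchE mem_set.
have mh : measurable_fun D h.
  by apply: eq_measurable_fun mf => x /set_mem Dx; rewrite hE.
transitivity (\int[nu]_(x in D) h x).
  by apply: eq_integral => x /set_mem Dx; rewrite hE.
rewrite -(@Radon_Nikodym_SigmaFinite.change_of_variables _ _ _ nu leb nu_leb)//; last first.
  by apply: erestrict_ge0.
apply: ae_eq_integral => //.
- apply: emeasurable_funM => //; apply: measurable_funTS.
  exact: measurable_int (Radon_Nikodym_SigmaFinite.f_integrable nu_leb).
- by apply: emeasurable_funM => //; exact/measurable_EFinP.
- by apply: filterS nu_ae => x /= H Dx; rewrite H// hE.
Qed.

Lemma integral_density (f : R -> \bar R) : measurable_fun D f ->
  \int[nu]_(x in D) f x = \int[leb]_(x in D) (f x * (w x)%:E).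
Proof.
move=> mf; rewrite integralE [RHS]integralE !ge0_integral_density//.
- congr (_ - _); apply: eq_integral => x /set_mem /w0 wx.
    by rewrite !funeposE maxe_pMl// mul0e.
  by rewrite !funenegE -mulNe maxe_pMl// mul0e.
- exact: measurable_funeneg.
- exact: measurable_funepos.
Qed.

End Density.

(** * Finite measures are determined by continuous functions *)

Section MeasureEquality.
Context {R : realType}.
Implicit Types (m : {finite_measure set (measurableTypeR R) -> \bar R}).

(* Increasing continuous approximations of the indicator of ]0, +oo[. *)
Let ramp (n : nat) (y : R) : R := Num.min 1 (Num.max 0 (n%:R * y)).

Let ramp01 n y : 0 <= ramp n y <= 1.
Proof. by rewrite /ramp ge_min lexx le_min ler01 le_max lexx. Qed.

Let ramp_cont n a : continuous (fun x => ramp n (x - a)).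
Proof.
move=> x; apply: (@continuous_min _ _ (cst 1 : R -> R^o)
  ((cst 0 : R -> R^o) \max (fun x => n%:R * (x - a) : R^o))).
  exact: cvg_cst.
apply: continuous_max; first exact: cvg_cst.
by apply: cvgM; [exact: cvg_cst|apply: cvgB; [exact: cvg_id|exact: cvg_cst]].
Qed.

Let ramp_cvg y : (fun n : nat => ramp n y) @ \oo --> ((0 < y)%R%:R : R).
Proof.
have [y0|y0] := ltP 0 y; last first.
  rewrite (_ : (fun n => _) = cst 0); first exact: cvg_cst.
  apply/funext => n; rewrite /ramp/= (max_idPl _) ?(min_idPr _)//.
  by rewrite mulr_ge0_le0.
apply: cvg_near_cst; near=> n.
rewrite /ramp (min_idPl _)// le_max; apply/orP; right.
rewrite -ler_pdivrMr// mul1r; near: n.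
exact: nbhs_infty_ger.
Unshelve. all: by end_near. Qed.

(** Half-open intervals suffice, and their indicators are bounded pointwise limits of continuous
    functions with values in [[0, 1]]. *)
Lemma finite_measure_eq m m' :
  (forall f : R -> R, continuous f -> (forall x, 0 <= f x <= 1) ->
     (\int[m]_x (f x)%:E = \int[m']_x (f x)%:E)%E) ->
  forall A, measurable A -> m A = m' A.
Proof.
move=> mm; pose S : set (set (measurableTypeR R)) := @ocitv R.
apply: (@measure_unique _ R (measurableTypeR R) S (fun n => `]- n%:R, n%:R]%classic)) => //.
- exact: ocitvI.
- move=> n; exact: is_ocitv.
- apply/seteqP; split => // x _; exists (Num.truncn `|x|).+1 => //=.
  have := truncnS_gt `|x|; rewrite in_itv/= ltr_norml => /andP[-> /ltW ->]//.
- move=> _ [[a b] _ <-]/=.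
  (* [ramp] vanishes at 0, which excludes [a] and includes [b] in the limit. *)
  pose f n x : R := ramp n (x - a) * (1 - ramp n (x - b)).
  have f01 n x : 0 <= f n x <= 1.
    have /andP[r0 r1] := ramp01 n (x - a); have /andP[s0 s1] := ramp01 n (x - b).
    by rewrite /f mulr_ge0 ?subr_ge0//= mulr_ile1 ?subr_ge0// lerBlDr lerDl.
  have cf n : continuous (f n).
    move=> x; apply: cvgM; first exact: ramp_cont.
    by apply: cvgB; [exact: cvg_cst|exact: ramp_cont].
  have fcvg (x : R) : (fun n => (f n x)%:E) @ \oo --> ((\1_`]a, b]%classic x : R)%:E).
    have -> : \1_`]a, b]%classic x = (a < x)%R%:R * (1 - (b < x)%R%:R) :> R.
      rewrite indicE mem_setE/= in_itv/= [x <= b]leNgt.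
      by case: (a < x); case: (b < x); rewrite /= ?subr0 ?subrr ?mulr1 ?mulr0 ?mul0r.
    apply: cvg_EFin; first exact: nearW.
    apply: cvgM; first by rewrite -(subr_gt0 a x); exact: ramp_cvg.
    apply: cvgB; first exact: cvg_cst.
    by rewrite -(subr_gt0 b x); exact: ramp_cvg.
  have lim (mu : {finite_measure set (measurableTypeR R) -> \bar R}) :
      (fun n => \int[mu]_x (f n x)%:E)%E @ \oo --> mu `]a, b]%classic.
    have -> : mu `]a, b]%classic = (\int[mu]_x (\1_`]a, b]%classic x)%:E)%E.
      by rewrite integral_indic// setIT.
    apply: (@dominated_cvg _ _ _ mu setT _ (fun n x => (f n x)%:E) _ (cst 1%E)) => //.
    - by move=> n; apply/measurable_EFinP; exact: continuous_measurable_fun.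
    - by apply: finite_measure_integrable_cst.
    - by move=> n x _ /=; rewrite lee_fin; have /andP[? ?] := f01 n x; rewrite ger0_norm.
  apply: (cvg_unique _ (lim m)) => //=.
  have -> : (fun n => \int[m]_x (f n x)%:E)%E = (fun n => \int[m']_x (f n x)%:E)%E.
    by apply/funext => n; apply: mm; [exact: cf|exact: f01].
  exact: lim.
- by move=> n; rewrite -ge0_fin_numE// fin_num_measure.
Unshelve. all: by end_near. Qed.

End MeasureEquality.

(** * Transport of densities *)

Section ParamIntegral.
Context d (Y : measurableType d) {R : realType} (mu : {measure set Y -> \bar R}).

Lemma continuous_param_integral (D : set Y) (k : R -> Y -> R) (h : Y -> R) :
  measurable D -> (forall u, measurable_fun D (k u)) ->
  mu.-integrable D (EFin \o h) ->
  (forall u y, D y -> `|k u y| <= h y) ->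
  (forall y, D y -> continuous (k^~ y)) ->
  continuous (fun u => \int[mu]_(y in D) k u y).
Proof.
move=> mD mk ih kh ck u.
have ik v : mu.-integrable D (EFin \o k v).
  apply: le_integrable ih => //; first exact/measurable_EFinP.
  by move=> y Dy; rewrite /= lee_fin (le_trans (kh v y Dy))// ler_norm.
apply: (@continuity_under_integral R _ _ mu k D mD (u - 1) (u + 1) _ _ h) => //.
- by apply: aeW => y Dy v _; exact: ck.
- by move=> v _; apply: aeW => y Dy; exact: kh.
- by rewrite inE/= in_itv/= ltrBlDr ltrDl ltr01.
Qed.

Lemma cvg_param_integral (D : set Y) (k : nat -> Y -> R) (l h : Y -> R) :
  measurable D -> (forall n, measurable_fun D (k n)) -> measurable_fun D l ->
  mu.-integrable D (EFin \o h) ->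
  (forall n y, D y -> `|k n y| <= h y) ->
  (forall y, D y -> k^~ y @ \oo --> l y) ->
  (fun n => \int[mu]_(y in D) k n y) @ \oo --> \int[mu]_(y in D) l y.
Proof.
move=> mD mk ml ih kh kl.
have il : mu.-integrable D (EFin \o l).
  apply: (le_integrable mD _ _ ih); first exact/measurable_EFinP.
  move=> y Dy /=; rewrite lee_fin; apply: le_trans (ler_norm _).
  have cv : (fun n => `|k n y|) @ \oo --> `|l y| by apply: cvg_norm; exact: kl.
  rewrite -(cvg_lim _ cv)//; apply: limr_le; first by apply/cvg_ex; eexists; exact: cv.
  by apply: nearW => n; exact: kh.
apply: fine_cvg; rewrite fineK; last exact: integrable_fin_num.
apply: (@dominated_cvg _ _ _ mu D mD (fun n y => (k n y)%:E) (EFin \o l) (EFin \o h)) => //.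
- by move=> n; exact/measurable_EFinP.
- by move=> y Dy; apply: cvg_EFin; [exact: nearW|exact: kl].
Qed.

End ParamIntegral.

Section Transport.
Context {R : realType}.
Notation leb := (@lebesgue_measure R).
Notation Rp := (`[0%R, +oo[%classic : set (measurableTypeR R)).
Variables (G g : R -> R).
Hypothesis hG : service_distribution G g.
Notation T := (tail G).
Implicit Types (f rho r : R -> R) (a c t u K M : R).

(** The pairing of the measure of density [rho T] with [aged G f u]: the denominator [T x] of the
    ageing factor cancels the tail in the density. *)
Definition aged_pairing rho f u := \int[leb]_(x in Rp) (f (x + u) * T (x + u) * rho x).

Let shift_cont f u : continuous f -> continuous (fun x => f (x + u)).
Proof.
move=> cf x; apply: continuous_comp; last exact: cf.
by apply: cvgD; [exact: cvg_id|exact: cvg_cst].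
Qed.

Let aged_cont rho f u : continuous rho -> continuous f ->
  continuous (fun x => f (x + u) * T (x + u) * rho x).
Proof.
move=> cr cf x; apply: cvgM; last exact: cr.
apply: cvgM; [exact: shift_cont|apply: shift_cont; exact: (tail_continuous hG)].
Qed.

Let aged_meas rho f u (D : set (measurableTypeR R)) : continuous rho -> continuous f ->
  measurable_fun D (fun x : R => f (x + u) * T (x + u) * rho x).
Proof.
move=> cr cf; apply: measurable_funTS; apply: continuous_measurable_fun.
exact: aged_cont.
Qed.

Lemma tail_integrable : leb.-integrable Rp (EFin \o T).
Proof.
apply/integrableP; split.
  apply/measurable_EFinP; apply: measurable_funTS; exact: (tail_measurable hG).
rewrite (_ : integral _ _ _ = 1%E) ?ltry// -(tail_total hG).
by apply: eq_integral => x _; rewrite /= ger0_norm// (tail_ge0 hG).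
Qed.

Lemma weighted_tail_integrable (q : R -> R) M : continuous q -> (forall x, 0 <= x -> 0 <= q x <= M) ->
  leb.-integrable Rp (EFin \o (fun x => q x * T x)).
Proof.
move=> cq qM; apply: (le_integrable _ _ _ (integrableZl _ M tail_integrable)) => //.
  apply/measurable_EFinP; apply: measurable_funTS; apply: continuous_measurable_fun => x.
  by apply: cvgM; [exact: cq|exact: (tail_continuous hG)].
move=> x /=; rewrite in_itv/= andbT => x0; have /andP[r0 r1] := qM x x0.
have Tx := tail_ge0 hG x; have M0 := le_trans r0 r1.
by rewrite lee_fin !ger0_norm ?mulr_ge0// ler_wpM2r.
Qed.

Let tailM_integrable K : leb.-integrable Rp (EFin \o (fun x => K * T x)).
Proof.
rewrite (_ : EFin \o _ = (fun x => K%:E * (T x)%:E)%E)//.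
by apply: integrableZl => //; exact: tail_integrable.
Qed.

Let aged_le rho f u K M x : (forall x, `|f x| <= K) ->
  (forall x, 0 <= x -> 0 <= rho x <= M) -> 0 <= u -> 0 <= x ->
  `|f (x + u) * T (x + u) * rho x| <= K * M * T x.
Proof.
move=> fK rM u0 x0; have /andP[r0 r1] := rM x x0.
rewrite !normrM (ger0_norm r0) (ger0_norm (tail_ge0 hG _)) mulrAC.
apply: ler_pM => //.
- by rewrite mulr_ge0.
- exact: (tail_ge0 hG).
- by apply: ler_pM.
- by apply: (tail_nonincreasing hG); rewrite lerDl.
Qed.

Lemma aged_integrable rho f u K M : continuous rho -> continuous f ->
  (forall x, `|f x| <= K) ->
  (forall x, 0 <= x -> 0 <= rho x <= M) -> 0 <= u ->
  leb.-integrable Rp (EFin \o (fun x => f (x + u) * T (x + u) * rho x)).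
Proof.
move=> cr cf fK rM u0; apply: (le_integrable _ _ _ (tailM_integrable (K * M))) => //.
  apply/measurable_EFinP; exact: aged_meas.
move=> x /=; rewrite in_itv/= andbT => x0; rewrite lee_fin.
by apply: le_trans (ler_norm _); exact: aged_le.
Qed.

Lemma aged_pairing_continuous rho f K M : continuous rho -> continuous f ->
  (forall x, `|f x| <= K) ->
  (forall x, 0 <= x -> 0 <= rho x <= M) ->
  continuous (fun u => aged_pairing rho f (Num.max u 0)).
Proof.
move=> cr cf fK rM.
apply: (continuous_param_integral _ _ (tailM_integrable (K * M))) => //.
- by move=> u; exact: aged_meas.
- move=> u x /=; rewrite in_itv/= andbT => x0; apply: aged_le => //.
  by rewrite le_max lexx orbT.
- move=> x _ u; apply: cvgM; last exact: cvg_cst.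
  have cm : continuous (fun u : R => x + Num.max u 0).
    move=> v; apply: cvgD; first exact: cvg_cst.
    by apply: (@continuous_max _ _ (id : R -> R^o) (cst 0 : R -> R^o)); [exact: cvg_id|exact: cvg_cst].
  apply: cvgM; first exact: (continuous_comp (cm u) (cf _)).
  by apply: (@continuous_comp _ _ _ (fun u : R => x + Num.max u 0) T u); [exact: cm|exact: (tail_continuous hG)].
Qed.

Lemma aged_pairingB rho f f' u K K' M : continuous rho -> continuous f -> continuous f' ->
  (forall x, `|f x| <= K) -> (forall x, `|f' x| <= K') ->
  (forall x, 0 <= x -> 0 <= rho x <= M) -> 0 <= u ->
  aged_pairing rho (fun x => f x - f' x) u = aged_pairing rho f u - aged_pairing rho f' u.
Proof.
move=> cr cf cf' fK fK' rM u0; rewrite -RintegralB//; last 2 first.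
- exact: aged_integrable fK rM u0.
- exact: aged_integrable fK' rM u0.
by apply: eq_Rintegral => x _; ring.
Qed.

(** The tail at [n] is the integral of the density off [[0, n]], which vanishes in the limit under
    domination by [g]. *)
Lemma tail_cvg0 : (fun n : nat => T n%:R) @ \oo --> (0 : R).
Proof.
have H : (fun n : nat => \int[leb]_(x in Rp) (g x - (g \_ (`[0, n%:R]%classic)) x)) @ \oo --> (\int[leb]_(x in Rp) 0 : R).
  apply: (cvg_param_integral _ _ _ (density_integrable hG)) => //.
  - move=> n; apply: measurable_funB; first exact: (density_measurable hG).
    apply/measurable_restrict => //.
    apply: measurable_funS (density_measurable hG) => //; exact: subIsetl.
  - move=> n x /=; rewrite in_itv/= andbT => x0; have gx := density_ge0 hG x0.
    by rewrite patchE; case: ifPn => _; rewrite ?subrr ?subr0 ?normr0// ger0_norm.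
  - move=> x /=; rewrite in_itv/= andbT => x0; apply: cvg_near_cst; near=> n.
    rewrite patchE mem_set ?subrr//= in_itv/= x0/=; near: n; exact: nbhs_infty_ger.
rewrite Rintegral_cst// mul0r in H.
apply: cvg_trans H; apply: near_eq_cvg; near=> n.
have := @Rintegral_itvB R g (BLeft 0) (BInfty R false) n%:R (density_integrable hG).
rewrite !bnd_simp => /(_ (ler0n _ _) isT) E.
rewrite RintegralB//; last 2 first.
- exact: density_integrable hG.
- rewrite -restrict_EFin; apply/integrable_restrict => //.
  by apply: integrableS (density_integrable hG) => //; exact: measurableI.
rewrite -Rintegral_mkcondr (_ : Rp `&` _ = `[0, n%:R]%classic); last first.
  apply/seteqP; split => y /=; rewrite !in_itv/= andbT; first by case.
  by move=> /andP[-> ->].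
rewrite E; apply: EFin_inj; rewrite (tail_integral hG)// -integral_itv_obnd_cbnd//; last first.
  apply/measurable_EFinP; apply: measurable_funS (density_measurable hG) => //.
  by move=> y /=; rewrite !in_itv/= !andbT => /ltW; exact: le_trans.
rewrite /Rintegral fineK//; apply: integrable_fin_num => //.
apply: integrableS (density_integrable hG) => //.
by move=> y /=; rewrite !in_itv/= !andbT => /ltW; exact: le_trans.
Unshelve. all: by end_near. Qed.

Lemma aged_pairing_cvg0 rho f K M : continuous rho -> continuous f ->
  (forall x, `|f x| <= K) -> (forall x, 0 <= x -> 0 <= rho x <= M) ->
  (fun n : nat => aged_pairing rho f n%:R) @ \oo --> (0 : R).
Proof.
move=> cr cf fK rM.
have : (fun n : nat => aged_pairing rho f n%:R) @ \oo --> (\int[leb]_(x in Rp) 0 : R).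
  apply: (cvg_param_integral _ _ _ (tailM_integrable (K * M))) => //.
  - by move=> n; exact: aged_meas.
  - by move=> n x /=; rewrite in_itv/= andbT => x0; exact: aged_le.
  - move=> x /=; rewrite in_itv/= andbT => x0; have /andP[r0 rM0] := rM x x0.
    apply/cvgr0Pnorm_le => e e0.
    have K0 : 0 <= K := le_trans (normr_ge0 _) (fK 0).
    have M0 : 0 <= M := le_trans r0 rM0.
    (* The [+ 1] keeps the denominator positive when [K * M] is 0. *)
    have d0 : 0 < e / (K * M + 1) by rewrite divr_gt0// ltr_wpDl// mulr_ge0.
    have /cvgr0Pnorm_le/(_ _ d0) := tail_cvg0.
    apply: filterS => n; rewrite (ger0_norm (tail_ge0 hG _)) => Tn.
    rewrite !normrM (ger0_norm r0) (ger0_norm (tail_ge0 hG _)) mulrAC.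
    have Tx : T (x + n%:R) <= T n%:R by apply: (tail_nonincreasing hG); rewrite lerDr.
    have : `|f (x + n%:R)| * rho x * T (x + n%:R) <= (K * M) * (e / (K * M + 1)).
      apply: ler_pM.
      + by rewrite mulr_ge0.
      + exact: tail_ge0 hG _.
      + by apply: ler_pM.
      + exact: le_trans Tn.
    move=> /le_trans; apply; rewrite mulrA ler_pdivrMr; last by rewrite ltr_wpDl// mulr_ge0.
    by rewrite mulrDr mulr1 [e * _]mulrC lerDl ltW.
by rewrite Rintegral_cst// mul0r.
Qed.

End Transport.

(** * Stieltjes integrals against linear departure processes *)

Section Stieltjes.
Context {R : realType}.
Notation leb := (@lebesgue_measure R).
Implicit Types (k : R -> R) (c t : R).

Lemma lebesgue_stieltjes_linear (D : cumulative R R) c : 0 <= c ->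
  (forall s, D s = if 0 <= s then c * s else 0) ->
  forall A : set (measurableTypeR R), measurable A ->
  A `<=` (`[0, +oo[%classic : set (measurableTypeR R)) ->
  lebesgue_stieltjes_measure D A = (c%:E * leb A)%E.
Proof.
move=> c0 DE A mA A0.
have mRp : measurable (`[0, +oo[%classic : set (measurableTypeR R)) by [].
(* With Lebesgue measure restricted to the half-line, the two measures agree on every half-open
   interval, also on those that meet negative times, where [D] is 0. *)
pose m := mscale (NngNum c0) (mrestr leb mRp).
suff mE X : ocitv X -> lebesgue_stieltjes_measure D X = m X.
  rewrite (@lebesgue_stieltjes_measure_unique R D m mE A mA).
  have e1 : m A = (c%:E * leb (A `&` (`[0%R, +oo[%classic : set (measurableTypeR R))))%E by [].
  by apply: (etrans e1); rewrite setIidl.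
move=> [[a b] _ <-]/=.
have [ab|ba] := leP a b; last first.
  by rewrite set_itv_ge ?bnd_simp -?leNgt ?ltW// !measure0.
rewrite /lebesgue_stieltjes_measure /measure_extension/= measurable_mu_extE/=; last exact: is_ocitv.
rewrite wlength_itv_bnd// !DE.
have e1 : m `]a, b]%classic = (c%:E * leb (`]a, b]%classic `&` `[0%R, +oo[%classic))%E by [].
apply/esym/(etrans e1)/esym.
have [b0|b0] := leP 0 b; last first.
  rewrite (leNgt 0 a) (le_lt_trans ab b0)/= subrr (_ : _ `&` _ = set0) ?measure0 ?mule0//.
  apply/seteqP; split => x //=; rewrite !in_itv/= andbT => -[/andP[_ xb] x0].
  by have := le_lt_trans (le_trans x0 xb) b0; rewrite ltxx.
have [a0|a0] := leP 0 a.
  rewrite setIidl; last first.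
    by move=> x /=; rewrite !in_itv/= andbT => /andP[/ltW + _]; exact: le_trans.
  rewrite lebesgue_measure_itv/= lte_fin lt_neqAle ab andbT.
  have [->|_] := eqVneq a b; first by rewrite subrr mule0.
  by rewrite -EFinD -EFinM mulrBr.
have -> : `]a, b] `&` `[0, +oo[ = `[0, b]%classic.
  apply/seteqP; split => x /=; rewrite !in_itv/= andbT.
    by move=> [/andP[_ ->]] ->.
  by move=> /andP[x0 ->]; rewrite x0 (lt_le_trans a0 x0).
rewrite lebesgue_measure_itv/= lte_fin subr0 le0r in b0 *.
case/orP: b0 => [/eqP->|->]; first by rewrite ltxx mulr0 mule0.
by rewrite oppr0 addr0 -EFinM.
Qed.

Lemma Rintegral_stieltjes_linear (D : cumulative R R) c t k : 0 <= c ->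
  (forall s, D s = if 0 <= s then c * s else 0) ->
  leb.-integrable `[0, t] (EFin \o k) ->
  \int[lebesgue_stieltjes_measure D]_(s in `[0, t]) k s =
  c * \int[leb]_(s in `[0, t]) k s.
Proof.
move=> c0 DE ik; rewrite /Rintegral.
have -> : (\int[lebesgue_stieltjes_measure D]_(s in `[0%R, t]) (k s)%:E =
    \int[mscale (NngNum c0) leb]_(s in `[0%R, t]) (k s)%:E)%E.
  apply: eq_measure_integral => A mA At.
  apply: (etrans (lebesgue_stieltjes_linear c0 DE mA _)) => // x /At /=.
  by rewrite !in_itv/= andbT => /andP[].
have mk : measurable_fun (`[0, t]%classic : set (measurableTypeR R)) (EFin \o k).
  exact: measurable_int ik.
rewrite [X in fine X = _]integralE [X in _ = _ * fine X]integralE !ge0_integral_mscale//=; last 2 first.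
- exact: measurable_funeneg.
- exact: measurable_funepos.
have mI : measurable (`[0, t]%classic : set (measurableTypeR R)) by [].
have /fineK <- := integrable_fin_num mI (integrable_funepos mI ik).
have /fineK <- := integrable_fin_num mI (integrable_funeneg mI ik).
by rewrite -!EFinM -!EFinB/= mulrBr.
Qed.

Lemma Rintegral_reflect t k :
  measurable_fun (`[0, t]%classic : set (measurableTypeR R)) k ->
  \int[leb]_(s in `[0, t]) k (t - s) = \int[leb]_(s in `[0, t]) k s.
Proof.
move=> mk; rewrite /Rintegral; congr fine.
have := @integral_leb_reflect R t `[0, t]%classic (EFin \o k) (measurable_itv _).
move=> <-; last exact/measurable_EFinP.
congr (integral _ _ _); apply/seteqP; split => s /=; rewrite !in_itv/=.
  by move=> /andP[s0 st]; rewrite subr_ge0 st gerBl.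
by rewrite subr_ge0 gerBl andbC.
Qed.

End Stieltjes.

(** * The transport identity for bounded test functions *)

Section TransportReal.
Context {R : realType}.
Notation leb := (@lebesgue_measure R).
Notation Rp := (`[0%R, +oo[%classic : set (measurableTypeR R)).
Variables (G g : R -> R).
Hypothesis hG : service_distribution G g.
Notation T := (tail G).
Notation I := (aged_pairing G).
Variables (a c M : R) (r rho : R -> R).
Hypotheses (cr : continuous r) (crho : continuous rho) (c0 : 0 <= c) (a0 : 0 <= a)
  (rhoE : forall x, 0 <= x -> rho x = c + \int[leb]_(u in `[0, x]) (a * (r u - rho u)))
  (rho0 : forall x, 0 <= x -> 0 <= rho x <= r x)
  (rM : forall x, 0 <= x -> r x <= M).

Let r0 x : 0 <= x -> 0 <= r x <= M.
Proof. by move=> x0; rewrite rM// andbT; have /andP[] := rho0 x0; exact: le_trans. Qed.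

Let rhoM x : 0 <= x -> 0 <= rho x <= M.
Proof. by move=> x0; have /andP[-> /le_trans] := rho0 x0; apply; exact: rM. Qed.

Let flux_continuous (f : R -> R) K : continuous f -> (forall x, `|f x| <= K) ->
  continuous (fun u : R => a * (I r f (Num.max u 0) - I rho f (Num.max u 0))).
Proof.
move=> cf fK u; apply: cvgM; first exact: cvg_cst.
apply: cvgB; first exact: (aged_pairing_continuous hG cr cf fK r0).
exact: (aged_pairing_continuous hG crho cf fK rhoM).
Qed.

Let fluxE (f : R -> R) t : \int[leb]_(u in `[0, t]) (a * (I r f u - I rho f u)) =
  \int[leb]_(u in `[0, t]) (a * (I r f (Num.max u 0) - I rho f (Num.max u 0))).
Proof.
by apply: eq_Rintegral => u; rewrite inE/= in_itv/= => /andP[u0 _]; rewrite (max_idPl u0).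
Qed.

Let cfT (f : R -> R) : continuous f -> continuous (fun x => f x * T x).
Proof. by move=> cf x; apply: cvgM; [exact: cf|exact: (tail_continuous hG)]. Qed.

Let EFin_pairing (rho' f : R -> R) (K u : R) : continuous rho' ->
  (forall x, 0 <= x -> 0 <= rho' x <= M) -> continuous f ->
  (forall x, `|f x| <= K) -> 0 <= u ->
  (I rho' f u)%:E = (\int[leb]_(x in Rp) (f (x + u) * T (x + u) * rho' x)%:E)%E.
Proof.
move=> cr' rM' cf fK u0; rewrite /aged_pairing /Rintegral fineK//.
by apply: integrable_fin_num => //; exact: (aged_integrable hG cr' cf fK rM').
Qed.

Let EFin_itv k t : continuous k ->
  (\int[leb]_(x in `[0%R, t]) (k x)%:E)%E = (\int[leb]_(x in `[0, t]) k x)%:E.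
Proof.
move=> ck; rewrite /Rintegral fineK//; apply: integrable_fin_num => //.
exact: integrable_continuous_itv.
Qed.

(** The inflow [q = a (r - rho)] is nonnegative because [rho <= r], so [transport_identity] applies;
    the bounds [K] and [M] make all its terms finite. *)
Let transport_ge0 (f : R -> R) K t : continuous f -> (forall x, `|f x| <= K) ->
  (forall x, 0 <= f x) -> 0 <= t ->
  I rho f 0 = I rho f t + c * \int[leb]_(u in `[0, t]) (f u * T u) +
    \int[leb]_(u in `[0, t]) (a * (I r f u - I rho f u)).
Proof.
move=> cf fK f0 t0.
pose q x := a * (r (Num.max x 0) - rho (Num.max x 0)).
have q0 x : 0 <= q x.
  have m0 : 0 <= Num.max x 0 by rewrite le_max lexx orbT.
  by rewrite mulr_ge0// subr_ge0; case/andP: (rho0 m0).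
have cq : continuous q.
  have cm : continuous (fun u : R => Num.max u 0).
    by move=> v; apply: (@continuous_max _ _ (id : R -> R^o) (cst 0 : R -> R^o)); [exact: cvg_id|exact: cvg_cst].
  move=> x; apply: cvgM; first exact: cvg_cst.
  by apply: cvgB; apply: (@continuous_comp _ _ _ (fun u : R => Num.max u 0)); [exact: cm|exact: cr|exact: cm|exact: crho].
have F0 x : 0 <= f x * T x by rewrite mulr_ge0// (tail_ge0 hG).
have H := @transport_identity R (fun x => f x * T x) q c t
  (continuous_measurable_fun (cfT cf)) (continuous_measurable_fun cq) F0 q0 c0 t0.
have qE x : 0 <= x -> (c%:E + \int[leb]_(u in `[0%R, x]) (q u)%:E)%E = (rho x)%:E.
  move=> x0; rewrite EFin_itv// -EFinD rhoE//; congr (c + _)%:E.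
  apply: eq_Rintegral => u; rewrite inE/= in_itv/= => /andP[u0 _].
  by rewrite /q (max_idPl u0).
have lhsE u : 0 <= u -> (\int[leb]_(x in `[0%R, +oo[) ((f (x + u) * T (x + u))%:E *
    (c%:E + \int[leb]_(u in `[0%R, x]) (q u)%:E)))%E = (I rho f u)%:E.
  move=> u0; rewrite (EFin_pairing crho rhoM cf fK u0); apply: eq_integral => x.
  by rewrite inE/= in_itv/= andbT => x0; rewrite qE.
have := lhsE 0 (lexx 0); under eq_integral do rewrite addr0.
rewrite H lhsE// EFin_itv; last exact: cfT.
have -> : (\int[leb]_(u in `[0%R, t]) \int[leb]_(x in `[0%R, +oo[)
      (f (x + u) * T (x + u) * q x)%:E)%E =
    (\int[leb]_(u in `[0%R, t]) (a * (I r f (Num.max u 0) - I rho f (Num.max u 0)))%:E)%E.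
  apply: eq_integral => u; rewrite inE/= in_itv/= => /andP[u0 _].
  rewrite (max_idPl u0) EFinM EFinB (EFin_pairing cr r0 cf fK u0) (EFin_pairing crho rhoM cf fK u0).
  have ir := aged_integrable hG cr cf fK r0 u0.
  have irho := aged_integrable hG crho cf fK rhoM u0.
  rewrite -integralB// -integralZl//; last exact: integrableB.
  apply: eq_integral => x; rewrite inE/= in_itv/= andbT => x0.
  by rewrite -EFinB -EFinM /q (max_idPl x0); congr (_%:E); ring.
rewrite EFin_itv; last exact: flux_continuous fK.
by rewrite -EFinM -!EFinD (fluxE f) => H2; apply: EFin_inj; exact/esym.
Qed.

(** Both sides are linear in [f], and a signed [f] is the difference of the nonnegative functions
    [f + K] and [K]. *)
Lemma transport_real (f : R -> R) K t : continuous f -> (forall x, `|f x| <= K) -> 0 <= t ->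
  I rho f 0 = I rho f t + c * \int[leb]_(u in `[0, t]) (f u * T u) +
    \int[leb]_(u in `[0, t]) (a * (I r f u - I rho f u)).
Proof.
move=> cf fK t0.
have K0 : 0 <= K := le_trans (normr_ge0 _) (fK 0).
pose f1 x := f x + K; pose f2 : R -> R := cst K.
have cf1 : continuous f1 by move=> x; apply: cvgD; [exact: cf|exact: cvg_cst].
have cf2 : continuous f2 by exact: cst_continuous.
have f1K x : `|f1 x| <= K + K by rewrite (le_trans (ler_normD _ _))// lerD// ger0_norm.
have f2K x : `|f2 x| <= K by rewrite /f2/= ger0_norm.
have f10 x : 0 <= f1 x by have := fK x; rewrite ler_norml /f1 => /andP[+ _]; lra.
have fE : f = fun x => f1 x - f2 x by apply/funext => x; rewrite /f1 /f2/= addrK.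
have E1 := transport_ge0 cf1 f1K f10 t0.
have E2 := transport_ge0 cf2 f2K (fun=> K0) t0.
have B (rho' : R -> R) (u : R) : continuous rho' -> (forall x, 0 <= x -> 0 <= rho' x <= M) -> 0 <= u ->
    I rho' f u = I rho' f1 u - I rho' f2 u.
  by move=> cr' rM' u0; rewrite fE; exact: (aged_pairingB hG cr' cf1 cf2 f1K f2K rM').
have BT : \int[leb]_(u in `[0, t]) (f u * T u) =
    \int[leb]_(u in `[0, t]) (f1 u * T u) - \int[leb]_(u in `[0, t]) (f2 u * T u).
  rewrite -RintegralB//; try exact/integrable_continuous_itv/cfT.
  by apply: eq_Rintegral => u _; rewrite fE mulrBl.
have BF : \int[leb]_(u in `[0, t]) (a * (I r f u - I rho f u)) =
    \int[leb]_(u in `[0, t]) (a * (I r f1 u - I rho f1 u)) -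
    \int[leb]_(u in `[0, t]) (a * (I r f2 u - I rho f2 u)).
  rewrite (fluxE f1) (fluxE f2) -RintegralB//; last 2 first.
  - exact/integrable_continuous_itv/(flux_continuous cf1 f1K).
  - exact/integrable_continuous_itv/(flux_continuous cf2 f2K).
  apply: eq_Rintegral => u; rewrite inE/= in_itv/= => /andP[u0 _].
  by rewrite (max_idPl u0) !B//; ring.
have alg (x1 x2 y1 y2 z1 z2 w1 w2 : R) : x1 = y1 + c * z1 + w1 -> x2 = y2 + c * z2 + w2 ->
    x1 - x2 = (y1 - y2) + c * (z1 - z2) + (w1 - w2) by move=> -> ->; ring.
by rewrite BT BF (B rho 0)// (B rho t)//; exact: alg E1 E2.
Qed.

End TransportReal.

(** * Measurability of inversion and extension of test functions *)

Section MeasurableInv.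
Context {R : realType}.

(** Needed for the ratio of tails in [aged]: inversion is continuous off 0, and 0 is split off as a
    single point. *)
Lemma measurable_invr : measurable_fun [set: R] (fun x : R => x^-1).
Proof.
rewrite -(setUv [set (0 : R)]); apply/measurable_funU.
- exact: measurable_set1.
- by apply: measurableC; exact: measurable_set1.
split; first exact: measurable_fun_set1.
apply: open_continuous_measurable_fun.
  rewrite (_ : [set~ 0] = [set x : R | x < 0] `|` [set x | 0 < x]).
    by apply: openU; [exact: open_lt|exact: open_gt].
  apply/seteqP; split => x /=; first by move=> /eqP; rewrite neq_lt => /orP.
  by case => [/lt_eqF|/gt_eqF] /eqP.
move=> x; rewrite inE/= => /eqP x0; apply: cvgV => //; exact: cvg_id.
Qed.

(** Pairings see only nonnegative ages, so a test function may be extended by its value at 0 and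
    treated as continuous on the line. *)
Lemma Cb_extension (f : R -> R) : Cb `[0, +oo[ f -> exists f' K, [/\ continuous f',
  forall x, `|f' x| <= K & forall x, 0 <= x -> f x = f' x].
Proof.
move=> [cf bf].
have [K fK] : exists K, forall x, 0 <= x -> `|f x| <= K.
  have [K HK] := @filter_ex _ (+oo%R : set_system R) _ _ bf.
  by exists K => x x0; apply: HK; rewrite /= in_itv/= x0.
exists (fun x => f (Num.max x 0)), K; split.
- move=> x.
  have m0 (y : R) : 0 <= Num.max y 0 by rewrite le_max lexx orbT.
  have cm : Num.max y 0 @[y --> x] --> Num.max x 0.
    by apply: (@continuous_max _ _ (id : R -> R^o) (cst 0 : R -> R^o)); [exact: cvg_id|exact: cvg_cst].
  move/subspace_continuousP : cf => /(_ (Num.max x 0)).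
  rewrite /= in_itv/= m0 => /(_ isT) H.
  apply: cvg_comp H.
  move=> P HP.
  have H1 : nbhs (Num.max x 0) [set z | `[0, +oo[%classic z -> P z] := HP.
  have H2 : nbhs x [set y | `[0, +oo[%classic (Num.max y 0) -> P (Num.max y 0)] := cm _ H1.
  change (nbhs x [set y | P (Num.max y 0)]).
  move: H2; apply: filterS => y /= Hy; apply: Hy.
  by rewrite in_itv/= m0.
- by move=> x; apply: fK; rewrite le_max lexx orbT.
- by move=> x x0; rewrite (max_idPl x0).
Qed.

Lemma Cb_continuous (A : set R) (f : R -> R) K : continuous f -> (forall x, `|f x| <= K) ->
  Cb A f.
Proof.
move=> cf fK; split; first exact: continuous_subspaceT.
exists K; split; first exact: num_real.
by move=> M KM x _ /=; exact: le_trans (fK x) (ltW KM).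
Qed.
End MeasurableInv.

(** * Pairings with aged test functions *)

Section AgedMeasure.
Context {R : realType}.
Notation leb := (@lebesgue_measure R).
Notation Rp := (`[0%R, +oo[%classic : set (measurableTypeR R)).
Variables (G g : R -> R).
Hypothesis hG : service_distribution G g.
Notation T := (tail G).
Notation I := (aged_pairing G).
Notation age := (age_space G).
Implicit Types (f : R -> R) (u t K x : R) (nu : subprobability (measurableTypeR R) R).

Lemma age_ge0 x : age x -> 0 <= x. Proof. by case. Qed.

Lemma age_tail_gt0 x : age x -> 0 < T x.
Proof. by rewrite (age_spaceE hG) => -[]. Qed.

Lemma aged_measurable f u : continuous f -> measurable_fun [set: measurableTypeR R] (aged G f u : measurableTypeR R -> R).
Proof.
move=> cf; have ms : measurable_fun [set: measurableTypeR R] (fun x : R => x + u) by exact: measurable_funD.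
apply: measurable_funM.
  exact: measurableT_comp (continuous_measurable_fun cf) ms.
apply: measurable_funM; first exact: measurableT_comp (tail_measurable hG) ms.
exact: measurableT_comp measurable_invr (tail_measurable hG).
Qed.

Lemma tail_ratio01 x u : age x -> 0 <= u -> 0 <= T (x + u) / T x <= 1.
Proof.
move=> ax u0; have Tx := age_tail_gt0 ax.
rewrite divr_ge0 ?(tail_ge0 hG)//= ler_pdivrMr// mul1r.
by apply: (tail_nonincreasing hG); rewrite lerDl.
Qed.

Lemma aged_bound f K x u : (forall x, `|f x| <= K) -> age x -> 0 <= u ->
  `|aged G f u x| <= K.
Proof.
move=> fK ax u0; have /andP[t0 t1] := tail_ratio01 ax u0.
rewrite /aged normrM (ger0_norm t0) (le_trans _ (fK (x + u)))// ler_piMr//.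
Qed.

Lemma max0_ge0 (u : R) : 0 <= Num.max u 0. Proof. by rewrite le_max lexx orbT. Qed.

Lemma pairing_aged_continuous nu f K : continuous f -> (forall x, `|f x| <= K) ->
  continuous (fun u : R => pairing G (aged G f (Num.max u 0)) nu).
Proof.
move=> cf fK; have mage := age_space_measurable hG.
apply: (@continuous_param_integral _ _ R nu age (fun u : R => aged G f (Num.max u 0)) (cst K)) => //.
- by move=> u; apply: measurable_funTS; exact: aged_measurable.
- exact: finite_measure_integrable_cst.
- by move=> u x ax; apply: aged_bound => //; exact: max0_ge0.
- move=> x _ u.
  have cm : continuous (fun u : R => x + Num.max u 0).
    move=> v; apply: cvgD; first exact: cvg_cst.
    by apply: (@continuous_max _ _ (id : R -> R^o) (cst 0 : R -> R^o)); [exact: cvg_id|exact: cvg_cst].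
  apply: cvgM; first by apply: (@continuous_comp _ _ _ (fun u : R => x + Num.max u 0) f u); [exact: cm|exact: cf].
  apply: cvgM; last exact: cvg_cst.
  by apply: (@continuous_comp _ _ _ (fun u : R => x + Num.max u 0) T u); [exact: cm|exact: (tail_continuous hG)].
Qed.

(** At each age [x] the ratio [T (x + n) / T x] tends to 0, though not uniformly in [x]; as [nu] is
    finite, the constant [K] dominates. *)
Lemma pairing_aged_cvg0 nu f K : continuous f -> (forall x, `|f x| <= K) ->
  (fun n : nat => pairing G (aged G f n%:R) nu) @ \oo --> (0 : R).
Proof.
move=> cf fK; have mage := age_space_measurable hG.
have K0 : 0 <= K := le_trans (normr_ge0 _) (fK 0).
have : (fun n : nat => pairing G (aged G f n%:R) nu) @ \oo --> (\int[nu]_(x in age) 0 : R).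
  apply: (@cvg_param_integral _ _ R nu age _ _ (cst K)) => //.
  - by move=> n; apply: measurable_funTS; exact: aged_measurable.
  - exact: finite_measure_integrable_cst.
  - by move=> n x ax; exact: aged_bound.
  - move=> x ax; apply/cvgr0Pnorm_le => e e0.
    have Tx := age_tail_gt0 ax.
    have d0 : 0 < e * T x / (K + 1) by rewrite divr_gt0 ?mulr_gt0// ltr_wpDl.
    have /cvgr0Pnorm_le/(_ _ d0) := tail_cvg0 hG.
    apply: filterS => n; rewrite (ger0_norm (tail_ge0 hG _)) => Tn.
    have Tn' : T (x + n%:R) <= e * T x / (K + 1).
      by apply: le_trans Tn; apply: (tail_nonincreasing hG); rewrite lerDr age_ge0.
    have /andP[t0 _] := tail_ratio01 ax (ler0n R n).
    rewrite /aged normrM (ger0_norm t0) mulrA ler_pdivrMr//.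
    have : `|f (x + n%:R)| * T (x + n%:R) <= K * (e * T x / (K + 1)).
      by apply: ler_pM => //; exact: (tail_ge0 hG).
    move=> /le_trans; apply; rewrite mulrA ler_pdivrMr ?ltr_wpDl//.
    rewrite -subr_ge0 (_ : _ - _ = e * T x); last by ring.
    by rewrite mulr_ge0 ?ltW.
by rewrite Rintegral_cst// mul0r.
Qed.

Lemma pairing_aged0 nu f : pairing G (aged G f 0) nu = pairing G f nu.
Proof.
apply: eq_Rintegral => x /set_mem ax; rewrite /aged addr0 divff ?mulr1//.
by rewrite gt_eqF// age_tail_gt0.
Qed.

Lemma eq_pairing (mu : {measure set (measurableTypeR R) -> \bar R}) f f' :
  (forall x, 0 <= x -> f x = f' x) -> pairing G f mu = pairing G f' mu.
Proof. by move=> ff'; apply: eq_Rintegral => x /set_mem /age_ge0 /ff'. Qed.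

Lemma Rintegral_aged_age (rho f : R -> R) u : 0 <= u ->
  (\int[leb]_(x in age) (f (x + u) * T (x + u) * rho x)%:E =
   \int[leb]_(x in Rp) (f (x + u) * T (x + u) * rho x)%:E)%E.
Proof.
move=> u0; rewrite integral_mkcond [RHS]integral_mkcond; apply: eq_integral => x _.
rewrite !patchE; case: ifPn => [|].
  by rewrite inE => -[x0 _]; rewrite ifT// inE/= in_itv/= x0.
rewrite notin_setE => nx; case: ifPn => //; rewrite inE/= in_itv/= andbT => x0.
rewrite (_ : T (x + u) = 0) ?mulr0 ?mul0r//; apply: (tail_out hG); first exact: addr_ge0.
by apply: contra_not nx; apply: (age_space_le hG) => //; rewrite lerDl.
Qed.

Lemma pairing_aged_density nu (rho f : R -> R) u : continuous rho ->
  (forall x, 0 <= x -> 0 <= rho x) -> nu (~` age) = 0%E ->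
  (forall A, measurable A -> A `<=` age -> nu A = (\int[leb]_(x in A) (rho x * T x)%:E)%E) ->
  continuous f -> 0 <= u -> pairing G (aged G f u) nu = I rho f u.
Proof.
move=> cr r0 nu0 nuE cf u0; rewrite /pairing /aged_pairing /Rintegral; congr fine.
rewrite -Rintegral_aged_age//.
rewrite (@integral_density R nu age (fun x => rho x * T x))//.
- by apply: eq_integral => x /set_mem /age_tail_gt0 Tx; rewrite -EFinM /aged; congr (_%:E);
   field; rewrite gt_eqF.
- exact: (age_space_measurable hG).
- apply: measurable_funTS; apply: continuous_measurable_fun => x.
  by apply: cvgM; [exact: cr|exact: (tail_continuous hG)].
- by move=> x /age_ge0 x0; rewrite mulr_ge0 ?r0// (tail_ge0 hG).
- by apply/measurable_EFinP; apply: measurable_funTS; exact: aged_measurable.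
Qed.

(** Testing against 1 shows that [rho T] has mass at most 1, so it is the density of a
    subprobability [nu']. The two measures agree on continuous functions, hence on Borel sets. *)
Lemma state_of_pairings nu (rho : R -> R) M : continuous rho ->
  (forall x, 0 <= x -> 0 <= rho x <= M) -> nu (~` age) = 0%E ->
  (forall f K, continuous f -> (forall x, `|f x| <= K) -> pairing G f nu = I rho f 0) ->
  forall A, measurable A -> A `<=` age -> nu A = (\int[leb]_(x in A) (rho x * T x)%:E)%E.
Proof.
move=> cr r0 nu0 nuI A mA Aage.
have mage := age_space_measurable hG.
pose w : R -> R := (fun x => rho x * T x) \_ Rp.
have wE x : 0 <= x -> w x = rho x * T x by move=> x0; rewrite /w patchE mem_set//= in_itv/= x0.
have w0 x : 0 <= w x.
  rewrite /w patchE; case: ifPn => //; rewrite inE/= in_itv/= andbT => x0.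
  by rewrite mulr_ge0 ?(tail_ge0 hG)//; case/andP: (r0 x x0).
have mw : measurable_fun [set: measurableTypeR R] w.
  have mrT : measurable_fun [set: measurableTypeR R] (fun x : R => rho x * T x).
    apply: continuous_measurable_fun => x.
    by apply: cvgM; [exact: cr|exact: (tail_continuous hG)].
  have mRp : measurable Rp by [].
  by apply/(measurable_restrictT _ mRp); exact: measurable_funTS.
have fw (f : R -> R) K : continuous f -> (forall x, `|f x| <= K) ->
    (\int[leb]_x ((f x)%:E * (w x)%:E) = (pairing G f nu)%:E)%E.
  move=> cf fK; rewrite (nuI f K)// /aged_pairing /Rintegral fineK; last first.
    by apply: integrable_fin_num => //; exact: (aged_integrable hG cr cf fK r0).
  rewrite [RHS]integral_mkcond; apply: eq_integral => x _.
  rewrite /w !patchE; case: ifPn => _; last by rewrite mule0.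
  by rewrite -EFinM addr0 mulrCA mulrC.
have nuT (f : R -> R) : measurable_fun [set: measurableTypeR R] (f : measurableTypeR R -> R) ->
    (forall x, 0 <= f x) -> (\int[nu]_x (f x)%:E = \int[nu]_(x in age) (f x)%:E)%E.
  move=> mf f0; rewrite (@ge0_negligible_integral _ _ _ nu setT (~` age))//.
  - by rewrite setTD setCK.
  - exact: measurableC.
  - exact/measurable_EFinP.
  - by move=> *; rewrite lee_fin.
have pairE (f : R -> R) K : continuous f -> (forall x, `|f x| <= K) -> (forall x, 0 <= f x) ->
    ((pairing G f nu)%:E = \int[nu]_x (f x)%:E)%E.
  move=> cf fK f0; rewrite nuT//; last exact: continuous_measurable_fun.
  rewrite /pairing /Rintegral fineK//; apply: integrable_fin_num => //.
  apply: (le_integrable mage _ _ (finite_measure_integrable_cst nu K mage)).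
    by apply/measurable_EFinP; apply: measurable_funTS; exact: continuous_measurable_fun.
  by move=> x _ /=; rewrite lee_fin (le_trans (fK x))// ler_norm.
have w1 : (\int[leb]_x (w x)%:E <= 1)%E.
  have c1 : continuous (cst 1 : R -> R) by exact: cst_continuous.
  have n1 (x : R) : `|(cst 1 : R -> R) x| <= 1 by rewrite normr1.
  have := fw _ _ c1 n1; under eq_integral do rewrite mul1e.
  move=> ->; rewrite (pairE _ _ c1 n1)//.
  have -> : (\int[nu]_x ((cst 1 : R -> R) x)%:E = \int[nu]_x (cst 1%E x))%E by [].
  by rewrite integral_cst// mul1e sprobability_setT.
have [nu' nu'E] := subprobability_of_density mw w0 w1.
have -> : nu A = nu' A.
  apply: finite_measure_eq mA => f cf f01.
  have f0 x : 0 <= f x by case/andP: (f01 x).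
  have f1 x : `|f x| <= 1 by rewrite ger0_norm//; case/andP: (f01 x).
  rewrite -(pairE f 1)// -(fw f 1)//; apply/esym.
  rewrite (@integral_density R nu' setT w)//.
  - by rewrite setCT measure0.
  - by move=> B _ _; exact: nu'E.
  - by apply/measurable_EFinP; exact: continuous_measurable_fun.
rewrite nu'E; apply: eq_integral => x /set_mem /Aage /age_ge0 x0.
by rewrite wE.
Qed.

Variables (a c M : R) (r rho : R -> R).
Hypotheses (cr : continuous r) (crho : continuous rho) (c0 : 0 <= c) (a0 : 0 <= a)
  (rhoE : forall x, 0 <= x -> rho x = c + \int[leb]_(u in `[0, x]) (a * (r u - rho u)))
  (rho0 : forall x, 0 <= x -> 0 <= rho x <= r x)
  (rM : forall x, 0 <= x -> r x <= M).

(** The equation for [nu] and [transport_real] share their terms in [c] and in [r], which cancel in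
    the difference and leave a closed equation for [phi]. *)
Lemma pairing_transport_unique nu f K : continuous f -> (forall x, `|f x| <= K) ->
  (forall t, 0 <= t ->
    pairing G f nu = pairing G (aged G f t) nu + c * \int[leb]_(u in `[0, t]) (f u * T u) +
      \int[leb]_(u in `[0, t]) (a * (I r f u - pairing G (aged G f u) nu))) ->
  pairing G f nu = I rho f 0.
Proof.
move=> cf fK eqn.
have r0 x : 0 <= x -> 0 <= r x <= M.
  by move=> x0; rewrite rM// andbT; have /andP[] := rho0 x0; exact: le_trans.
have rhoM x : 0 <= x -> 0 <= rho x <= M.
  by move=> x0; have /andP[-> /le_trans] := rho0 x0; apply; exact: rM.
pose phi (u : R) := pairing G (aged G f (Num.max u 0)) nu - I rho f (Num.max u 0).
have cP := @pairing_aged_continuous nu f K cf fK.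
have cphi : continuous phi.
  move=> u; apply: cvgB; first exact: cP.
  exact: (aged_pairing_continuous hG crho cf fK rhoM).
have phiE u : 0 <= u -> phi u = pairing G (aged G f u) nu - I rho f u.
  by move=> u0; rewrite /phi (max_idPl u0).
have : phi 0 = 0.
  apply: (exp_ode_zero a0 cphi); last first.
    rewrite (_ : (fun n : nat => _) = (fun n : nat => pairing G (aged G f n%:R) nu - I rho f n%:R)).
      rewrite -[0]subr0; apply: cvgB; first exact: (@pairing_aged_cvg0 nu f K).
      exact: (aged_pairing_cvg0 hG crho cf fK rhoM).
    by apply/funext => n; rewrite phiE.
  move=> t t0; rewrite !phiE// pairing_aged0.
  have E1 := eqn t t0.
  have E2 := transport_real hG cr crho c0 a0 rhoE rho0 rM cf fK t0.
  have E3 : \int[leb]_(u in `[0, t]) (a * (I r f u - I rho f u)) -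
      \int[leb]_(u in `[0, t]) (a * (I r f u - pairing G (aged G f u) nu)) =
      a * \int[leb]_(u in `[0, t]) phi u.
    rewrite -RintegralZl//; last exact: integrable_continuous_itv.
    rewrite (_ : \int[leb]_(u in `[0, t]) (a * (I r f u - I rho f u)) =
      \int[leb]_(u in `[0, t]) (a * (I r f (Num.max u 0) - I rho f (Num.max u 0)))); last first.
      by apply: eq_Rintegral => u; rewrite inE/= in_itv/= => /andP[u0 _]; rewrite (max_idPl u0).
    rewrite (_ : \int[leb]_(u in `[0, t]) (a * (I r f u - pairing G (aged G f u) nu)) =
      \int[leb]_(u in `[0, t]) (a * (I r f (Num.max u 0) - pairing G (aged G f (Num.max u 0)) nu))); last first.
      by apply: eq_Rintegral => u; rewrite inE/= in_itv/= => /andP[u0 _]; rewrite (max_idPl u0).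
    rewrite -RintegralB//; last 2 first.
    - apply: integrable_continuous_itv => u; apply: cvgM; first exact: cvg_cst.
      apply: cvgB; first exact: (aged_pairing_continuous hG cr cf fK r0).
      exact: (aged_pairing_continuous hG crho cf fK rhoM).
    - apply: integrable_continuous_itv => u; apply: cvgM; first exact: cvg_cst.
      apply: cvgB; first exact: (aged_pairing_continuous hG cr cf fK r0).
      exact: cP.
    by apply: eq_Rintegral => u _; rewrite /phi; ring.
  rewrite -E3.
  have alg (x1 x2 y1 y2 z w1 w2 : R) : x1 = y1 + z + w1 -> x2 = y2 + z + w2 ->
    y1 - y2 = x1 - x2 + (w2 - w1) by move=> -> ->; ring.
  exact: alg E1 E2.
by rewrite phiE// pairing_aged0 => /eqP; rewrite subr_eq0 => /eqP.
Qed.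

End AgedMeasure.

(** * The hydrodynamic equations at a constant state *)

Section Hydro.
Context {R : realType}.
Notation leb := (@lebesgue_measure R).
Variables (G g : R -> R) (lam : R) (d : nat).
Hypothesis hG : service_distribution G g.
Notation T := (tail G).
Notation age := (age_space G).
Implicit Types (nu : @mseq R) (f : R -> R) (t c K : R) (l : nat).

Lemma Pd_mulB (x y : R) : Pd d x y * (x - y) = x ^+ d - y ^+ d.
Proof.
rewrite -[RHS]opprB subrXX -mulNr opprB mulrC; congr (_ * _).
by apply: eq_bigr => i _; rewrite mulrC.
Qed.

Lemma Pd_ge0 (x y : R) : 0 <= x -> 0 <= y -> 0 <= Pd d x y.
Proof. by move=> x0 y0; apply: sumr_ge0 => i _; rewrite mulr_ge0 ?exprn_ge0. Qed.

Lemma arrivals_first_aged nu f u : continuous f -> 0 <= u ->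
  arrivals G lam d nu 1 (aged G f u) = lam * (1 - mass G (nu 1%N) ^+ d) * (f u * T u).
Proof.
move=> cf u0; rewrite /arrivals eqxx; congr (_ * _).
rewrite /Rintegral integral_dirac//; last 2 first.
- exact: (age_space_measurable hG).
- by apply/measurable_EFinP; apply: measurable_funTS; exact: (aged_measurable hG).
rewrite diracE mem_set; last exact: (age_space0 hG).
by rewrite mul1e /= /aged add0r (tail_le0 hG (lexx 0)) divr1.
Qed.

Lemma arrivals_first_total nu :
  arrivals G lam d nu 1 (fun=> 1) = lam * (1 - mass G (nu 1%N) ^+ d).
Proof.
rewrite /arrivals eqxx /Rintegral integral_dirac//; last exact: (age_space_measurable hG).
by rewrite diracE mem_set ?mul1e ?mulr1//; exact: (age_space0 hG).
Qed.

Lemma arrivals_total nu l : (2 <= l)%N ->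
  arrivals G lam d nu l (fun=> 1) = lam * (mass G (nu l.-1) ^+ d - mass G (nu l) ^+ d).
Proof.
case: l => [//|[//|l]] _.
by rewrite /arrivals/= -mulrA -Pd_mulB.
Qed.

Lemma hazard_rate_ge0 (mu : {measure set (measurableTypeR R) -> \bar R}) :
  (0 <= hazard_rate G g mu)%E.
Proof.
apply: integral_ge0 => x ax; rewrite lee_fin /hazard divr_ge0 ?(tail_ge0 hG)//.
by apply: (density_ge0 hG); case: ax.
Qed.

Lemma lebesgue_itv0 t : 0 <= t -> leb (`[0, t]%classic : set R) = t%:E.
Proof.
move=> t0; apply: (etrans (lebesgue_measure_itv _)); rewrite /= lte_fin oppr0 adde0.
by move: t0; rewrite le_eqVlt => /predU1P[<-|->//]; rewrite ltxx.
Qed.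

Lemma departures_extE nu l t : 0 <= t ->
  departures_ext G g (fun=> nu) l t = (hazard_rate G g (nu l) * t%:E)%E.
Proof.
move=> t0; rewrite /departures_ext integral_cst//; congr (_ * _)%E.
exact: lebesgue_itv0.
Qed.

(** This covers an infinite hazard rate too: both sides are then 0, the value of [fine] at
    infinity. *)
Lemma departuresE nu l t : 0 <= t ->
  departures G g (fun=> nu) l t = fine (hazard_rate G g (nu l)) * t.
Proof.
move=> t0; rewrite /departures departures_extE//.
have := hazard_rate_ge0 (nu l); case: (hazard_rate G g (nu l)) => [h| |]//= _.
move: t0; rewrite le_eqVlt => /predU1P[<-|t0]; first by rewrite mule0 mulr0.
by rewrite gt0_mulye ?lte_fin// mul0r.
Qed.

Lemma Rintegral_cst_itv t (k : R) : 0 <= t -> \int[leb]_(s in `[0, t]) k = k * t.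
Proof.
move=> t0; rewrite Rintegral_cst//; congr (_ * _).
exact: (congr1 fine (lebesgue_itv0 t0)).
Qed.

Let cfT f : continuous f -> continuous (fun x => f x * T x).
Proof. by move=> cf x; apply: cvgM; [exact: cf|exact: (tail_continuous hG)]. Qed.

Let itv_measurable (t : R) (k : R -> R) : continuous k ->
  measurable_fun (`[0, t]%classic : set (measurableTypeR R)) k.
Proof. by move=> ck; apply: measurable_funTS; exact: continuous_measurable_fun. Qed.

Let stieltjes_part (D : cumulative R R) c f t : 0 <= c ->
  (forall s, D s = if 0 <= s then c * s else 0) -> continuous f ->
  \int[lebesgue_stieltjes_measure D]_(s in `[0, t]) (f (t - s) * T (t - s)) =
  c * \int[leb]_(u in `[0, t]) (f u * T u).
Proof.
move=> c0 DE cf.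
have ck : continuous (fun s : R => f (t - s) * T (t - s)).
  move=> s; apply: (@continuous_comp _ _ _ (fun s : R => t - s) (fun u => f u * T u)).
    by apply: cvgB; [exact: cvg_cst|exact: cvg_id].
  exact: cfT.
rewrite (Rintegral_stieltjes_linear c0 DE); last exact: integrable_continuous_itv.
rewrite (Rintegral_reflect (k := fun u => f u * T u))//.
by apply: itv_measurable; exact: cfT.
Qed.

(** At level 1 the services started after a departure and those started by an external arrival both
    begin at age 0, so they merge into a single boundary rate. *)
Lemma hydro_first (D : cumulative R R) c nu f t : 0 <= c ->
  (forall s, D s = if 0 <= s then c * s else 0) -> continuous f ->
  \int[lebesgue_stieltjes_measure D]_(s in `[0, t]) (f (t - s) * T (t - s)) +
  \int[leb]_(s in `[0, t]) arrivals G lam d nu 1 (aged G f (t - s)) =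
  (c + lam * (1 - mass G (nu 1%N) ^+ d)) * \int[leb]_(u in `[0, t]) (f u * T u).
Proof.
move=> c0 DE cf; rewrite (stieltjes_part _ c0 DE cf) mulrDl; congr (_ + _).
set b := lam * _.
have cb : continuous (fun u : R => b * (f u * T u)).
  by move=> u; apply: cvgM; [exact: cvg_cst|exact: cfT].
rewrite -RintegralZl//; last exact/integrable_continuous_itv/cfT.
rewrite -(Rintegral_reflect (k := fun u => b * (f u * T u))); last exact: itv_measurable.
apply: eq_Rintegral => s; rewrite inE/= in_itv/= => /andP[_ st].
by rewrite arrivals_first_aged// subr_ge0.
Qed.

(** From level 2 on, an arrival finds a job in service and keeps its age, so arrivals contribute a
    difference of pairings instead of a boundary term. *)
Lemma hydro_next (D : cumulative R R) c nu l f K t : (2 <= l)%N -> 0 <= c ->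
  (forall s, D s = if 0 <= s then c * s else 0) -> continuous f ->
  (forall x, `|f x| <= K) ->
  \int[lebesgue_stieltjes_measure D]_(s in `[0, t]) (f (t - s) * T (t - s)) +
  \int[leb]_(s in `[0, t]) arrivals G lam d nu l (aged G f (t - s)) =
  c * \int[leb]_(u in `[0, t]) (f u * T u) +
  \int[leb]_(u in `[0, t]) (lam * Pd d (mass G (nu l.-1)) (mass G (nu l)) *
     (pairing G (aged G f u) (nu l.-1) - pairing G (aged G f u) (nu l))).
Proof.
case: l => [|[|l]] l2 c0 DE cf fK; [by exfalso|by exfalso|].
apply: (etrans (congr1 (+%R^~ _) (stieltjes_part t c0 DE cf))).
apply: (congr1 (+%R (c * _))).
rewrite /arrivals/=; set a := lam * _.
have ck : continuous (fun u : R => a * (pairing G (aged G f (Num.max u 0)) (nu l.+1) -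
    pairing G (aged G f (Num.max u 0)) (nu l.+2))).
  move=> u; apply: cvgM; first exact: cvg_cst.
  by apply: cvgB; exact: (@pairing_aged_continuous _ G g hG _ f K).
transitivity (\int[leb]_(u in `[0, t]) (a * (pairing G (aged G f (Num.max u 0)) (nu l.+1) -
    pairing G (aged G f (Num.max u 0)) (nu l.+2)))); last first.
  by apply: eq_Rintegral => u; rewrite inE/= in_itv/= => /andP[u0 _]; rewrite (max_idPl u0).
rewrite -(Rintegral_reflect (k := fun u => a * _)); last exact: itv_measurable.
apply: eq_Rintegral => s; rewrite inE/= in_itv/= => /andP[_ st].
by rewrite (max_idPl _) ?subr_ge0.
Qed.

Lemma arrivals_eq nu l f f' : (forall x, 0 <= x -> f x = f' x) ->
  arrivals G lam d nu l f = arrivals G lam d nu l f'.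
Proof.
move=> ff'; rewrite /arrivals; case: ifP => _; last first.
  by congr (_ * (_ - _)); exact: eq_pairing.
congr (_ * _); apply: eq_Rintegral => x; rewrite inE => /age_ge0.
exact: ff'.
Qed.

End Hydro.

(** * The functions of age *)

Section AgeFunctions.
Context {R : realType}.
Notation leb := (@lebesgue_measure R).
Variables (c a : nat -> R).

(* The solutions r_l for given initial values c_l and rates a_l, extended to
   negative ages by their value at 0 so as to be continuous on the line. *)
Fixpoint age_fun (l : nat) : R -> R :=
  if l is l'.+1 then
    if l' is 0 then cst (c 1%N)
    else fun x => volterra (a l) (c l) (age_fun l') (Num.max x 0)
  else cst (c 1%N).

Lemma age_fun_continuous l : continuous (age_fun l).
Proof.
elim: l => [|[|l] ih]; [exact: cst_continuous|exact: cst_continuous|].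
exact: volterra_continuous.
Qed.

Lemma age_funS l x : 0 <= x ->
  age_fun l.+2 x = volterra (a l.+2) (c l.+2) (age_fun l.+1) x.
Proof. by move=> x0 /=; rewrite (max_idPl x0). Qed.

Lemma age_fun0 l : age_fun l.+1 0 = c l.+1.
Proof.
case: l => [//|l]; rewrite age_funS// volterra0//.
exact: age_fun_continuous.
Qed.

Lemma age_fun_int l x : 0 <= x -> age_fun l.+2 x = c l.+2 +
  \int[leb]_(u in `[0, x]) (a l.+2 * (age_fun l.+1 u - age_fun l.+2 u)).
Proof.
move=> x0; have := volterra_int (a l.+2) (c l.+2) (@age_fun_continuous l.+1) (lexx 0) x0.
rewrite volterra0; last exact: age_fun_continuous.
by rewrite -age_funS// => /eqP; rewrite subr_eq addrC => /eqP.
Qed.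

Hypotheses (a0 : forall l, 0 <= a l.+2) (c0 : forall l, 0 <= c l.+1)
  (ndc : forall l, c l.+2 <= c l.+1).

Lemma age_fun_nondecreasing l : {in `[0, +oo[ &, nondecreasing (age_fun l.+1)}.
Proof.
elim: l => [//|l ih] x y x0 y0 xy; rewrite !age_funS//.
- apply: volterra_nondecreasing => //; first exact: age_fun_continuous.
  by rewrite age_fun0.
- by move: y0; rewrite in_itv/= andbT.
- by move: x0; rewrite in_itv/= andbT.
Qed.

Lemma age_funS_le l x : 0 <= x -> age_fun l.+2 x <= age_fun l.+1 x.
Proof.
move=> x0; rewrite age_funS//; apply: volterra_le_source => //.
- exact: age_fun_continuous.
- exact: age_fun_nondecreasing.
- by rewrite age_fun0.
Qed.

Lemma age_fun_le l x : 0 <= x -> age_fun l.+1 x <= c 1%N.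
Proof.
by move=> x0; elim: l => [|l ih]//; apply: le_trans ih; exact: age_funS_le.
Qed.

Lemma age_fun_ge l x : 0 <= x -> c l.+1 <= age_fun l.+1 x.
Proof.
by move=> x0; rewrite -age_fun0; apply: age_fun_nondecreasing => //; rewrite in_itv/= ?lexx ?andbT.
Qed.

Lemma age_fun_ge0 l x : 0 <= x -> 0 <= age_fun l.+1 x.
Proof. by move=> x0; exact: le_trans (c0 l) (age_fun_ge l x0). Qed.

End AgeFunctions.
Arguments age_fun {R} c a l x : simpl never.

(** * The system satisfied by the functions of age *)

Section AgeSystem.
Context {R : realType}.
Notation leb := (@lebesgue_measure R).
Notation Rp := (`[0%R, +oo[%classic : set (measurableTypeR R)).
Variables (G g : R -> R) (lam : R) (d : nat).
Hypothesis hG : service_distribution G g.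
Hypothesis lam0 : 0 < lam.
Notation T := (tail G).
Notation age := (age_space G).
Implicit Types (s : nat -> R) (l : nat) (x : R).

Definition age_init s l := if l is _.+2 then lam * s l ^+ d else lam.
Definition age_rate s l := lam * Pd d (s l.-1) (s l).
Notation ages s := (age_fun (age_init s) (age_rate s)).

(** Once the queue lengths are fixed the system is an explicit recursion on levels, and [[0, x]]
    stays inside the age space, which is an interval starting at 0. *)
Lemma age_system_unique (r : nat -> R -> R) s : age_system G lam d r ->
  (forall l, (1 <= l)%N -> queue_length G r l = s l) ->
  forall l x, (1 <= l)%N -> age x -> r l x = ages s l x.
Proof.
move=> [_ [r1 rS]] qs; case=> // l x _; elim: l x => [|l ih] x ax.
  by rewrite r1.
have x0 := age_ge0 ax.
rewrite rS// age_funS// /volterra /age_init /age_rate/= !qs//.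
congr (_ + _ * _); apply: eq_Rintegral => u; rewrite inE/= in_itv/= => /andP[u0 ux].
by rewrite ih//; exact: (age_space_le hG u0 ux).
Qed.

Lemma cvg_within_age_eq (f1 f2 : R -> R) x (y0 : R) :
  (forall y, age y -> y != x -> f1 y = f2 y) ->
  f1 @ within age x^' --> y0 -> f2 @ within age x^' --> y0.
Proof.
move=> f12; apply: cvg_trans; apply: near_eq_cvg.
change (nbhs x [set y | y != x -> age y -> f1 y = f2 y]).
by apply: filterS (@filterT _ (nbhs x) _) => y _ yx ay; exact: f12.
Qed.

Lemma ages_derivable (c a : nat -> R) l x : age x ->
  (fun y => (age_fun c a l.+2 y - age_fun c a l.+2 x) / (y - x)) @ within age x^' -->
  a l.+2 * (age_fun c a l.+1 x - age_fun c a l.+2 x).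
Proof.
move=> ax; have x0 := age_ge0 ax.
have [W [WE dW]] := volterra_ode (a l.+2) (c l.+2) (@age_fun_continuous _ c a l.+1).
have agE y : 0 <= y -> age_fun c a l.+2 y = W y by move=> y0; rewrite age_funS// WE.
(* A slope function continuous at [x] survives the restriction to the age space, so the endpoint 0
   needs no separate argument. *)
have /dW/is_derive1_caratheodory : -1 < x by rewrite (lt_le_trans _ x0)// ltrN10.
move=> [h [hE ch hx]].
rewrite (agE x x0) -hx.
have H1 : h y @[y --> within age x^'] --> h x.
  apply: cvg_trans ch; apply: cvg_app => P HP.
  change (nbhs x [set y | y != x -> age y -> P y]).
  by apply: filterS HP => y Py _ _; exact: Py.
apply: cvg_within_age_eq H1 => y ay yx; rewrite agE; last exact: age_ge0 ay.
by rewrite hE mulfK// subr_eq0.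
Qed.

(** The part of the definition of a state that concerns masses, and what makes the initial values
    [age_init] nonincreasing. The value at index 0 is left free. *)
Definition admissible s := [/\ s 1%N <= 1, forall l, 0 <= s l.+1 & forall l, s l.+2 <= s l.+1].

Lemma admissible_conditions s : admissible s ->
  [/\ forall l, 0 <= age_rate s l.+2, forall l, 0 <= age_init s l.+1 &
      forall l, age_init s l.+2 <= age_init s l.+1].
Proof.
move=> [s1 s0 sd]; split.
- by move=> l; apply: mulr_ge0; [exact: ltW|exact: Pd_ge0 (s0 l) (s0 l.+1)].
- case=> [|l]; rewrite /age_init; first exact: ltW.
  exact: mulr_ge0 (ltW lam0) (exprn_ge0 _ (s0 _)).
- case=> [|l]; rewrite /age_init.
    apply: ler_piMr (ltW lam0) _; apply: exprn_ile1 => //.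
    exact: le_trans (sd 0%N) s1.
  by rewrite ler_pM2l// lerXn2r// ?nnegrE.
Qed.

Lemma ages_bounds s l x : admissible s -> 0 <= x -> 0 <= ages s l.+1 x <= lam.
Proof.
move=> /admissible_conditions[a0 c0 ndc] x0.
by rewrite age_fun_ge0//= (age_fun_le a0 ndc).
Qed.

Lemma ages_tail_integrable s l : admissible s ->
  leb.-integrable Rp (EFin \o (fun x => ages s l.+1 x * T x)).
Proof.
move=> sa; apply: (weighted_tail_integrable hG); first exact: age_fun_continuous.
by move=> x x0; exact: ages_bounds.
Qed.

Lemma age_system_of_ages s : admissible s ->
  (forall l, s l.+1 = \int[leb]_(x in age) (ages s l.+1 x * T x)) ->
  age_system G lam d (fun l => ages s l \_ age) /\
  forall l, (1 <= l)%N -> queue_length G (fun l => ages s l \_ age) l = s l.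
Proof.
move=> sa sE; set r := fun l => _.
have rE l x : age x -> r l x = ages s l x by move=> ax; rewrite /r patchE mem_set.
have qE l : (1 <= l)%N -> queue_length G r l = s l.
  case: l => // l _; rewrite sE; apply: eq_Rintegral => x; rewrite inE => ax.
  by rewrite rE.
have mage := age_space_measurable hG.
have ageR : age `<=` Rp by move=> x ax /=; rewrite in_itv/= (age_ge0 ax).
split=> //; split; last split.
- case=> // l _; split.
  + apply: measurable_funTS; apply/(measurable_restrictT _ mage).
    by apply: measurable_funTS; apply: continuous_measurable_fun; exact: age_fun_continuous.
  + case: l => [|l].
      exists (cst 0); first by apply: continuous_subspaceT; exact: cst_continuous.
      move=> x ax; apply: (@cvg_within_age_eq (cst 0)); last exact: cvg_cst.
      by move=> y ay _; rewrite !rE//= /age_fun/= subrr mul0r.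
    exists (fun x => age_rate s l.+2 * (ages s l.+1 x - ages s l.+2 x)).
      apply: continuous_subspaceT => x; apply: cvgM; first exact: cvg_cst.
      by apply: cvgB; exact: age_fun_continuous.
    move=> x ax; apply: (@cvg_within_age_eq _ _ x _ _ (@ages_derivable (age_init s) (age_rate s) l x ax)).
    by move=> y ay _; rewrite !rE.
  + by move=> x x0 nax; rewrite /r patchE memNset.
  + apply: eq_integrable (integrableS _ mage ageR (ages_tail_integrable l sa)) => //.
    by move=> x /set_mem ax; rewrite /= rE.
- by move=> x ax; rewrite rE.
- case=> [//|[//|l]] x _ ax; have x0 := age_ge0 ax.
  rewrite rE// age_funS// !qE//=; congr (_ + _ * _).
  apply: eq_Rintegral => u; rewrite inE/= in_itv/= => /andP[u0 ux].
  by rewrite rE//; exact: (age_space_le hG u0 ux).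
Qed.

End AgeSystem.

(** * From physical invariant states to solutions *)

Section PhysicalStates.
Context {R : realType}.
Notation leb := (@lebesgue_measure R).
Notation Rp := (`[0%R, +oo[%classic : set (measurableTypeR R)).
Variables (G g : R -> R) (lam : R) (d : nat).
Hypothesis hG : service_distribution G g.
Hypotheses (lam0 : 0 < lam) (hd : (1 <= d)%N).
Notation T := (tail G).
Notation age := (age_space G).
Notation I := (aged_pairing G).
Notation ages s := (age_fun (age_init lam d s) (age_rate lam d s)).
Implicit Types (nu : @mseq R) (l : nat).

Lemma mass_ge0 (mu : {measure set (measurableTypeR R) -> \bar R}) : 0 <= mass G mu.
Proof. exact: Rintegral_ge0. Qed.

Lemma massE (mu : {measure set (measurableTypeR R) -> \bar R}) : mass G mu = fine (mu age).
Proof. by rewrite /mass /pairing Rintegral_cst ?mul1r//; exact: (age_space_measurable hG). Qed.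

Lemma mass_le1 (mu : subprobability (measurableTypeR R) R) : mass G mu <= 1.
Proof.
have mage := age_space_measurable hG.
rewrite massE -lee_fin fineK ?fin_num_measure//.
apply: (@le_trans _ _ (mu setT)); last exact: sprobability_setT.
by apply: le_measure; rewrite ?inE.
Qed.

Lemma mass_nonincreasing nu l : in_S G nu -> mass G (nu l.+2) <= mass G (nu l.+1).
Proof.
move=> [_]; apply => //; apply: (@Cb_continuous _ _ _ 1).
  exact: cst_continuous.
by move=> x; rewrite normr1.
Qed.

(** The tail has total mass 1, so a density above [c T] has mass at least [c]. *)
Lemma aged_pairing_one_ge (rho : R -> R) c M : continuous rho -> 0 <= c ->
  (forall x, 0 <= x -> c <= rho x <= M) -> c <= I rho (cst 1) 0.
Proof.
move=> cr c0 rM.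
have r0 x : 0 <= x -> 0 <= rho x <= M.
  by move=> x0; have /andP[cx ->] := rM x x0; rewrite (le_trans c0).
have ic := integrableZl (measurable_itv _ : measurable Rp) c (tail_integrable hG).
have {1}-> : c = \int[leb]_(x in Rp) (c * T x).
  rewrite RintegralZl//; last exact: (tail_integrable hG).
  by rewrite /Rintegral (tail_total hG) mulr1.
apply: le_Rintegral => //.
  apply: (@aged_integrable _ G g hG rho (cst 1) 0 1 M) => //.
  - exact: cst_continuous.
  - by move=> x; rewrite normr1.
move=> x /=; rewrite in_itv/= andbT => x0; rewrite addr0 mul1r mulrC.
by rewrite ler_wpM2l ?(tail_ge0 hG)//; case/andP: (rM x x0).
Qed.

Lemma Rintegral_mul0 t (k : R -> R) : \int[leb]_(u in `[0, t]) (0 * k u) = 0.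
Proof. by under eq_Rintegral do rewrite mul0r; rewrite Rintegral_cst// mul0r. Qed.

(** The tail in the denominator of the hazard cancels the one in the density of [mu]. *)
Lemma hazard_rate_density (mu : subprobability (measurableTypeR R) R) (rho : R -> R) :
  continuous rho -> mu (~` age) = 0%E ->
  (forall A : set (measurableTypeR R), measurable A -> A `<=` age ->
     mu A = (\int[leb]_(x in A) (rho x * T x)%:E)%E) ->
  (hazard_rate G g mu = \int[leb]_(x in age) (g x * rho x)%:E)%E.
Proof.
move=> crho mu0 muE.
have mage := age_space_measurable hG.
have ageR : age `<=` Rp by move=> x ax /=; rewrite in_itv/= (age_ge0 ax).
have mw : measurable_fun age (fun x => rho x * T x).
  apply: measurable_funTS; apply: continuous_measurable_fun => x.
  by apply: cvgM; [exact: crho|exact: (tail_continuous hG)].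
have H := @ge0_integral_density R mu age (fun x => rho x * T x) mage mw mu0
  muE (fun x => (hazard G g x)%:E).
apply: (etrans (H _ _)).
- apply/measurable_EFinP; apply: measurable_funM; first exact: measurable_funS (density_measurable hG).
  apply: measurable_funTS; exact: measurableT_comp measurable_invr (tail_measurable hG).
- move=> x ax; rewrite lee_fin divr_ge0 ?(tail_ge0 hG)//.
  by rewrite (density_ge0 hG)// (age_ge0 ax).
- apply: eq_integral => x; rewrite inE => ax; rewrite -EFinM /hazard; congr (_%:E).
  by have Tx := age_tail_gt0 hG ax; field; rewrite gt_eqF.
Qed.

(** * Departure rates and densities of an invariant state *)

Section Invariant.
Variables (nu : @mseq R) (s h : nat -> R).
Hypothesis hnu : invariant_state G g lam d nu.
Hypothesis sE : forall l, s l = mass G (nu l).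
Hypothesis hE : forall l, h l = fine (hazard_rate G g (nu l)).

Lemma hazard_balance l : h l.+2 = h 1%N - lam * (1 - s l.+1 ^+ d).
Proof.
have [_ [_ _ _ hm _]] := hnu.
have st (k : nat) : (1 <= k)%N -> h k.+1 = h k - arrivals G lam d nu k (fun=> 1).
  move=> k1; have := hm 1 k ler01 k1.
  rewrite subrr !(departuresE hG _ _ ler01) !mulr1 (Rintegral_cst_itv _ ler01) mulr1 -!hE.
  have alg (x y z : R) : 0 = x + y - z -> x = z - y by lra.
  exact: alg.
elim: l => [|l ih]; first by rewrite st// (arrivals_first_total lam d hG) -sE.
by rewrite st// ih (arrivals_total G lam)//= -!sE; ring.
Qed.

Lemma hazard_fine_ge0 l : 0 <= h l.
Proof. by rewrite hE; exact/fine_ge0/(hazard_rate_ge0 hG). Qed.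

Let mass0 l : 0 <= s l. Proof. by rewrite sE mass_ge0. Qed.
Let massd l : s l.+2 <= s l.+1. Proof. by rewrite !sE mass_nonincreasing//; case: hnu. Qed.
Let mass1 l : s l <= 1. Proof. by rewrite sE mass_le1. Qed.

(** At level [l >= 2] only the departures [h (l + 1)] enter at age 0. At level 1 external arrivals
    are added to [h 2], and [hazard_balance] identifies the sum with [h 1], not yet known to be
    [lam]. *)
Let c0 (l : nat) := if l is _.+2 then h l.+1 else h 1%N.
Let a0 := age_rate lam d s.

Let c0_ge0 l : 0 <= c0 l.+1.
Proof. by case: l => [|l]; exact: hazard_fine_ge0. Qed.

Let c0_le l : c0 l.+2 <= c0 l.+1.
Proof.
case: l => [|l]; rewrite /c0 !hazard_balance ?lerD2l.
  by rewrite gerDl oppr_le0 (mulr_ge0 (ltW lam0))// subr_ge0 exprn_ile1.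
by rewrite lerN2 (ler_wpM2l (ltW lam0))// lerB// lerXn2r// nnegrE.
Qed.

Let a0_ge0 l : 0 <= a0 l.+2.
Proof. by apply: mulr_ge0; [exact: ltW|exact: Pd_ge0]. Qed.

Let rho l := age_fun c0 a0 l.

Let rho_ge0 l x : 0 <= x -> 0 <= rho l.+1 x <= h 1%N.
Proof.
by move=> x0; rewrite (age_fun_ge0 a0_ge0 c0_ge0 c0_le)//= (age_fun_le a0_ge0 c0_le l x0).
Qed.

Let rho_continuous l : continuous (rho l). Proof. exact: age_fun_continuous. Qed.

Let nu_out l : nu l.+1 (~` age) = 0%E.
Proof. by case: hnu => -[H _] _; exact: H. Qed.

Let evolution l (f : R -> R) K t : (1 <= l)%N -> continuous f -> (forall x, `|f x| <= K) -> 0 <= t ->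
  exists2 D : cumulative R R, (forall u, D u = if 0 <= u then h l.+1 * u else 0) &
  pairing G f (nu l) = pairing G (aged G f t) (nu l)
    + (\int[lebesgue_stieltjes_measure D]_(u in `[0, t]) (f (t - u) * T (t - u))
    + \int[leb]_(u in `[0, t]) arrivals G lam d nu l (aged G f (t - u))).
Proof.
move=> l1 cf fK t0; have [_ [_ _ _ _ /(_ l l1)[D DE ev]]] := hnu.
exists D; first by move=> u; rewrite DE hE; case: ifPn => // u0; rewrite (departuresE hG).
by rewrite addrA; apply: ev => //; exact: Cb_continuous fK.
Qed.

Let state_rho l (A : set (measurableTypeR R)) : measurable A -> A `<=` age ->
  nu l.+1 A = (\int[leb]_(x in A) (rho l.+1 x * T x)%:E)%E.
Proof.
elim: l A => [|l ih].
  apply: (state_of_pairings hG (@rho_continuous 1) (rho_ge0 0) (nu_out 0)) => f K cf fK.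
  have cc : continuous (cst (h 1%N) : R -> R) by exact: cst_continuous.
  (* Level 1 is the degenerate case of rate 0, with the constant [h 1] both as source and as
     solution. *)
  apply: (pairing_transport_unique hG cc cc (hazard_fine_ge0 1) (lexx 0) _ _ _ cf fK (M := h 1%N)).
  - by move=> x x0; rewrite Rintegral_mul0 addr0.
  - by move=> x _; rewrite /= lexx hazard_fine_ge0.
  - by [].
  - move=> t t0; have [D DE ->] := evolution (ltnSn 0) cf fK t0.
    rewrite (hydro_first lam d hG nu t (hazard_fine_ge0 2) DE cf).
    by rewrite -sE hazard_balance subrK Rintegral_mul0 addr0.
apply: (state_of_pairings hG (@rho_continuous l.+2) (rho_ge0 l.+1) (nu_out l.+1)) => f K cf fK.
apply: (pairing_transport_unique hG (@rho_continuous l.+1) (@rho_continuous l.+2)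
  (c0_ge0 l.+1) (a0_ge0 l) _ _ _ cf fK (M := h 1%N)).
- by move=> x x0; rewrite /rho age_fun_int.
- move=> x x0; have /andP[-> _] := rho_ge0 l.+1 x0.
  exact: (age_funS_le a0_ge0 c0_le l x0).
- by move=> x x0; case/andP: (rho_ge0 l x0).
- move=> t t0; have [D DE ->] := evolution (ltn0Sn l.+1) cf fK t0.
  have := hydro_next lam d hG nu t (isT : (1 < l.+2)%N) (hazard_fine_ge0 l.+3) DE cf fK.
  move=> ->; rewrite -!sE addrA; congr (_ + _).
  apply: eq_Rintegral => u; rewrite inE/= in_itv/= => /andP[u0 _].
  rewrite (pairing_aged_density hG (@rho_continuous l.+1) _ (nu_out l) ih cf u0)//.
  by move=> x x0; case/andP: (rho_ge0 l x0).
Qed.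

(** The density of [nu (l + 2)] is the tail, of total mass 1, times a function that is nondecreasing
    from its value [h (l + 3)] at age 0. *)
Let hazard_le_mass l : h l.+3 <= s l.+2.
Proof.
have cc : continuous (cst 1 : R -> R) by exact: cst_continuous.
rewrite sE /mass -(pairing_aged0 hG).
rewrite (pairing_aged_density hG (@rho_continuous l.+2) _ (nu_out l.+1) (@state_rho l.+1) cc (lexx 0)).
  apply: (aged_pairing_one_ge (@rho_continuous l.+2) (hazard_fine_ge0 _) (M := h 1%N)).
  move=> x x0; have /andP[_ ->] := rho_ge0 l.+1 x0; rewrite andbT.
  exact: (age_fun_ge a0_ge0 c0_le l.+1 x0).
by move=> x x0; case/andP: (rho_ge0 l.+1 x0).
Qed.

Hypothesis hphys : s @ \oo --> (0 : R).

(* The hazard rates h (l + 2) = h 1 - lam + lam (s (l + 1))^d lie between 0 and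
   s (l + 1), hence vanish in the limit. *)
Lemma hazard_first : h 1%N = lam.
Proof.
have key l : `|h 1%N - lam| <= (1 + lam) * s l.+2.
  have H := hazard_balance l.+1; have h0 := hazard_fine_ge0 l.+3.
  have hs := hazard_le_mass l.
  have sd0 : 0 <= lam * s l.+2 ^+ d by rewrite (mulr_ge0 (ltW lam0))// exprn_ge0.
  have sd1 : lam * s l.+2 ^+ d <= lam * s l.+2.
    apply: (ler_wpM2l (ltW lam0)); rewrite -[leRHS]expr1.
    by case: (d) hd => // n _; rewrite exprS expr1 ler_piMr// exprn_ile1.
  rewrite ler_norml mulrDl mul1r; have := mass0 l.+2; lra.
apply/eqP; rewrite -subr_eq0 -normr_le0.
have cv : (fun l => (1 + lam) * s l) @ \oo --> (1 + lam) * 0.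
  by apply: cvgM; [exact: cvg_cst|exact: hphys].
rewrite -[leRHS](mulr0 (1 + lam)) -(cvg_lim _ cv)//.
apply: limr_ge; first by apply/cvg_ex; eexists; exact: cv.
near=> l; have lE : l = (l - 2).+2.
  by rewrite -addn2 subnK//; near: l; exact: nbhs_infty_ge.
by rewrite lE; exact: key.
Unshelve. all: by end_near. Qed.

Lemma hazardE l : h l.+2 = lam * s l.+1 ^+ d.
Proof. by rewrite hazard_balance hazard_first; ring. Qed.

Lemma invariant_admissible : admissible s.
Proof. by split. Qed.

Lemma invariant_density l (A : set (measurableTypeR R)) : measurable A -> A `<=` age ->
  nu l.+1 A = (\int[leb]_(x in A) (ages s l.+1 x * T x)%:E)%E.
Proof.
move=> mA Aage; have cE : age_init lam d s = c0.
  by apply/funext => -[|[|k]]; rewrite /c0 ?hazard_first// hazardE.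
by have := @state_rho l A mA Aage; rewrite /rho -cE.
Qed.

Lemma invariant_mass l : s l.+1 = \int[leb]_(x in age) (ages s l.+1 x * T x).
Proof.
rewrite sE massE.
exact: (congr1 fine (invariant_density l (age_space_measurable hG) (@subset_refl _ _))).
Qed.

Lemma hazard_integral l :
  (hazard_rate G g (nu l.+1) = \int[leb]_(x in age) (g x * ages s l.+1 x)%:E)%E.
Proof.
exact: (@hazard_rate_density (nu l.+1) (ages s l.+1) (@age_fun_continuous _ _ _ l.+1)
  (nu_out l) (@invariant_density l)).
Qed.

(** [hazardE] only knows the rate through [fine]; the bound [ages <= lam] makes the integral finite,
    so nothing is lost. *)
Lemma departure_balance l :
  ((lam * s l.+1 ^+ d)%:E = \int[leb]_(x in age) (g x * ages s l.+2 x)%:E)%E.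
Proof.
rewrite -hazardE hE hazard_integral fineK//.
have mage := age_space_measurable hG.
have ageR : age `<=` Rp by move=> x ax /=; rewrite in_itv/= (age_ge0 ax).
apply: integrable_fin_num => //.
have ig : leb.-integrable age (EFin \o (fun x => lam * g x)).
  rewrite (_ : EFin \o _ = (fun x => lam%:E * (g x)%:E)%E)//.
  by apply: integrableZl => //; exact: integrableS (density_integrable hG).
apply: (le_integrable mage _ _ ig).
  apply/measurable_EFinP; apply: measurable_funM; first exact: measurable_funS (density_measurable hG).
  by apply: measurable_funTS; apply: continuous_measurable_fun; exact: age_fun_continuous.
move=> x ax; have gx := density_ge0 hG (age_ge0 ax).
have /andP[r0 r1] := ages_bounds d lam0 l.+1 invariant_admissible (age_ge0 ax).
by rewrite /= lee_fin !ger0_norm ?mulr_ge0 ?(ltW lam0)// mulrC ler_wpM2r.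
Qed.

End Invariant.
End PhysicalStates.

(** * From solutions to physical invariant states *)

Section Flow.
Context {R : realType}.
Notation leb := (@lebesgue_measure R).
Notation Rp := (`[0%R, +oo[%classic : set (measurableTypeR R)).
Variables (G g : R -> R).
Hypothesis hG : service_distribution G g.
Notation T := (tail G).
Notation age := (age_space G).
Implicit Types (q k r rho : R -> R) (a c M : R).

Lemma tail_flow q : continuous q -> (forall x, 0 <= q x) ->
  (\int[leb]_(x in Rp) (g x * \int[leb]_(u in `[0, x]) q u)%:E =
   \int[leb]_(u in Rp) (q u * T u)%:E)%E.
Proof.
move=> cq q0; pose k := g \_ Rp.
have kE x : 0 <= x -> k x = g x.
  by move=> x0; rewrite /k patchE mem_set//= in_itv/= x0.
have mk : measurable_fun [set: measurableTypeR R] (k : measurableTypeR R -> R).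
  have mRp : measurable Rp by [].
  by apply/(measurable_restrictT _ mRp); exact: (density_measurable hG).
have k0 x : 0 <= k x.
  rewrite /k patchE; case: ifPn => [/set_mem|//]; rewrite /= in_itv/= andbT.
  exact: (density_ge0 hG).
have mq : measurable_fun [set: measurableTypeR R] (q : measurableTypeR R -> R).
  exact: continuous_measurable_fun.
apply: (etrans _ (etrans (tonelli_tail mk mq k0 q0) _)).
- apply: eq_integral => x; rewrite inE/= in_itv/= andbT => x0.
  rewrite kE// EFinM; congr (_ * _)%E; rewrite /Rintegral fineK//.
  exact: integrable_fin_num (integrable_continuous_itv 0 x cq).
- apply: eq_integral => u; rewrite inE/= in_itv/= andbT => u0.
  rewrite EFinM; congr (_ * _)%E; rewrite (tail_integral hG)//.
  apply: eq_integral => x; rewrite inE/= in_itv/= andbT => ux.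
  by rewrite kE// (le_trans u0).
Qed.

Lemma weighted_density_integrable q M : continuous q -> (forall x, 0 <= x -> 0 <= q x <= M) ->
  leb.-integrable Rp (EFin \o (fun x => g x * q x)).
Proof.
move=> cq qM; apply: (le_integrable _ _ _ (integrableZl _ M (density_integrable hG))) => //.
  apply/measurable_EFinP; apply: measurable_funM; first exact: (density_measurable hG).
  by apply: measurable_funTS; exact: continuous_measurable_fun.
move=> x /=; rewrite in_itv/= andbT => x0; have /andP[r0 r1] := qM x x0.
have gx := density_ge0 hG x0; have M0 := le_trans r0 r1.
by rewrite lee_fin !ger0_norm ?mulr_ge0// mulrC ler_wpM2r.
Qed.

(** The equation for [rho] is integrated against [g]: the constant contributes [c], and Tonelli's
    theorem turns the primitive into tail integrals. Nothing compares [r] with [rho] here, so the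
    two parts of the inflow, each nonnegative, are exchanged separately. *)
Lemma flow_balance a c M r rho : continuous r -> continuous rho -> 0 <= a -> 0 <= c ->
  (forall x, 0 <= x -> rho x = c + \int[leb]_(u in `[0, x]) (a * (r u - rho u))) ->
  (forall x, 0 <= x -> 0 <= r x <= M) -> (forall x, 0 <= x -> 0 <= rho x <= M) ->
  \int[leb]_(x in Rp) (g x * rho x) =
  c + a * (\int[leb]_(x in Rp) (r x * T x) - \int[leb]_(x in Rp) (rho x * T x)).
Proof.
move=> cr crho a0 c0 rhoE rM rhoM.
pose pos (q : R -> R) (u : R) := a * q (Num.max u 0).
have mx0 (u : R) : 0 <= Num.max u 0 by rewrite le_max lexx orbT.
have cpos q : continuous q -> continuous (pos q).
  move=> cq u; apply: cvgM; first exact: cvg_cst.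
  apply: (@continuous_comp _ _ _ (fun u : R => Num.max u 0) q); last exact: cq.
  by apply: (@continuous_max0 _ id) => x _; exact: cvg_id.
have posE q u : 0 <= u -> pos q u = a * q u by move=> u0; rewrite /pos (max_idPl u0).
have posM q : (forall x, 0 <= x -> 0 <= q x <= M) -> forall x, 0 <= x -> 0 <= pos q x <= a * M.
  by move=> qM x x0; rewrite posE//; have /andP[q0 q1] := qM x x0; rewrite mulr_ge0//= ler_wpM2l.
have key q : continuous q -> (forall x, 0 <= x -> 0 <= q x <= M) ->
    \int[leb]_(x in Rp) (g x * \int[leb]_(u in `[0, x]) pos q u) =
      a * \int[leb]_(x in Rp) (q x * T x) /\
    leb.-integrable Rp (EFin \o (fun x => g x * \int[leb]_(u in `[0, x]) pos q u)).
  move=> cq qM.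
  have q0 x : 0 <= pos q x by rewrite mulr_ge0//; case/andP: (qM _ (mx0 x)).
  have E := tail_flow (cpos _ cq) q0; split.
    rewrite -RintegralZl//; last exact: (weighted_tail_integrable hG cq qM).
    apply: (etrans (congr1 fine E)); apply: congr1; apply: eq_integral => x.
    by rewrite inE/= in_itv/= andbT => x0; rewrite posE// mulrA.
  have iT := weighted_tail_integrable hG (cpos _ cq) (posM _ qM).
  have I0 x : 0 <= \int[leb]_(u in `[0, x]) pos q u by apply: Rintegral_ge0 => u _.
  apply/integrableP; split.
    apply/measurable_EFinP; apply: measurable_funM; first exact: (density_measurable hG).
    have [K [dK KE]] := primitive_continuous (cpos _ cq).
    have cK : continuous (fun x : R => K (Num.max x 0)).
      apply: continuous_max0 => x x1; apply: differentiable_continuous.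
      by apply/derivable1_diffP; have := dK x x1; case.
    have mK : measurable_fun Rp (fun x : R => K (Num.max x 0) - K 0).
      apply: measurable_funTS; apply: measurable_funB => //.
      exact: continuous_measurable_fun.
    apply: eq_measurable_fun mK => x.
    by rewrite inE/= in_itv/= andbT => x0; rewrite (max_idPl x0) KE.
  rewrite (_ : (\int[_]_(_ in _) _)%E = \int[leb]_(u in Rp) (pos q u * T u)%:E)%E.
    by have := integrable_fin_num (measurable_itv _ : measurable Rp) iT; rewrite ltey_eq => ->.
  rewrite -E; apply: eq_integral => x; rewrite inE/= in_itv/= andbT => x0.
  by rewrite ger0_norm// mulr_ge0// (density_ge0 hG).
have [Er ir] := key r cr rM; have [Erho irho] := key rho crho rhoM.
have igr := weighted_density_integrable crho rhoM.
have split_int x : 0 <= x ->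
    g x * rho x + g x * \int[leb]_(u in `[0, x]) pos rho u =
    c * g x + g x * \int[leb]_(u in `[0, x]) pos r u.
  move=> x0; rewrite rhoE// (_ : \int[leb]_(u in `[0, x]) (a * (r u - rho u)) =
     \int[leb]_(u in `[0, x]) pos r u - \int[leb]_(u in `[0, x]) pos rho u); first by ring.
  rewrite -RintegralB//; [|exact: integrable_continuous_itv (cpos _ _)..].
  apply: eq_Rintegral => u; rewrite inE/= in_itv/= => /andP[u0 _].
  by rewrite !posE// mulrBr.
have igc : leb.-integrable Rp (EFin \o (fun x => c * g x)).
  exact: (integrableZl (measurable_itv _ : measurable Rp) c (density_integrable hG)).
have : \int[leb]_(x in Rp) (g x * rho x + g x * \int[leb]_(u in `[0, x]) pos rho u) =
       \int[leb]_(x in Rp) (c * g x + g x * \int[leb]_(u in `[0, x]) pos r u).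
  by apply: eq_Rintegral => x; rewrite inE/= in_itv/= andbT => x0; exact: split_int.
rewrite !RintegralD//.
rewrite (_ : \int[leb]_(x in Rp) (c * g x) = c); last first.
  rewrite RintegralZl//; last exact: (density_integrable hG).
  by rewrite /Rintegral (density_total hG) mulr1.
move: Er Erho; set X1 := \int[leb]_(x in Rp) _; set X2 := \int[leb]_(x in Rp) _.
set X3 := \int[leb]_(x in Rp) _; set X4 := \int[leb]_(x in Rp) _.
set X5 := \int[leb]_(x in Rp) _.
move=> -> -> H; rewrite mulrBr; lra.
Qed.

(** A zero integral would make [g] vanish almost everywhere, against its total mass 1. *)
Lemma density_integral_gt0 k : continuous k -> (forall x, 0 <= x -> 0 < k x) ->
  (0 < \int[leb]_(x in Rp) (g x * k x)%:E)%E.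
Proof.
move=> ck k0.
have gk0 x : Rp x -> (0 <= (g x * k x)%:E)%E.
  rewrite /= in_itv/= andbT => x0; rewrite lee_fin mulr_ge0 ?(density_ge0 hG)//.
  exact/ltW/k0.
rewrite lt_neqAle integral_ge0// andbT; apply/eqP => H.
have mgk : measurable_fun Rp (fun x => (g x * k x)%:E).
  apply/measurable_EFinP; apply: measurable_funM; first exact: (density_measurable hG).
  by apply: measurable_funTS; exact: continuous_measurable_fun.
have /(ae_eq_integral_abs _ _ mgk) ae0 : (\int[leb]_(x in Rp) `|(g x * k x)%:E| = 0)%E.
  rewrite [RHS]H; apply: eq_integral => x; rewrite inE => /gk0; exact: gee0_abs.
have g0 : ae_eq leb Rp (EFin \o g) (cst 0%E).
  apply: filterS (ae0 _) => // x /= E Dx; have := E Dx => /eqP.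
  move: Dx; rewrite in_itv/= andbT => x0.
  by rewrite eqe mulf_eq0 (gt_eqF (k0 x x0)) orbF => /eqP ->.
have E : (\int[leb]_(x in Rp) (g x)%:E = \int[leb]_(x in Rp) cst 0%E x)%E.
  apply: ae_eq_integral g0 => //.
  by apply/measurable_EFinP; exact: (density_measurable hG).
have /eqP := etrans (esym (density_total hG)) E.
by rewrite integral0 eqe oner_eq0.
Qed.

Lemma Rintegral_tail_age k :
  \int[leb]_(x in age) (k x * T x) = \int[leb]_(x in Rp) (k x * T x).
Proof. exact: (congr1 fine (integral_tail_age hG k)). Qed.

End Flow.

(** * Monotonicity of the queue lengths of a solution *)

Section QueueLengths.
Context {R : realType}.
Notation leb := (@lebesgue_measure R).
Notation Rp := (`[0%R, +oo[%classic : set (measurableTypeR R)).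
Variables (G g : R -> R) (lam : R) (d : nat).
Hypothesis hG : service_distribution G g.
Hypotheses (lam0 : 0 < lam) (lam1 : lam <= 1) (hd : (1 <= d)%N).
Notation T := (tail G).
Notation age := (age_space G).
Notation ages s := (age_fun (age_init lam d s) (age_rate lam d s)).
Variable s : nat -> R.
Hypothesis sE : forall l, s l.+1 = \int[leb]_(x in age) (ages s l.+1 x * T x).

(** In [flow_balance] the inflow is [lam] times a difference of [d]-th powers, by the factorization
    through [Pd], and its negative part cancels the initial value [lam (s (l + 2))^d]. *)
Lemma ages_flow M l : 0 <= s l.+1 -> 0 <= s l.+2 ->
  (forall x, 0 <= x -> 0 <= ages s l.+1 x <= M) ->
  (forall x, 0 <= x -> 0 <= ages s l.+2 x <= M) ->
  \int[leb]_(x in Rp) (g x * ages s l.+2 x) = lam * s l.+1 ^+ d.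
Proof.
move=> s1 s2 r1 r2.
have := flow_balance hG (@age_fun_continuous _ (age_init lam d s) (age_rate lam d s) l.+1)
  (@age_fun_continuous _ (age_init lam d s) (age_rate lam d s) l.+2)
  (mulr_ge0 (ltW lam0) (Pd_ge0 d s1 s2)) (mulr_ge0 (ltW lam0) (exprn_ge0 d s2))
  (@age_fun_int _ (age_init lam d s) (age_rate lam d s) l) r1 r2.
move=> ->; rewrite -!(Rintegral_tail_age hG) -!sE -mulrA (Pd_mulB d); ring.
Qed.

Hypothesis s_ge0 : forall l, 0 <= s l.+1.
Hypothesis ages_ge0 : forall l x, 0 <= x -> 0 <= ages s l.+1 x.

Lemma first_queue : s 1%N = lam.
Proof.
rewrite sE (Rintegral_tail_age hG) RintegralZl//; last exact: (tail_integrable hG).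
by rewrite /Rintegral (tail_total hG) mulr1.
Qed.

(* If s (l + 2) > s (l + 1), then ages (l + 2) > lam (s (l + 1))^d everywhere, so
   its integral against the density g exceeds the value prescribed by the flow. *)
Lemma queue_le_of_ages l : (forall x, 0 <= x -> lam * s l.+1 ^+ d <= ages s l.+1 x <= lam) ->
  s l.+2 <= s l.+1.
Proof.
move=> r1; rewrite leNgt; apply/negP => lt12.
have s1 := s_ge0 l; have s2 := s_ge0 l.+1.
set c := lam * s l.+1 ^+ d; set c' := lam * s l.+2 ^+ d.
have c0 : 0 <= c by rewrite mulr_ge0 ?(ltW lam0)// exprn_ge0.
have cc' : c < c' by rewrite ltr_pM2l// ltrXn2r// ?nnegrE// -lt0n.
have a0 : 0 <= age_rate lam d s l.+2 := mulr_ge0 (ltW lam0) (Pd_ge0 d s1 s2).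
have cr := @age_fun_continuous _ (age_init lam d s) (age_rate lam d s) l.+1.
have lb x : 0 <= x -> 0 < ages s l.+2 x - c.
  move=> x0; rewrite age_funS// subr_gt0.
  (* The solution with constant source [c] exceeds [c] by [c' - c] times an exponential, a positive
     amount. *)
  apply: (@lt_le_trans _ _ (volterra (age_rate lam d s l.+2) c' (cst c) x)).
    rewrite volterra_cst//; set e := expR _; have e0 : 0 < e := expR_gt0 _.
    have -> : c' * e + c * (1 - e) = c + (c' - c) * e by ring.
    by rewrite ltrDl mulr_gt0// subr_gt0.
  apply: volterra_le => //; first exact: cst_continuous.
  by move=> u u0 _; case/andP: (r1 u u0).
(* Nothing bounds [c'] by [lam] at this stage, hence the maximum. *)
have r1' x : 0 <= x -> 0 <= ages s l.+1 x <= Num.max lam c'.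
  by move=> x0; rewrite ages_ge0//= le_max; case/andP: (r1 x x0) => _ ->.
have r2 x : 0 <= x -> 0 <= ages s l.+2 x <= Num.max lam c'.
  move=> x0; rewrite ages_ge0//= age_funS//; apply: volterra_ubound => //.
    by move=> u u0 _; case/andP: (r1' u u0).
  by rewrite le_max lexx orbT.
have flow := ages_flow s1 s2 r1' r2.
have cr2 := @age_fun_continuous _ (age_init lam d s) (age_rate lam d s) l.+2.
have ck : continuous (fun x => ages s l.+2 x - c).
  by move=> x; apply: cvgB; [exact: cr2|exact: cvg_cst].
have kM x : 0 <= x -> 0 <= ages s l.+2 x - c <= Num.max lam c'.
  move=> x0; rewrite (ltW (lb x x0))/=; case/andP: (r2 x x0) => _.
  by apply: le_trans; rewrite gerBl.
have ik := weighted_density_integrable hG ck kM.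
have := density_integral_gt0 hG ck lb.
have -> : (\int[leb]_(x in Rp) (g x * (ages s l.+2 x - c))%:E)%E =
    (\int[leb]_(x in Rp) (g x * (ages s l.+2 x - c)))%:E.
  by rewrite /Rintegral fineK//; exact: integrable_fin_num ik.
have -> : \int[leb]_(x in Rp) (g x * (ages s l.+2 x - c)) =
    \int[leb]_(x in Rp) (g x * ages s l.+2 x) - \int[leb]_(x in Rp) (c * g x).
  rewrite -RintegralB//.
  - by apply: eq_Rintegral => x _; ring.
  - exact: (weighted_density_integrable hG cr2 r2).
  - exact: (integrableZl _ c (density_integrable hG)).
rewrite flow RintegralZl//; last exact: (density_integrable hG).
by rewrite /Rintegral (density_total hG) mulr1 subrr ltxx.
Qed.

(** Comparing two consecutive queue lengths needs bounds on the function of the lower level, and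
    these rest on the previous comparison. The bound on [s], monotonicity and the two-sided bounds
    are therefore carried by one induction. *)
Lemma ages_admissible : admissible s.
Proof.
suff P l : [/\ s l.+1 <= 1, {in `[0, +oo[ &, nondecreasing (ages s l.+1)} &
    forall x, 0 <= x -> lam * s l.+1 ^+ d <= ages s l.+1 x <= lam].
  split; [by case: (P 0%N)|exact: s_ge0|move=> l].
  by apply: queue_le_of_ages; case: (P l).
elim: l => [|l [s1 nd r1]].
  split; [by rewrite first_queue|by []|] => x x0.
  rewrite lexx andbT; apply: ler_piMr (ltW lam0) _; apply: exprn_ile1 => //.
  by rewrite first_queue.
have s21 := queue_le_of_ages r1.
have cr := @age_fun_continuous _ (age_init lam d s) (age_rate lam d s) l.+1.
have a0 : 0 <= age_rate lam d s l.+2 := mulr_ge0 (ltW lam0) (Pd_ge0 d (s_ge0 l) (s_ge0 l.+1)).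
have cle : age_init lam d s l.+2 <= ages s l.+1 0.
  case/andP: (r1 0 (lexx 0)) => + _; apply: le_trans.
  by rewrite ler_pM2l// lerXn2r// ?nnegrE.
have nd2 : {in `[0, +oo[ &, nondecreasing (ages s l.+2)}.
  move=> x y xp yp xy.
  have x0 : 0 <= x by move: xp; rewrite in_itv/= andbT.
  have y0 : 0 <= y by move: yp; rewrite in_itv/= andbT.
  by rewrite !age_funS//; apply: volterra_nondecreasing.
split=> //; first exact: le_trans s21 s1.
move=> x x0; apply/andP; split.
  rewrite -[X in X <= _](@age_fun0 _ (age_init lam d s) (age_rate lam d s) l.+1).
  by apply: nd2 => //; rewrite in_itv/= ?lexx ?andbT.
rewrite age_funS//; case/andP: (r1 x x0) => _; apply: le_trans.
exact: volterra_le_source.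
Qed.

End QueueLengths.

(** * Vanishing of the queue lengths *)

Section Vanishing.
Context {R : realType}.
Notation leb := (@lebesgue_measure R).
Notation Rp := (`[0%R, +oo[%classic : set (measurableTypeR R)).
Variables (G g : R -> R) (lam : R) (d : nat).
Hypothesis hG : service_distribution G g.
Hypotheses (lam0 : 0 < lam) (lam1 : lam < 1) (hd : (1 <= d)%N).
Notation T := (tail G).
Notation age := (age_space G).
Notation ages s := (age_fun (age_init lam d s) (age_rate lam d s)).
Variable s : nat -> R.
Hypothesis sa : admissible s.
Hypothesis sE : forall l, s l.+1 = \int[leb]_(x in age) (ages s l.+1 x * T x).

Lemma Pd_le (x y : R) : 0 <= x <= 1 -> 0 <= y <= 1 -> Pd d x y <= d%:R.
Proof.
move=> /andP[x0 x1] /andP[y0 y1]; rewrite /Pd.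
apply: (@le_trans _ _ (\sum_(m < d) (1 : R))); last by rewrite sumr_const card_ord.
by apply: ler_sum => i _; rewrite mulr_ile1 ?exprn_ge0 ?exprn_ile1.
Qed.

Let s01 l : 0 <= s l.+1 <= 1.
Proof.
case: sa => s1 s0 sd; rewrite s0/=; elim: l => [//|l ih]; exact: le_trans (sd l) ih.
Qed.

Let cr l := @age_fun_continuous _ (age_init lam d s) (age_rate lam d s) l.

(* ages (l + 2) exceeds lam (s (l + 2))^d by at most lam d times a telescoping
   term. *)
Lemma ages_cvg (y : R) x : 0 <= x -> s @ \oo --> y -> (fun l => ages s l x) @ \oo --> lam * y ^+ d.
Proof.
move=> x0 sy.
have [a0 c0 ndc] := admissible_conditions d lam0 sa.
(* [J] is nonincreasing and nonnegative, hence convergent, so its increments tend to 0. *)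
pose J l := \int[leb]_(u in `[0, x]) ages s l.+1 u.
have intJ l : leb.-integrable `[0, x] (EFin \o ages s l) := integrable_continuous_itv 0 x (@cr l).
have J0 l : 0 <= J l.
  by apply: Rintegral_ge0 => u; rewrite /= in_itv/= => /andP[u0 _]; case/andP: (ages_bounds d lam0 l sa u0).
have cvJ : cvgn J.
  apply: nonincreasing_is_cvgn.
    apply/nonincreasing_seqP => l; apply: le_Rintegral => //.
    move=> u; rewrite /= in_itv/= => /andP[u0 _]; exact: (age_funS_le a0 ndc l u0).
  by exists 0 => _ [l _ <-].
have dJ : (fun l => J l - J l.+1) @ \oo --> (0 : R).
  rewrite -(subrr (lim (J @ \oo))); apply: cvgB; first exact: cvJ.
  by rewrite cvg_shiftS; exact: cvJ.
have sd : (fun l => lam * s l ^+ d) @ \oo --> lam * y ^+ d.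
  apply: cvgM; first exact: cvg_cst.
  exact: (@cvg_comp _ _ _ s (fun z : R => z ^+ d) _ _ _ sy (@exprn_continuous _ d y)).
rewrite -(cvg_shiftn 2).
have sd2 : (fun l => lam * s (l + 2)%N ^+ d) @ \oo --> lam * y ^+ d.
  by rewrite (cvg_shiftn 2 (fun l => lam * s l ^+ d)).
have up : (fun l => lam * s (l + 2)%N ^+ d + lam * d%:R * (J l - J l.+1)) @ \oo --> lam * y ^+ d.
  rewrite -[X in _ --> X]addr0 -[X in _ + X](mulr0 (lam * d%:R)).
  by apply: cvgD => //; apply: cvgM => //; exact: cvg_cst.
apply: (squeeze_cvgr _ sd2 up); apply: nearW => l; rewrite /= !addn2.
have lo := age_fun_ge a0 ndc l.+1 x0.
apply/andP; split; first exact: lo.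
rewrite age_fun_int// lerD2l RintegralZl//; last exact: (integrableB _ (intJ _) (intJ _)).
rewrite RintegralB//.
apply: ler_wpM2r.
  rewrite subr_ge0; apply: le_Rintegral => // u; rewrite /= in_itv/= => /andP[u0 _].
  exact: (age_funS_le a0 ndc l u0).
exact: (ler_wpM2l (ltW lam0) (Pd_le (s01 l) (s01 l.+1))).
Qed.

Lemma queue_cvg0 : s @ \oo --> (0 : R).
Proof.
have [s1 s0 sd] := sa.
have cvs : cvgn s.
  have cvs : cvgn (fun l => s l.+1).
    apply: nonincreasing_is_cvgn; first exact/nonincreasing_seqP.
    by exists 0 => _ [l _ <-]; exact: s0.
  by apply/cvg_ex; exists (lim ((fun l => s l.+1) @ \oo)); rewrite -(cvg_shiftS s).
have sy : s @ \oo --> lim (s @ \oo) := cvs.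
move: sy; set y := lim _ => sy.
(* The functions of age are at most [lam], so [lam T] dominates the integrands. *)
have lim_int : (fun l => s l.+1) @ \oo --> \int[leb]_(x in Rp) (lam * y ^+ d * T x).
  under eq_fun do rewrite sE (Rintegral_tail_age hG).
  apply: (@cvg_param_integral _ _ R leb Rp (fun l x => ages s l.+1 x * T x)
    (fun x => lam * y ^+ d * T x) (fun x => lam * T x)) => //.
  - move=> l; apply: measurable_funTS; apply: continuous_measurable_fun => x.
    by apply: cvgM; [exact: cr|exact: (tail_continuous hG)].
  - apply: measurable_funM => //; apply: measurable_funTS; exact: (tail_measurable hG).
  - exact: (integrableZl _ lam (tail_integrable hG)).
  - move=> l x; rewrite /= in_itv/= andbT => x0; have /andP[r0 r1] := ages_bounds d lam0 l sa x0.
    by rewrite ger0_norm ?mulr_ge0 ?(tail_ge0 hG)// ler_wpM2r ?(tail_ge0 hG).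
  - move=> x; rewrite /= in_itv/= andbT => x0; apply: cvgM; last exact: cvg_cst.
    by rewrite (cvg_shiftS (fun l => ages s l x)); exact: ages_cvg.
have s' : (fun l => s l.+1) @ \oo --> y by rewrite (cvg_shiftS s).
have yE : y = lam * y ^+ d.
  have <- : \int[leb]_(x in Rp) (lam * y ^+ d * T x) = lam * y ^+ d.
    rewrite RintegralZl//; last exact: (tail_integrable hG).
    by rewrite /Rintegral (tail_total hG) mulr1.
  exact: (@cvg_unique _ (@Rhausdorff R) ((fun l => s l.+1) @ \oo)).
have y0 : 0 <= y.
  rewrite -(cvg_lim _ s')//; apply: limr_ge; first by apply/cvg_ex; exists y.
  exact: nearW.
have y1 : y <= 1.
  rewrite -(cvg_lim _ s')//; apply: limr_le; first by apply/cvg_ex; exists y.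
  by apply: nearW => l; case/andP: (s01 l).
(* With [y = lam y^d] this gives [y <= lam y], which leaves only [y = 0]. *)
have ydy : y ^+ d <= y by rewrite -[leRHS]expr1; apply: ler_wiXn2l.
suff <- : y = 0 by [].
apply/eqP; rewrite eq_le y0 andbT -(pmulr_rle0 _ (_ : 0 < 1 - lam)) ?subr_gt0//.
rewrite mulrBl mul1r subr_le0 {1}yE.
exact: (ler_wpM2l (ltW lam0)).
Qed.

End Vanishing.

(** * The cumulative function of a linear departure process *)

Section LinearCumulative.
Context {R : realType}.
Variable c : R.
Hypothesis c0 : 0 <= c.

Definition clipped_linear (x : R) : R := c * Num.max x 0.

Let clipped_linear_nd : {homo clipped_linear : x y / x <= y}.
Proof. by move=> x y xy; rewrite ler_wpM2l// ge_max !le_max xy lexx orbT. Qed.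

Let clipped_linear_rc : right_continuous clipped_linear.
Proof.
move=> x; apply: cvg_at_right_filter; apply: cvgM; first exact: cvg_cst.
by apply: (@continuous_max0 _ id) => y _; exact: cvg_id.
Qed.

HB.instance Definition _ := isCumulative.Build R _ R clipped_linear
  clipped_linear_nd clipped_linear_rc.

Lemma linear_cumulative : exists D : cumulative R R,
  forall x, D x = if 0 <= x then c * x else 0.
Proof.
exists (clipped_linear : cumulative R R) => x.
transitivity (c * Num.max x 0) => //; case: ifPn => x0; first by rewrite (max_idPl x0).
by rewrite (max_idPr _) ?mulr0// ltW// ltNge.
Qed.

End LinearCumulative.

(** * The invariant state built from an admissible solution *)

Section InvariantOfAges.
Context {R : realType}.
Notation leb := (@lebesgue_measure R).
Notation Rp := (`[0%R, +oo[%classic : set (measurableTypeR R)).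
Variables (G g : R -> R) (lam : R) (d : nat).
Hypothesis hG : service_distribution G g.
Hypotheses (lam0 : 0 < lam) (lam1 : lam < 1) (hd : (1 <= d)%N).
Notation T := (tail G).
Notation age := (age_space G).
Notation I := (aged_pairing G).
Notation ages s := (age_fun (age_init lam d s) (age_rate lam d s)).
Variable s : nat -> R.
Hypothesis sa : admissible s.
Hypothesis sE : forall l, s l.+1 = \int[leb]_(x in age) (ages s l.+1 x * T x).

Let cr l := @age_fun_continuous _ (age_init lam d s) (age_rate lam d s) l.

(** The mass of [ages T] at level [l + 1] is [s (l + 1) <= s 1 <= 1], so it defines a
    subprobability. *)
Lemma states_of_ages : exists nu : @mseq R, forall l,
  nu l.+1 (~` age) = 0%E /\ forall A : set (measurableTypeR R), measurable A -> A `<=` age ->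
    nu l.+1 A = (\int[leb]_(x in A) (ages s l.+1 x * T x)%:E)%E.
Proof.
have mRp : measurable Rp by [].
pose w l := (fun x => ages s l.+1 x * T x) \_ Rp.
have wE l x : 0 <= x -> w l x = ages s l.+1 x * T x.
  by move=> x0; rewrite /w patchE mem_set//= in_itv/= x0.
have mw l : measurable_fun [set: measurableTypeR R] (w l : measurableTypeR R -> R).
  apply/(measurable_restrictT _ mRp); apply: measurable_funTS.
  apply: continuous_measurable_fun => x.
  by apply: cvgM; [exact: cr|exact: (tail_continuous hG)].
have w0 l x : 0 <= w l x.
  rewrite /w patchE; case: ifPn => // /set_mem; rewrite /= in_itv/= andbT => x0.
  by rewrite mulr_ge0 ?(tail_ge0 hG)//; case/andP: (ages_bounds d lam0 l sa x0).
have w1 l : (\int[leb]_x (w l x)%:E <= 1)%E.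
  rewrite (_ : (\int[leb]_x _)%E = (\int[leb]_(x in Rp) (ages s l.+1 x * T x)%:E)%E); last first.
    rewrite [RHS]integral_mkcond; apply: eq_integral => x _.
    by rewrite /w !patchE; case: ifP.
  rewrite -(integral_tail_age hG) -(fineK (x := (\int[leb]_(x in age) _)%E)).
    have [s1 s0 sd] := sa; rewrite -[fine _](sE l) lee_fin.
    by elim: (l) => [//|n ih]; exact: le_trans (sd n) ih.
  have mage := age_space_measurable hG.
  have ageR : age `<=` Rp by move=> x ax /=; rewrite in_itv/= (age_ge0 ax).
  have iT := @ages_tail_integrable _ _ _ _ d hG lam0 s l sa.
  by apply: integrable_fin_num => //; exact: (integrableS mRp mage ageR iT).
have [nu nuE] := choice (fun l => subprobability_of_density (mw l) (w0 l) (w1 l)).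
(* The choice function gives level [l + 1] at index [l]; after the shift, index 0 is meaningless. *)
exists (fun l => nu l.-1) => l; split.
  rewrite nuE; apply: integral0_eq => x nax; rewrite /w patchE; case: ifPn => // /set_mem.
  by rewrite /= in_itv/= andbT => x0; rewrite (tail_out hG x0 nax) mulr0.
move=> A mA Aage; rewrite nuE; apply: eq_integral => x; rewrite inE => /Aage ax.
by rewrite wE//; exact: age_ge0 ax.
Qed.

Variable nu : @mseq R.
Hypothesis nu_out : forall l, nu l.+1 (~` age) = 0%E.
Hypothesis nuE : forall l (A : set (measurableTypeR R)), measurable A -> A `<=` age ->
  nu l.+1 A = (\int[leb]_(x in A) (ages s l.+1 x * T x)%:E)%E.

Let ages0 l x : 0 <= x -> 0 <= ages s l.+1 x.
Proof. by move=> x0; case/andP: (ages_bounds d lam0 l sa x0). Qed.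

Let nu_pairing l f u : continuous f -> 0 <= u -> pairing G (aged G f u) (nu l.+1) = I (ages s l.+1) f u.
Proof.
by move=> cf u0; exact: (pairing_aged_density hG (@cr l.+1) (@ages0 l) (nu_out l) (@nuE l) cf u0).
Qed.

Lemma mass_ages l : mass G (nu l.+1) = s l.+1.
Proof.
rewrite (massE hG) sE.
exact: (congr1 fine (nuE l (age_space_measurable hG) (@subset_refl _ _))).
Qed.

(* departure_rate l is <h, nu_(l+1)> *)
Definition departure_rate l := if l is _.+1 then lam * s l ^+ d else lam.

Lemma hazard_rate_ages l :
  hazard_rate G g (nu l.+1) = (departure_rate l)%:E.
Proof.
have [_ s0 _] := sa.
rewrite (hazard_rate_density hG (@cr l.+1) (nu_out l) (@nuE l)).
have rl k x : 0 <= x -> 0 <= ages s k.+1 x <= lam by exact: (ages_bounds d lam0 k sa).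
rewrite (integral_density_age hG (M := lam)); first last.
- exact: rl.
- by apply: measurable_funTS; apply: continuous_measurable_fun; exact: cr.
have ig := weighted_density_integrable hG (@cr l.+1) (rl l).
rewrite -(fineK (integrable_fin_num (measurable_itv _ : measurable Rp) ig)); congr (_%:E).
case: l ig => [|l] ig.
  apply: (etrans (y := \int[leb]_(x in Rp) (lam * g x))).
    by apply: eq_Rintegral => x _; rewrite mulrC.
  rewrite RintegralZl//; last exact: (density_integrable hG).
  by rewrite /Rintegral (density_total hG) mulr1.
exact: (ages_flow hG lam0 sE (s0 l) (s0 l.+1) (rl l) (rl l.+1)).
Qed.

Lemma in_S_ages : in_S G nu.
Proof.
have [a0 c0 ndc] := admissible_conditions d lam0 sa.
split; first by case.
case=> // l f _ /Cb_extension[f' [K [cf fK ff']]] f0.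
rewrite (eq_pairing G (nu l.+1) ff') (eq_pairing G (nu l.+2) ff').
rewrite -(pairing_aged0 hG (nu l.+1)) -(pairing_aged0 hG (nu l.+2)).
rewrite (nu_pairing l cf (lexx 0)) (nu_pairing l.+1 cf (lexx 0)).
have rl k x : 0 <= x -> 0 <= ages s k.+1 x <= lam by exact: (ages_bounds d lam0 k sa).
apply: le_Rintegral => //.
- exact: (aged_integrable hG (@cr l.+2) cf fK (rl l.+1) (lexx 0)).
- exact: (aged_integrable hG (@cr l.+1) cf fK (rl l) (lexx 0)).
move=> x; rewrite /= in_itv/= andbT => x0; rewrite addr0.
apply: ler_wpM2l; last exact: (age_funS_le a0 ndc l x0).
by rewrite mulr_ge0 ?(tail_ge0 hG)// -ff'// f0.
Qed.

(** For a state with density [ages T], the hydrodynamic equation is [transport_real] for [ages],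
    once its boundary and arrival terms are identified. *)
Let balance l f K t : continuous f -> (forall x, `|f x| <= K) -> 0 <= t ->
  forall D : cumulative R R, (forall x, D x = if 0 <= x then departure_rate l.+1 * x else 0) ->
  pairing G f (nu l.+1) = pairing G (aged G f t) (nu l.+1) +
    (\int[lebesgue_stieltjes_measure D]_(u in `[0, t]) (f (t - u) * T (t - u)) +
     \int[leb]_(u in `[0, t]) arrivals G lam d nu l.+1 (aged G f (t - u))).
Proof.
move=> cf fK t0 D DE.
have [a0 c0 ndc] := admissible_conditions d lam0 sa.
have h0 : 0 <= departure_rate l.+1 by case: sa => _ s0 _; rewrite mulr_ge0 ?(ltW lam0)// exprn_ge0.
rewrite -(pairing_aged0 hG) (nu_pairing l cf (lexx 0)) (nu_pairing l cf t0).
case: l DE h0 => [|l] DE h0.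
  apply/esym; apply: (etrans (congr1 _ (hydro_first lam d hG nu t h0 DE cf))); apply/esym.
  rewrite mass_ages.
  have cc : continuous (cst lam : R -> R) by exact: cst_continuous.
  have /= := @transport_real R G g hG 0 lam lam (cst lam) (cst lam) cc cc (ltW lam0) (lexx 0) _ _ _ f K t cf fK t0.
  move=> /(_ _ _ _)/= H.
  (* Departures from level 2 and external arrivals together start services at rate [lam], the
     constant function of level 1. *)
  have E : departure_rate 1 + lam * (1 - s 1%N ^+ d) = lam by rewrite /departure_rate; ring.
  rewrite E; apply: (etrans (H _ _ _)).
  - by move=> x x0; rewrite Rintegral_mul0 addr0.
  - by move=> x _; rewrite lexx (ltW lam0).
  - by [].
  - by rewrite Rintegral_mul0 addr0.
apply/esym; apply: (etrans (congr1 _ (hydro_next lam d hG nu t (isT : (1 < l.+2)%N) h0 DE cf fK))).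
apply/esym; rewrite !mass_ages addrA.
apply: (etrans (@transport_real R G g hG (age_rate lam d s l.+2) (age_init lam d s l.+2) lam
  (ages s l.+1) (ages s l.+2) (@cr l.+1) (@cr l.+2) (c0 l.+1) (a0 l) _ _ _ f K t cf fK t0)).
- by move=> x x0; exact: age_fun_int.
- by move=> x x0; rewrite ages0//= (age_funS_le a0 ndc l x0).
- by move=> x x0; case/andP: (ages_bounds d lam0 l sa x0).
congr (_ + _); apply: eq_Rintegral => u; rewrite inE/= in_itv/= => /andP[u0 _].
by rewrite !nu_pairing.
Qed.

Lemma physical_of_ages : physical_invariant_state G g lam d nu.
Proof.
have [a0 c0 ndc] := admissible_conditions d lam0 sa.
split; last first.
  have E : (fun l => s l.+1) = (fun l => mass G (nu l.+1)) by apply/funext => l; rewrite mass_ages.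
  have := queue_cvg0 hG lam0 lam1 hd sa sE.
  by rewrite -(cvg_shiftS s) E (cvg_shiftS (fun l => mass G (nu l))).
split; first exact: in_S_ages.
have h0 l : 0 <= departure_rate l.+1 by case: sa => _ s0 _; rewrite mulr_ge0 ?(ltW lam0)// exprn_ge0.
have depE l t : 0 <= t -> departures G g (fun=> nu) l.+1 t = departure_rate l * t.
  by move=> t0; rewrite (departuresE hG)// hazard_rate_ages.
split.
- split; first by move=> _ _; exact: in_S_ages.
  by move=> l f _ _; apply: continuous_subspaceT; exact: cst_continuous.
- by [].
- by move=> t t0; rewrite departures_extE// hazard_rate_ages -EFinM ltry.
- move=> t [//|l] t0 _; rewrite subrr !depE// (Rintegral_cst_itv _ t0).
  case: l => [|l].
    by rewrite (arrivals_first_total lam d hG) mass_ages /departure_rate; ring.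
  by rewrite (arrivals_total G lam)//= !mass_ages /departure_rate; ring.
- move=> [//|l] _; have [D DE] := linear_cumulative (h0 l).
  exists D; first by move=> u; rewrite DE; case: ifPn => // u0; rewrite depE.
  move=> t f t0 /Cb_extension[f' [K [cf fK ff']]].
  have agedE u x : 0 <= u -> 0 <= x -> aged G f u x = aged G f' u x.
    by move=> u0 x0; rewrite /aged ff'// addr_ge0.
  apply: (etrans (eq_pairing _ _ ff')); apply: (etrans (balance cf fK t0 DE)).
  apply: (etrans (addrA _ _ _)); apply: (congr2 +%R); first apply: (congr2 +%R).
  - by apply: eq_pairing => x x0; rewrite agedE.
  - apply: eq_Rintegral => u; rewrite inE/= in_itv/= => /andP[_ ut].
    by rewrite ff'// subr_ge0.
  - apply: eq_Rintegral => u; rewrite inE/= in_itv/= => /andP[_ ut].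
    by apply: arrivals_eq => x x0; rewrite agedE// subr_ge0.
Qed.

End InvariantOfAges.

(** * Existence of a solution *)

Section Existence.
Context {R : realType}.
Notation leb := (@lebesgue_measure R).
Notation Rp := (`[0%R, +oo[%classic : set (measurableTypeR R)).
Variables (G g : R -> R) (lam : R) (d : nat).
Hypothesis hG : service_distribution G g.
Hypotheses (lam0 : 0 < lam) (lam1 : lam <= 1).
Notation T := (tail G).
Notation age := (age_space G).
Notation ages s := (age_fun (age_init lam d s) (age_rate lam d s)).

Implicit Types (x y z : R) (f : R -> R).

(** The function of age that follows [f], of queue length [y], when its own queue length is guessed
    to be [z]; the true value is a fixed point in [z]. *)
Let next (y z : R) (f : R -> R) := volterra (lam * Pd d y z) (lam * z ^+ d) f.

Let next_bounds y z f x : continuous f -> {in `[0, +oo[ &, nondecreasing f} ->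
  (forall x, 0 <= x -> 0 <= f x) -> lam * y ^+ d <= f 0 -> 0 <= z <= y -> 0 <= x ->
  0 <= next y z f x <= f x.
Proof.
move=> cf nf f0 yf /andP[z0 zy] x0; have y0 := le_trans z0 zy.
have a0 : 0 <= lam * Pd d y z by rewrite mulr_ge0 ?(ltW lam0)// Pd_ge0.
apply/andP; split.
  by apply: volterra_lbound => //; [move=> u u0 _; exact: f0|rewrite mulr_ge0 ?(ltW lam0)// exprn_ge0].
apply: volterra_le_source => //; apply: le_trans yf.
by rewrite ler_pM2l// lerXn2r// nnegrE.
Qed.

(* Truncating the unknown to [0, y] makes the integrals below continuous in it on
   the whole line. *)
Let clip (y z : R) := Num.min y (Num.max z 0).

Let clip_bounds y z : 0 <= y -> 0 <= clip y z <= y.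
Proof. by move=> y0; rewrite /clip le_min ge_min y0 le_max !lexx orbT. Qed.

Let clip_continuous y : continuous (clip y).
Proof.
move=> z; apply: (@continuous_min R R (cst y) (fun z => Num.max z 0) z); first exact: cst_continuous.
by apply: (@continuous_max0 _ id) => u _; exact: cvg_id.
Qed.

Let rate_continuous y : continuous (fun z => lam * Pd d y (clip y z)).
Proof.
move=> z; apply: cvgM; first exact: cvg_cst.
apply: (@continuous_big R 'I_d (fun u v : R => u + v) 0 xpredT (fun u => @add_continuous R u)
  R (index_enum 'I_d) (fun (m : 'I_d) z => y ^+ m * clip y z ^+ (d.-1 - m))) => m _.
move=> u; apply: cvgM; first exact: cvg_cst.
exact: (@cvg_comp _ _ _ (clip y) (fun z : R => z ^+ (d.-1 - m)) _ _ _ (@clip_continuous y u)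
  (@exprn_continuous _ _ (clip y u))).
Qed.

Let expRN_continuous (a : R -> R) x : continuous a -> continuous (fun z => expR (- (a z * x))).
Proof.
move=> ca z; apply: (@continuous_comp _ _ _ (fun z => - (a z * x)) expR); last exact: continuous_expR.
by apply: cvgN; apply: cvgM; [exact: ca|exact: cvg_cst].
Qed.

(** The rates are nonnegative, so the exponential is at most 1 and [M] dominates the integrand for
    every [z]. *)
Let next_continuous y f x M : 0 <= y -> continuous f -> (forall x, 0 <= x -> 0 <= f x <= M) ->
  0 <= x -> continuous (fun z => next y (clip y z) f x).
Proof.
move=> y0 cf fM x0.
have ca := @rate_continuous y.
have a0 z : 0 <= lam * Pd d y (clip y z).
  by case/andP: (clip_bounds z y0) => z0 _; rewrite mulr_ge0 ?(ltW lam0)// Pd_ge0.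
have ci : continuous (fun z => \int[leb]_(u in `[0, x])
    (expR (- (lam * Pd d y (clip y z) * (x - u))) * f u)).
  apply: (@continuous_param_integral _ _ R leb `[0, x]%classic _ (cst M)) => //.
  - move=> z; apply: measurable_funTS; apply: continuous_measurable_fun => u.
    apply: cvgM; last exact: cf.
    apply: (@continuous_comp _ _ _ (fun u => - (lam * Pd d y (clip y z) * (x - u))) expR);
      last exact: continuous_expR.
    apply: cvgN; apply: cvgM; first exact: cvg_cst.
    by apply: cvgB; [exact: cvg_cst|exact: cvg_id].
  - by apply: integrable_continuous_itv; exact: cst_continuous.
  - move=> z u; rewrite /= in_itv/= => /andP[u0 ux]; have /andP[f0 f1] := fM u u0.
    rewrite ger0_norm ?mulr_ge0 ?expR_ge0//; apply: le_trans f1; apply: ler_piMl f0 _.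
    by rewrite -expR0 ler_expR oppr_le0 mulr_ge0// subr_ge0.
  - move=> u _ z; apply: cvgM; last exact: cvg_cst.
    exact: (@expRN_continuous _ (x - u) ca z).
move=> z; apply: cvgD.
  apply: cvgM; last exact: (@expRN_continuous _ x ca z).
  apply: cvgM; first exact: cvg_cst.
  exact: (@cvg_comp _ _ _ (clip y) (fun z : R => z ^+ d) _ _ _ (@clip_continuous y z)
    (@exprn_continuous _ _ (clip y z))).
by apply: cvgM; [exact: ca|exact: ci].
Qed.

(** Since [next] lies between 0 and [f], its integral [F z] lies in [[0, y]], so [F z - z] is
    nonnegative at 0 and nonpositive at [y]. *)
Lemma next_queue_exists y f : continuous f -> {in `[0, +oo[ &, nondecreasing f} ->
  (forall x, 0 <= x -> 0 <= f x <= lam) -> 0 <= y -> y = \int[leb]_(x in Rp) (f x * T x) ->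
  lam * y ^+ d <= f 0 ->
  exists2 z, 0 <= z <= y & z = \int[leb]_(x in Rp) (next y z f x * T x).
Proof.
move=> cf nf fM y0 yE yf.
have f0 x : 0 <= x -> 0 <= f x by move=> x0; case/andP: (fM x x0).
have nb z x : 0 <= x -> 0 <= next y (clip y z) f x <= f x.
  by move=> x0; apply: next_bounds => //; exact: clip_bounds.
have nc z : continuous (fun x => next y (clip y z) f (Num.max x 0)) by exact: volterra_continuous.
have mx (x : R) : 0 <= Num.max x 0 by rewrite le_max lexx orbT.
pose F z := \int[leb]_(x in Rp) (next y (clip y z) f (Num.max x 0) * T x).
have cF : continuous F.
  apply: (@continuous_param_integral _ _ R leb Rp
    (fun z x => next y (clip y z) f (Num.max x 0) * T x) (fun x => lam * T x)) => //.
  - move=> z; apply: measurable_funTS; apply: continuous_measurable_fun => x.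
    by apply: cvgM; [exact: nc|exact: (tail_continuous hG)].
  - exact: (integrableZl _ lam (tail_integrable hG)).
  - move=> z x; rewrite /= in_itv/= andbT => x0; rewrite (max_idPl x0).
    have /andP[n0 n1] := nb z x x0; have /andP[_ f1] := fM x x0.
    by rewrite ger0_norm ?mulr_ge0 ?(tail_ge0 hG)// ler_wpM2r ?(tail_ge0 hG)// (le_trans n1).
  - move=> x _ z; apply: cvgM; last exact: cvg_cst.
    exact: next_continuous fM (mx x) z.
have F0 z : 0 <= F z.
  apply: Rintegral_ge0 => x _; rewrite mulr_ge0 ?(tail_ge0 hG)//.
  by case/andP: (nb z _ (mx x)).
have Fy z : F z <= y.
  rewrite yE; apply: le_Rintegral => //.
  - apply: (@weighted_tail_integrable R G g hG _ lam (nc z)) => x x0.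
    rewrite (max_idPl x0); have /andP[n0 n1] := nb z x x0; have /andP[_ f1] := fM x x0.
    by rewrite n0 (le_trans n1).
  - exact: (weighted_tail_integrable hG cf fM).
  - move=> x; rewrite /= in_itv/= andbT => x0; rewrite ler_wpM2r ?(tail_ge0 hG)//.
    by rewrite (max_idPl x0); case/andP: (nb z x x0).
have cFz : {within `[0, y], continuous (fun z => F z - z)}.
  by apply: continuous_subspaceT => z; apply: cvgB; [exact: cF|exact: cvg_id].
have [|z] := IVT y0 cFz (v := 0).
  have := F0 0; have := Fy y; move: (F y) (F 0) => v0 v1 v0y v10.
  by rewrite ge_min le_max subr0 subr_le0 v0y orbT v10.
move=> + /subr0_eq Fz; rewrite in_itv/= => zy; exists z; first exact: zy.
have clipE : clip y z = z by case/andP: zy => z0 zy; rewrite /clip (max_idPl z0) (min_idPr zy).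
apply: (etrans (esym Fz)); apply: eq_Rintegral => x; rewrite inE/= in_itv/= andbT => x0.
by rewrite clipE (max_idPl x0).
Qed.

(** The invariant of the recursion on pairs of a queue length and a function of age: what the
    intermediate value step asks of the previous level. *)
Let good (p : R * (R -> R)) := [/\ continuous p.2, {in `[0, +oo[ &, nondecreasing p.2},
  forall x, 0 <= x -> 0 <= p.2 x <= lam, 0 <= p.1 &
  p.1 = \int[leb]_(x in Rp) (p.2 x * T x) /\ lam * p.1 ^+ d <= p.2 0].

Lemma queue_sequence_exists : exists s : nat -> R, admissible s /\
  forall l, s l.+1 = \int[leb]_(x in age) (ages s l.+1 x * T x).
Proof.
(* [good p] stands under the existential so that the choice function is total. *)
have ex p : exists z, good p -> 0 <= z <= p.1 /\ z = \int[leb]_(x in Rp) (next p.1 z p.2 x * T x).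
  have [gp|ngp] := pselect (good p); last by exists 0 => /ngp.
  have [c2 n2 b2 y0 [yE yf]] := gp.
  by have [z z1 z2] := next_queue_exists c2 n2 b2 y0 yE yf; exists z.
have [zf zfP] := choice ex.
pose step p := (zf p, fun x : R => next p.1 (zf p) p.2 (Num.max x 0)).
have good_step p : good p -> good (step p).
  move=> gp; have [zy zE] := zfP p gp; have [c2 n2 b2 y0 [yE yf]] := gp.
  have z0 : 0 <= zf p by case/andP: zy.
  have b2' x : 0 <= x -> 0 <= p.2 x by move=> x0; case/andP: (b2 x x0).
  have a0 : 0 <= lam * Pd d p.1 (zf p) by rewrite mulr_ge0 ?(ltW lam0)// Pd_ge0.
  have cf : lam * zf p ^+ d <= p.2 0.
    by apply: le_trans yf; rewrite ler_pM2l// lerXn2r// ?nnegrE//; case/andP: zy.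
  split.
  - exact: volterra_continuous.
  - move=> x y xp yp xy.
    have x0 : 0 <= x by move: xp; rewrite in_itv/= andbT.
    have y'0 : 0 <= y by move: yp; rewrite in_itv/= andbT.
    rewrite /= (max_idPl x0) (max_idPl y'0).
    exact: (volterra_nondecreasing c2 a0 n2 cf).
  - move=> x x0; rewrite /= (max_idPl x0).
    have /andP[-> n1] := next_bounds c2 n2 b2' yf zy x0; have /andP[_ f1] := b2 x x0.
    exact: le_trans n1 f1.
  - exact: z0.
  - split.
      apply: (etrans zE); apply: eq_Rintegral => x; rewrite inE/= in_itv/= andbT => x0.
      by rewrite /= (max_idPl x0).
    by rewrite /= (max_idPl (lexx 0)) /next volterra0.
have good0 : good (lam, cst lam).
  split=> //=.
  - exact: cst_continuous.
  - by move=> x _; rewrite lexx (ltW lam0).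
  - exact: ltW.
  - split; last by apply: ler_piMr (ltW lam0) _; apply: exprn_ile1; rewrite ?(ltW lam0).
    rewrite RintegralZl//; last exact: (tail_integrable hG).
    by rewrite /Rintegral (tail_total hG) mulr1.
pose u l := iter l step (lam, cst lam).
have gu l : good (u l) by elim: l => [//|l ih]; exact: good_step ih.
(* Iteration starts at level 1, so level [l + 1] is the iterate [u l]. *)
pose s (l : nat) := (u l.-1).1.
have agesE l : ages s l.+1 = (u l).2.
  elim: l => [//|l ih].
  by transitivity (fun x : R => next (s l.+1) (s l.+2) (ages s l.+1) (Num.max x 0)) => //; rewrite ih.
exists s; split.
  split; first exact: lam1.
  - by move=> l; case: (gu l).
  - by move=> l; case: (zfP _ (gu l)) => /andP[].
move=> l; rewrite agesE (Rintegral_tail_age hG).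
by case: (gu l) => _ _ _ _ [].
Qed.

End Existence.

(** * Correspondence between physical states and solutions *)

Section AgesOfStates.
Context {R : realType}.
Notation leb := (@lebesgue_measure R).
Variables (G g : R -> R) (lam : R) (d : nat).
Hypothesis hG : service_distribution G g.
Hypotheses (lam0 : 0 < lam) (hd : (1 <= d)%N).
Notation T := (tail G).
Notation age := (age_space G).
Notation ages s := (age_fun (age_init lam d s) (age_rate lam d s)).

Lemma physical_of_age_system (r : nat -> R -> R) : lam < 1 -> age_system G lam d r ->
  (forall l x, (1 <= l)%N -> age x -> 0 <= r l x) ->
  exists2 nu : mseq, physical_invariant_state G g lam d nu & state_of_ages G nu r.
Proof.
move=> lam1 rS r0; pose s := queue_length G r.
have rE l x : age x -> r l.+1 x = ages s l.+1 x by move=> ax; exact: (age_system_unique hG rS).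
have sE l : s l.+1 = \int[leb]_(x in age) (ages s l.+1 x * T x).
  by apply: eq_Rintegral => x; rewrite inE => ax; rewrite rE.
have s0 l : 0 <= s l.+1.
  by apply: Rintegral_ge0 => x ax; rewrite mulr_ge0 ?(tail_ge0 hG)// r0.
(* The sign of [r] is known only on the age space; beyond it, nonnegative initial values and rates
   keep [ages] nonnegative. *)
have ages0 l x : 0 <= x -> 0 <= ages s l.+1 x.
  elim: l x => [|l ih] x x0; first exact: ltW.
  rewrite age_funS//; apply: volterra_lbound => //.
  - exact: age_fun_continuous.
  - exact: (mulr_ge0 (ltW lam0) (Pd_ge0 d (s0 l) (s0 l.+1))).
  - by move=> u u0 _; exact: ih.
  - exact: (mulr_ge0 (ltW lam0) (exprn_ge0 d (s0 l.+1))).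
have sa := ages_admissible hG lam0 (ltW lam1) hd sE s0 ages0.
have [nu nuE] := states_of_ages hG lam0 sa sE.
exists nu; first exact: (physical_of_ages hG lam0 lam1 hd sa sE (fun l => (nuE l).1) (fun l => (nuE l).2)).
move=> [//|l] A _ mA Aage; rewrite (nuE l).2//.
by apply: eq_integral => x; rewrite inE => /Aage ax; rewrite rE.
Qed.

Lemma age_system_of_physical (nu : mseq) : physical_invariant_state G g lam d nu ->
  exists2 r, age_system G lam d r & state_of_ages G nu r.
Proof.
move=> [hnu hphys]; pose s l := mass G (nu l).
have sa := invariant_admissible hG hnu (fun=> erefl).
have sE := invariant_mass hG lam0 hd hnu (fun=> erefl) (fun=> erefl) hphys.
exists (fun l => ages s l \_ age).
  by have [] := age_system_of_ages hG lam0 sa sE.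
move=> [//|l] A _ mA Aage.
rewrite (invariant_density hG lam0 hd hnu (fun=> erefl) (fun=> erefl) hphys l mA Aage).
by apply: eq_integral => x; rewrite inE => /Aage ax; rewrite patchE mem_set.
Qed.

Lemma state_of_age_system (nu : mseq) (r : nat -> R -> R) :
  physical_invariant_state G g lam d nu -> age_system G lam d r ->
  (forall l, (1 <= l)%N -> queue_length G r l = mass G (nu l)) -> state_of_ages G nu r.
Proof.
move=> [hnu hphys] rS rs [//|l] A _ mA Aage.
rewrite (invariant_density hG lam0 hd hnu (fun=> erefl) (fun=> erefl) hphys l mA Aage).
apply: eq_integral => x; rewrite inE => /Aage ax.
by rewrite (age_system_unique hG rS rs).
Qed.

Lemma physical_state_exists : lam < 1 -> exists nu : mseq, physical_invariant_state G g lam d nu.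
Proof.
move=> lam1; have [s [sa sE]] := queue_sequence_exists d hG lam0 (ltW lam1).
have [nu nuE] := states_of_ages hG lam0 sa sE.
exists nu; exact: (physical_of_ages hG lam0 lam1 hd sa sE (fun l => (nuE l).1) (fun l => (nuE l).2)).
Qed.

Lemma departure_integral (nu : mseq) (r : nat -> R -> R) :
  physical_invariant_state G g lam d nu -> age_system G lam d r -> state_of_ages G nu r ->
  forall l, (2 <= l)%N -> (lam * mass G (nu l.-1) ^+ d)%:E =
    (\int[leb]_(x in age) (g x * r l x)%:E)%E.
Proof.
move=> [hnu hphys] rS rnu [//|[//|l]] _.
(* [state_of_ages] evaluated on the whole age space. *)
have rs k : (1 <= k)%N -> queue_length G r k = mass G (nu k).
  move=> k1; rewrite (massE hG).
  exact: (esym (congr1 fine (rnu k age k1 (age_space_measurable hG) (@subset_refl _ _)))).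
apply: (etrans (departure_balance hG lam0 hd hnu (fun=> erefl) (fun=> erefl) hphys l)).
apply: eq_integral => x; rewrite inE => ax.
by rewrite (age_system_unique hG rS rs).
Qed.

End AgesOfStates.

Theorem theorem3p3 (R : realType) (G g : R -> R) (lam : R) (d : nat)
    (hG : service_distribution G g)
    (hlam0 : 0 < lam) (hlam1 : lam <= 1) (hd : (1 <= d)%N)
    (hA2 : hydrodynamic_well_posed G g lam d) :
  [/\ (* at lam = 1 the solution r = 1 exists (s_l = 1) but no physical
         invariant state does, hence the guards lam < 1 *)
      lam < 1 ->
        ((exists nu : mseq, physical_invariant_state G g lam d nu) <->
         (exists r : nat -> R -> R, age_system G lam d r)),
      (* every physical invariant state comes from a solution r, and is
         related to each solution r with the same s^* *)
      forall nu : mseq, physical_invariant_state G g lam d nu ->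
        (exists2 r : nat -> R -> R,
           age_system G lam d r & state_of_ages G nu r) /\
        (forall r : nat -> R -> R, age_system G lam d r ->
           (forall l, (1 <= l)%N -> queue_length G r l = mass G (nu l)) ->
           state_of_ages G nu r),
      (* a solution r defining measures gives a physical invariant state *)
      lam < 1 -> forall r : nat -> R -> R, age_system G lam d r ->
        (forall l x, (1 <= l)%N -> age_space G x -> 0 <= r l x) ->
        exists2 nu : mseq,
          physical_invariant_state G g lam d nu & state_of_ages G nu r,
      lam < 1 -> exists nu : mseq, physical_invariant_state G g lam d nu
    &
      forall (nu : mseq) (r : nat -> R -> R),
        physical_invariant_state G g lam d nu ->
        age_system G lam d r -> state_of_ages G nu r ->
        forall l, (2 <= l)%N ->
          (lam * mass G (nu l.-1) ^+ d)%:E =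
          (\int[lebesgue_measure]_(x in age_space G) (g x * r l x)%:E)%E].
Proof.
have exist := physical_state_exists hG hlam0 hd.
have ages_of_state nu := @age_system_of_physical R G g lam d hG hlam0 hd nu.
split=> //.
- move=> lam1; split; last by move=> _; exact: exist.
  by move=> [nu /ages_of_state[r rS _]]; exists r.
- move=> nu hnu; split; first exact: ages_of_state.
  by move=> r; exact: (state_of_age_system hG hlam0 hd hnu).
- by move=> lam1 r; exact: physical_of_age_system.
- by move=> nu r; exact: departure_integral.
Qed.
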